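(* Let $m,\lambda,\beta,\gamma,k_BT>0$ be constants, let $K$ satisfy the kernel assumptions (I) and (II) listed in the context, and let $F$ and $\dot W$ be the uncorrelated stationary random distributions described in the context. Let $\Phi=(X,V)$ be a stationary operator (with $d=2$) with spectral measure $\nu$. Then $\Phi=(X,V)$ is a weak stationary solution (in the sense defined in the context) of the generalized Langevin system $$\dot x(t)=v(t),\qquad m\dot v(t)=-\lambda v(t)-\gamma x(t)-\beta\int_{-\infty}^tK(t-s)v(s)\,ds+\sqrt{\beta k_BT}\,F(t)+\sqrt{2\lambda k_BT}\,\dot W(t)$$ if and only if its spectral measure is $$\nu(d\omega)=\frac{k_BT}{2\pi}\big(r_{ij}(\omega)\,d\omega\big)_{1\le i,j\le 2},$$ where (for a.e. $\omega$) $$r_{11}(\omega)=\frac{2\lambda+\beta\widehat K(\omega)}{\big|\gamma-m\omega^2+\mathrm{i}\omega\big(\lambda+\beta\widehat{K^+}(\omega)\big)\big|^2},\qquad r_{22}(\omega)=\omega^2r_{11}(\omega),\qquad r_{12}(\omega)=\overline{r_{21}(\omega)}=\mathrm{i}\omega\, r_{11}(\omega).$$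
   Context: Fourier conventions. $\widehat f(\omega)=\int_{\mathbb R}f(t)e^{-\mathrm{i}t\omega}dt$. $\mathcal S$ is the Schwartz space on $\mathbb R$ and $\mathcal S'$ its dual; the Fourier transform $\mathcal F[g]$ of $g\in\mathcal S'$ is defined by $\langle\mathcal F[g],\varphi\rangle=\langle g,\widehat\varphi\rangle$, $\varphi\in\mathcal S$. $L^2(\Omega)$ is the space of square-integrable complex-valued random variables. Kernel assumptions. $K:\mathbb R\to\mathbb R\cup\{\infty\}$ is real-valued for $t\ne0$ (possibly infinite at $t=0$). (I) (a) $K\in L^1_{loc}(\mathbb R)$ is symmetric around zero and positive for all nonzero $t$; (b) $K(t)\to0$ as $t\to\infty$ and $K$ is eventually decreasing; (c) the improper integral $\mathcal K_{\cos}(\omega)=\int_0^\infty K(t)\cos(\omega t)\,dt$ is positive for all nonzero $\omega$. (II) Either (a) $K\in L^1(\mathbb R)$; or (b) $K(t)\sim t^{-1}$ as $t\to\infty$; or (c) there is $\alpha\in(0,1)$ with $K(t)\sim t^{-\alpha}$ as $t\to\infty$. Here $f(t)\sim g(t)$ means $\lim_{t\to\infty}f(t)/g(t)=c$ for some $c\in(0,\infty)$. Set $K^+(t)=K(t)1_{[0,\infty)}(t)$ and $\mathcal K_{\sin}(\omega)=\int_0^\infty K(t)\sin(\omega t)\,dt$ (improper integral). For $\omega\neq0$, $\widehat K(\omega)=2\mathcal K_{\cos}(\omega)$ and $\widehat{K^+}(\omega)=\mathcal K_{\cos}(\omega)-\mathrm{i}\mathcal K_{\sin}(\omega)$. Noise.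 $F,\dot W:\mathcal S\to L^2(\Omega)$ are stationary random distributions (linear functionals on $\mathcal S$ whose first and second moments are invariant under translation of test functions) with, for $\varphi_1,\varphi_2\in\mathcal S$, $$\mathbb E[\langle\dot W,\varphi_1\rangle\overline{\langle\dot W,\varphi_2\rangle}]=\frac1{2\pi}\int_{\mathbb R}\widehat{\varphi_1}\,\overline{\widehat{\varphi_2}}\,d\omega,\quad \mathbb E[\langle F,\varphi_1\rangle\overline{\langle F,\varphi_2\rangle}]=\frac1{2\pi}\int_{\mathbb R}2\mathcal K_{\cos}(\omega)\widehat{\varphi_1}(\omega)\overline{\widehat{\varphi_2}(\omega)}\,d\omega,\quad \mathbb E[\langle\dot W,\varphi_1\rangle\overline{\langle F,\varphi_2\rangle}]=0.$$ Stationary operators ($d=2$). Let $\nu=(\nu_{ij})_{1\le i,j\le2}$ be a Borel measure with values in the Hermitian positive semidefinite matrices, absolutely continuous with respect to Lebesgue measure, with $\int_{\mathbb R}\frac{\|\nu(d\omega)\|}{(1+\omega^2)^p}<\infty$ for some $p\in\mathbb R$. A random measure with respect to $\nu$ is a map $Z=(Z_1,Z_2)$ from the Borel sets $E$ with $\|\nu(E)\|<\infty$ to $L^2(\Omega)^2$ with $\mathbb E[Z(E_1)Z(E_2)^*]=\nu(E_1\cap E_2)$. The associated stationary operator $\Phi=(X,V)$, with spectral measure $\nu$, is $\langle\Phi,g\rangle=\int_{\mathbb R}\mathcal F[g](\omega)\,Z(d\omega)$; componentwise, $\langle X,g\rangle=\int\mathcal F[g]\,dZ_1$ and $\langle V,g\rangle=\int\mathcal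 F[g]\,dZ_2$, defined for those $g\in\mathcal S'$ whose Fourier transform is a function belonging to $L^2(\nu_{11})$, respectively $L^2(\nu_{22})$. Weak stationary solution. For $\varphi\in\mathcal S$ let $$\Psi(\varphi)(t)=-m\varphi'(t)+\lambda\varphi(t)+\beta\int_0^\infty K(s)\varphi(t+s)\,ds .$$ A stationary operator $\Phi=(X,V)$ is a weak stationary solution if: (a) for all $\varphi\in\mathcal S$, $\mathbb E|\langle V,\Psi(\varphi)\rangle|^2<\infty$ (in particular $\langle V,\Psi(\varphi)\rangle$ is defined); (b) for all $\varphi_1,\varphi_2\in\mathcal S$, $$\mathbb E[\langle X,-\varphi_1'\rangle\overline{\langle X,-\varphi_2'\rangle}]=\mathbb E[\langle V,\varphi_1\rangle\overline{\langle V,\varphi_2\rangle}]=\mathbb E[\langle X,-\varphi_1'\rangle\overline{\langle V,\varphi_2\rangle}]$$ and $$\mathbb E\Big[\big(\langle V,\Psi(\varphi_1)\rangle+\langle X,\gamma\varphi_1\rangle\big)\overline{\big(\langle V,\Psi(\varphi_2)\rangle+\langle X,\gamma\varphi_2\rangle\big)}\Big]=k_BT\Big(\beta\,\mathbb E[\langle F,\varphi_1\rangle\overline{\langle F,\varphi_2\rangle}]+2\lambda\,\mathbb E[\langle\dot W,\varphi_1\rangle\overline{\langle\dot W,\varphi_2\rangle}]\Big).$$ *)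

(* Defs.v *)
From HB Require Import structures.
From mathcomp Require Import all_boot all_order all_algebra.
From mathcomp Require Import all_classical all_reals all_analysis.
From mathcomp Require Import complex.

Set Implicit Arguments.
Unset Strict Implicit.
Unset Printing Implicit Defensive.

Import Order.TTheory GRing.Theory Num.Theory.
Import numFieldNormedType.Exports.

Local Open Scope classical_set_scope.
Local Open Scope ring_scope.
Local Open Scope complex_scope.

Local Notation leb := lebesgue_measure.

(* The analysis library has no topological or measurable structure on [R[i]]:
   measurability, integration and differentiation of complex-valued functions
   are taken separately on real and imaginary parts. *)

Section ComplexValued.
Context {d : measure_display} {T : measurableType d} {R : realType}.
Variable mu : {measure set T -> \bar R}.
Implicit Types (f : T -> R[i]) (D : set T).

Definition cmod (z : R[i]) : R := ComplexField.Normc.normc z.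

Definition cmeasurable f :=
  measurable_fun setT (fun x => complex.Re (f x)) /\
  measurable_fun setT (fun x => complex.Im (f x)).

Definition cintegrable D f :=
  mu.-integrable D (fun x => (complex.Re (f x))%:E) /\
  mu.-integrable D (fun x => (complex.Im (f x))%:E).

Definition cint D f : R[i] :=
  Rintegral mu D (fun x => complex.Re (f x)) +i*
  Rintegral mu D (fun x => complex.Im (f x)).

Definition sqnormL2 f : \bar R := (\int[mu]_x ((cmod (f x)) ^+ 2)%:E)%E.

(* Elements of L^2 are represented by functions; almost everywhere equal
   functions stand for the same element. *)
Definition L2 f := cmeasurable f /\ (sqnormL2 f < +oo)%E.

End ComplexValued.

Section Schwartz.
Context {R : realType}.
Implicit Types (f phi : R -> R[i]) (g : (R -> R[i]) -> R[i]) (h : R -> R[i]).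

Definition cderiven n f : R -> R[i] := fun t =>
  derive1n n (fun u => complex.Re (f u)) t +i*
  derive1n n (fun u => complex.Im (f u)) t.

Definition smooth f := forall n t,
  derivable (derive1n n (fun u => complex.Re (f u))) t 1 /\
  derivable (derive1n n (fun u => complex.Im (f u))) t 1.

Definition weighted j k f : set R :=
  range (fun t : R => `|t| ^+ j * cmod (cderiven k f t)).

Definition schwartz phi := smooth phi /\ forall j k, has_ubound (weighted j k phi).

Definition schwartz_seminorm j k phi : R := sup (weighted j k phi).

Definition fourier phi : R -> R[i] := fun w =>
  cint leb setT (fun t => phi t * (cos (t * w) -i* sin (t * w))).

(* A tempered distribution is a functional on all functions [R -> R[i]] of which
   only the values on Schwartz functions matter. *)
Definition tempered g :=
  (forall (a : R[i]) phi1 phi2, schwartz phi1 -> schwartz phi2 ->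
    g (fun t => a * phi1 t + phi2 t) = a * g phi1 + g phi2) /\
  (exists (C : R) (N : nat), forall phi, schwartz phi ->
    cmod (g phi) <= C * \sum_(j < N) \sum_(k < N) schwartz_seminorm j k phi).

(* Distribution induced by a function; the pairing is bilinear, not
   sesquilinear. *)
Definition distr f : (R -> R[i]) -> R[i] :=
  fun phi => cint leb setT (fun t => f t * phi t).

(* The Fourier transform of the tempered distribution [g] is the function [h]:
   <g, fourier phi> = int h phi for all Schwartz phi. *)
Definition fourier_is_fun g h :=
  cmeasurable h /\
  forall phi, schwartz phi ->
    cintegrable leb setT (fun w => h w * phi w) /\
    g (fourier phi) = distr h phi.

End Schwartz.

Section Kernel.
Context {R : realType}.
Variable K : R -> \bar R.

Definition kreal (t : R) : R := fine (K t).

Definition Kcos (w : R) : R :=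
  lim ((Rintegral leb `[0, b] (fun t => kreal t * cos (w * t))) @[b --> +oo]).

Definition Ksin (w : R) : R :=
  lim ((Rintegral leb `[0, b] (fun t => kreal t * sin (w * t))) @[b --> +oo]).

Definition Khat (w : R) : R := 2 * Kcos w.

Definition Kplus_hat (w : R) : R[i] := Kcos w -i* Ksin w.

(* f(t) ~ g(t) as t -> +oo, up to a positive constant *)
Definition asymp (f g : R -> R) :=
  exists2 c : R, 0 < c & f t / g t @[t --> +oo] --> c.

Definition kernel_valued :=
  K 0 != -oo%E /\ forall t, t != 0 -> K t \is a fin_num.

Definition kernel_I :=
  [/\ locally_integrable setT kreal,
      (forall t, K (- t) = K t),
      (forall t, t != 0 -> (0 < K t)%E),
      (kreal t @[t --> +oo] --> (0 : R)) /\
      (exists M : R, forall s t, M <= s -> s <= t -> (K t <= K s)%E)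
    & forall w, w != 0 -> 0 < Kcos w].

Definition kernel_II :=
  [\/ leb.-integrable setT (EFin \o kreal),
      asymp kreal (fun t => t^-1)
    | exists2 alpha : R, 0 < alpha < 1 & asymp kreal (fun t => t `^ (- alpha))].

End Kernel.

Section RandomDistributions.
Context {d : measure_display} {T : measurableType d} {R : realType}.
Variable P : probability T R.
Implicit Types (Y : T -> R[i]) (F : (R -> R[i]) -> T -> R[i]).

Definition cexp Y : R[i] := cint P setT Y.

Definition second_moment Y1 Y2 : R[i] := cexp (fun x => Y1 x * conjc (Y2 x)).

Definition random_distribution F :=
  (forall phi, schwartz phi -> L2 P (F phi)) /\
  (forall (a : R[i]) phi1 phi2, schwartz phi1 -> schwartz phi2 ->
    {ae P, forall x,
      F (fun t => a * phi1 t + phi2 t) x = a * F phi1 x + F phi2 x}).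

Definition stationary F :=
  (forall (u : R) phi, schwartz phi ->
    cexp (F (fun t => phi (t + u))) = cexp (F phi)) /\
  (forall (u : R) phi1 phi2, schwartz phi1 -> schwartz phi2 ->
    second_moment (F (fun t => phi1 (t + u))) (F (fun t => phi2 (t + u))) =
    second_moment (F phi1) (F phi2)).

Definition white_noise (W : (R -> R[i]) -> T -> R[i]) :=
  [/\ random_distribution W, stationary W &
    forall phi1 phi2, schwartz phi1 -> schwartz phi2 ->
      second_moment (W phi1) (W phi2) =
      ((2 * pi)^-1)%:C *
      cint leb setT (fun w => fourier phi1 w * conjc (fourier phi2 w))].

Definition kernel_noise (K : R -> \bar R) (F : (R -> R[i]) -> T -> R[i]) :=
  [/\ random_distribution F, stationary F &
    forall phi1 phi2, schwartz phi1 -> schwartz phi2 ->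
      second_moment (F phi1) (F phi2) =
      ((2 * pi)^-1)%:C *
      cint leb setT (fun w =>
        (2 * Kcos K w)%:C * fourier phi1 w * conjc (fourier phi2 w))].

Definition uncorrelated F1 F2 := forall phi1 phi2,
  schwartz phi1 -> schwartz phi2 -> second_moment (F1 phi1) (F2 phi2) = 0.

End RandomDistributions.

Section MatrixMeasure.
Context {R : realType}.

Definition adjmx m n (A : 'M[R[i]]_(m, n)) : 'M[R[i]]_(n, m) :=
  map_mx (@conjc R) A^T.

Definition hermitian_psd n (A : 'M[R[i]]_n) :=
  adjmx A = A /\ forall v : 'cV[R[i]]_n, 0 <= (adjmx v *m A *m v) ord0 ord0.

(* A matrix-valued measure nu may be infinite on unbounded sets. The diagonal
   entries nu_11 and nu_22 are kept as extended-real measures; the matrix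
   nu(E) itself is meaningful only when ||nu(E)|| < +oo. The matrix norm is the
   nuclear norm, which is the trace on positive semidefinite matrices, so that
   ||nu(dw)|| is the measure nu_11 + nu_22. *)
Record matrix_data := MatrixData {
  diag_measure : 'I_2 -> {measure set (measurableTypeR R) -> \bar R} ;
  mval :> set R -> 'M[R[i]]_2 }.

Definition norm_measure (nu : matrix_data) :
    {measure set (measurableTypeR R) -> \bar R} :=
  measure_add (diag_measure nu ord0) (diag_measure nu ord_max).

Definition finite_on (nu : matrix_data) (E : set R) :=
  measurable E /\ (norm_measure nu E < +oo)%E.

Definition is_matrix_measure (nu : matrix_data) :=
  [/\ forall E, finite_on nu E -> hermitian_psd (nu E),
      forall E i, finite_on nu E -> nu E i i = (fine (diag_measure nu i E))%:C
    & forall (E : (set R)^nat) i j, (forall n, measurable (E n)) ->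
        trivIset setT E -> finite_on nu (\bigcup_n E n) ->
        (\sum_(0 <= k < n) complex.Re (nu (E k) i j)) @[n --> \oo]
          --> complex.Re (nu (\bigcup_n E n) i j) /\
        (\sum_(0 <= k < n) complex.Im (nu (E k) i j)) @[n --> \oo]
          --> complex.Im (nu (\bigcup_n E n) i j)].

Definition spectral_measure (nu : matrix_data) :=
  [/\ is_matrix_measure nu,
      norm_measure nu `<< (leb : {measure set (measurableTypeR R) -> \bar R})
    & exists p : R,
        (\int[norm_measure nu]_w ((1 + w ^+ 2) `^ (- p))%:E < +oo)%E].

(* nu(dw) = r(w) dw *)
Definition has_density (nu : matrix_data) (r : R -> 'M[R[i]]_2) :=
  (forall (E : set R) i, measurable E ->
     diag_measure nu i E = (\int[leb]_(w in E) (complex.Re (r w i i))%:E)%E) /\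
  (forall (E : set R) i j, finite_on nu E ->
     cintegrable leb E (fun w => r w i j) /\
     nu E i j = cint leb E (fun w => r w i j)).

End MatrixMeasure.

Section StationaryOperator.
Context {d : measure_display} {T : measurableType d} {R : realType}.
Variable P : probability T R.
Implicit Types (nu : @matrix_data R) (h : R -> R[i]) (Y : T -> R[i]).

Definition random_measure nu (Z : 'I_2 -> set R -> T -> R[i]) :=
  (forall i E, finite_on nu E -> L2 P (Z i E)) /\
  (forall i j E1 E2, finite_on nu E1 -> finite_on nu E2 ->
     second_moment P (Z i E1) (Z j E2) = nu (E1 `&` E2) i j).

(* [:: (c_1, E_1); ...; (c_n, E_n)] stands for the simple function
   \sum_k c_k 1_{E_k}. *)
Definition simple_fun (s : seq (R[i] * set R)) : R -> R[i] :=
  fun w => \sum_(a <- s) a.1 * (\1_(a.2) w)%:C.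

Definition simple_int (Zi : set R -> T -> R[i]) (s : seq (R[i] * set R)) :
    T -> R[i] :=
  fun x => \sum_(a <- s) a.1 * Zi a.2 x.

(* [Y] is (a version of) the stochastic integral of [h] against [Z i]. *)
Definition is_stoch_int nu (Z : 'I_2 -> set R -> T -> R[i]) i h Y :=
  exists s : nat -> seq (R[i] * set R),
    [/\ forall n k, (k < size (s n))%N -> finite_on nu (nth (0, set0) (s n) k).2,
        sqnormL2 (diag_measure nu i) (fun w => h w - simple_fun (s n) w)
          @[n --> \oo] --> 0%E
      & sqnormL2 P (fun x => Y x - simple_int (Z i) (s n) x)
          @[n --> \oo] --> 0%E].

(* The tempered distribution [g] is in the domain of the component [i], and [h]
   is its Fourier transform. *)
Definition in_domain nu i (g : (R -> R[i]) -> R[i]) h :=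
  [/\ tempered g, fourier_is_fun g h & L2 (diag_measure nu i) h].

Definition operator_component nu (Z : 'I_2 -> set R -> T -> R[i]) i
    (X : ((R -> R[i]) -> R[i]) -> T -> R[i]) :=
  forall g h, in_domain nu i g h -> L2 P (X g) /\ is_stoch_int nu Z i h (X g).

Definition stationary_operator nu
    (X V : ((R -> R[i]) -> R[i]) -> T -> R[i]) :=
  exists Z, [/\ random_measure nu Z, operator_component nu Z ord0 X
              & operator_component nu Z ord_max V].

End StationaryOperator.

Section GLE.
Context {d : measure_display} {T : measurableType d} {R : realType}.
Variable P : probability T R.
Variables (m lambda beta gamma kBT : R) (K : R -> \bar R).

Definition Psi (phi : R -> R[i]) : R -> R[i] := fun t =>
  - m%:C * cderiven 1 phi t + lambda%:C * phi t
  + beta%:C * cint leb `[0, +oo[ (fun s => (kreal K s)%:C * phi (t + s)).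

Definition opp_deriv (phi : R -> R[i]) : R -> R[i] :=
  fun t => - cderiven 1 phi t.

Definition weak_stationary_solution (F W : (R -> R[i]) -> T -> R[i])
    (nu : @matrix_data R) (X V : ((R -> R[i]) -> R[i]) -> T -> R[i]) :=
  let lhs phi := fun x =>
    V (distr (Psi phi)) x + X (distr (fun t => gamma%:C * phi t)) x in
  [/\ forall phi, schwartz phi ->
        (exists h, in_domain nu ord_max (distr (Psi phi)) h) /\
        (sqnormL2 P (V (distr (Psi phi))) < +oo)%E,
      forall phi1 phi2, schwartz phi1 -> schwartz phi2 ->
        second_moment P (X (distr (opp_deriv phi1)))
                        (X (distr (opp_deriv phi2))) =
          second_moment P (V (distr phi1)) (V (distr phi2)) /\
        second_moment P (V (distr phi1)) (V (distr phi2)) =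
          second_moment P (X (distr (opp_deriv phi1))) (V (distr phi2))
    & forall phi1 phi2, schwartz phi1 -> schwartz phi2 ->
        second_moment P (lhs phi1) (lhs phi2) =
        kBT%:C * (beta%:C * second_moment P (F phi1) (F phi2)
                  + (2 * lambda)%:C * second_moment P (W phi1) (W phi2))].

Definition r11 (w : R) : R :=
  (2 * lambda + beta * Khat K w) /
  (cmod ((gamma - m * w ^+ 2)%:C
         + 'i * w%:C * (lambda%:C + beta%:C * Kplus_hat K w))) ^+ 2.

Definition r12 (w : R) : R[i] := 'i * w%:C * (r11 w)%:C.

Definition r22 (w : R) : R := w ^+ 2 * r11 w.

Definition gle_density (w : R) : 'M[R[i]]_2 :=
  (kBT / (2 * pi))%:C *:
  \matrix_(i, j)
    if (i == ord0) && (j == ord0) then (r11 w)%:C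
    else if (i == ord0) && (j == ord_max) then r12 w
    else if (i == ord_max) && (j == ord0) then conjc (r12 w)
    else (r22 w)%:C.

End GLE.

(* Main.v *)
From HB Require Import structures.
Require Import Defs.
From mathcomp Require Import all_boot all_order all_algebra.
From mathcomp Require Import all_classical all_reals all_analysis.
From mathcomp Require Import complex ring lra measurable_realfun.

(** The equation is linear and stationary, so it is diagonal in frequency: what
    has to be identified is the density of one positive measure, [nu11],
    together with the way the second component hangs on the first.

    Velocity. The identities that say dx/dt = v amount to E|<X,-phi'> -
    <V,phi>|^2 = 0 for every test function, that is, to [Z_2 = -iw Z_1]. On the
    level of the spectral measure this is [velocity_linked]: [nu22 = w^2 nu11]
    and [nu12 = iw nu11]. To get from test functions back to sets, one tests
    with Schwartz functions whose Fourier transforms are windows, that is,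
    indicators of intervals smoothed by a Gaussian ([window_fourier],
    [win_test]): they converge to the indicator almost everywhere, under one
    common Gaussian bound, and a spectral measure integrates Gaussians times
    polynomials. Measures, and complex set functions, that agree on bounded
    intervals agree ([measure_eq_itv], [sigma_additive_unique]).

    Drift. The transform of [Psi phi] is the product of the transform of [phi]
    with [drift w = - i m w + lambda + beta (Kcos w + i Ksin w)]. For a kernel
    that is not integrable this is where work is needed
    ([memory_fourier_is_fun]). For the kernel truncated to [[0, n]] the formula
    is Fubini's theorem; the truncated transforms are bounded, uniformly in [n],
    by a multiple of [1 + |w|^-b] with [b < 1] ([ktrunc_bound]). That bound
    comes from the oscillation estimate for decreasing functions
    ([oscillation_decreasing]) and from the power decay of the kernel
    ([kreal_power_bound]), and it is integrable against any bounded integrable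
    function, so dominated convergence applies. As the transform of a
    distribution is unique almost everywhere ([fourier_is_fun_unique]), any
    function that witnesses that [V] is defined at [Psi phi] is this product.

    Response. Once [Z_2 = -iw Z_1], the left-hand side of the equation, paired
    with [phi], is the stochastic integral with respect to [Z_1] of [response]
    times the transform of [phi], where [response w = -iw drift w + gamma] is
    the conjugate of the denominator of [r11]. By the isometry of stochastic
    integrals ([stoch_int_moment], [lhs_moment]) the last identity of a weak
    solution reads, with [phi^] for the transform of [phi],

    int |response|^2 phi1^ conj(phi2^) dnu11 = kBT/(2 pi) int (2 lambda + beta
    K^) phi1^ conj(phi2^) dw.

    Tested with windows, it says that [|response|^2 nu11] has the density
    [kBT/(2 pi) (2 lambda + beta K^)]. Away from the origin [response] does not
    vanish, because its imaginary part is [-w (lambda + beta Kcos w)]; the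
    origin is a null set, so one may divide, and [nu11] has the density [kBT/(2
    pi) r11] ([response_density]). Conversely, if [nu] has the stated density,
    all these identities can be read backwards ([density_solution]); that [<V,
    Psi phi>] is then defined follows from [|w drift| <= |response| + gamma]. *)

Set Implicit Arguments.
Unset Strict Implicit.
Unset Printing Implicit Defensive.
Import Order.TTheory GRing.Theory Num.Theory.
Import numFieldNormedType.Exports.
Local Open Scope classical_set_scope.
Local Open Scope ring_scope.
Local Open Scope complex_scope.
Local Notation leb := lebesgue_measure.

(** * Complex moduli and convergence of complex sequences *)

Section ComplexModulus.
Context {R : realType}.
Implicit Types (z w : R[i]) (x : R).

Lemma cReD z w : complex.Re (z + w) = complex.Re z + complex.Re w.
Proof. by case: z => a b; case: w. Qed.
Lemma cImD z w : complex.Im (z + w) = complex.Im z + complex.Im w.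
Proof. by case: z => a b; case: w. Qed.
Lemma cReN z : complex.Re (- z) = - complex.Re z.
Proof. by case: z. Qed.
Lemma cImN z : complex.Im (- z) = - complex.Im z.
Proof. by case: z. Qed.
Lemma cReM z w : complex.Re (z * w) =
  complex.Re z * complex.Re w - complex.Im z * complex.Im w.
Proof. by case: z => a b; case: w. Qed.
Lemma cImM z w : complex.Im (z * w) =
  complex.Re z * complex.Im w + complex.Im z * complex.Re w.
Proof. by case: z => a b; case: w. Qed.
Lemma cReJ z : complex.Re (conjc z) = complex.Re z.
Proof. by case: z. Qed.
Lemma cImJ z : complex.Im (conjc z) = - complex.Im z.
Proof. by case: z. Qed.

Definition cReImE := (cReD, cImD, cReN, cImN, cReM, cImM, cReJ, cImJ).

Lemma complexP z w : complex.Re z = complex.Re w ->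
  complex.Im z = complex.Im w -> z = w.
Proof. by case: z => a b; case: w => c d /= -> ->. Qed.

Lemma conjcM z w : conjc (z * w) = conjc z * conjc w.
Proof. by rewrite rmorphM. Qed.
Lemma conjcD z w : conjc (z + w) = conjc z + conjc w.
Proof. by rewrite rmorphD. Qed.
Lemma conjcB z w : conjc (z - w) = conjc z - conjc w.
Proof. by rewrite rmorphB. Qed.

Lemma sqr_cmod z : cmod z ^+ 2 = complex.Re z ^+ 2 + complex.Im z ^+ 2.
Proof. by case: z => a b; rewrite /cmod /= sqr_sqrtr// addr_ge0// sqr_ge0. Qed.
Lemma cmod_ge0 z : 0 <= cmod z.
Proof. by case: z => a b; exact: sqrtr_ge0. Qed.
Lemma cmodM z w : cmod (z * w) = cmod z * cmod w.
Proof. exact: ComplexField.Normc.normcM. Qed.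
Lemma cmodD z w : cmod (z + w) <= cmod z + cmod w.
Proof. exact: le_normcD. Qed.
Lemma cmodN z : cmod (- z) = cmod z.
Proof. exact: normcN. Qed.
Lemma cmodB z w : cmod (z - w) <= cmod z + cmod w.
Proof. by rewrite (le_trans (cmodD _ _))// cmodN. Qed.
Lemma cmod0 : cmod (0 : R[i]) = 0.
Proof. exact: ComplexField.Normc.normc0. Qed.
Lemma cmod1 : cmod (1 : R[i]) = 1.
Proof. exact: ComplexField.Normc.normc1. Qed.
Lemma cmodR x : cmod x%:C = `|x|.
Proof. by rewrite /cmod /= expr0n /= addr0 sqrtr_sqr. Qed.
Lemma cmodi : cmod ('i : R[i]) = 1.
Proof. by rewrite /cmod /= expr0n /= add0r expr1n sqrtr1. Qed.
Lemma cmodJ z : cmod (conjc z) = cmod z.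
Proof. by case: z => a b; rewrite /cmod /= sqrrN. Qed.
Lemma cmod_eq0 z : cmod z = 0 -> z = 0.
Proof. exact: ComplexField.Normc.eq0_normc. Qed.
Lemma cmod_gt0 z : z != 0 -> 0 < cmod z.
Proof.
by move=> z0; rewrite lt_neqAle cmod_ge0 andbT eq_sym; apply: contra_neq z0 => /cmod_eq0.
Qed.
Lemma Re_le_cmod z : `|complex.Re z| <= cmod z.
Proof.
by case: z => a b; rewrite /cmod /= -sqrtr_sqr ler_wsqrtr// lerDl sqr_ge0.
Qed.
Lemma Im_le_cmod z : `|complex.Im z| <= cmod z.
Proof.
by case: z => a b; rewrite /cmod /= -sqrtr_sqr ler_wsqrtr// lerDr sqr_ge0.
Qed.
Lemma cmod_le_ReIm z : cmod z <= `|complex.Re z| + `|complex.Im z|.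
Proof.
case: z => a b; rewrite /cmod /= -[leRHS]ger0_norm ?addr_ge0// -sqrtr_sqr.
rewrite ler_wsqrtr// sqrrD !real_normK ?num_real// -addrAC lerDl.
by rewrite mulrn_wge0// mulr_ge0.
Qed.
Lemma mulcJ z : z * conjc z = (cmod z ^+ 2)%:C.
Proof. by apply: complexP; rewrite sqr_cmod !cReImE /=; ring. Qed.
Lemma cmodX z n : cmod (z ^+ n) = cmod z ^+ n.
Proof. by elim: n => [|n ih]; rewrite ?expr0 ?cmod1// !exprS cmodM ih. Qed.
Lemma cmod_cossin x : cmod (cos x +i* sin x) = 1.
Proof. by rewrite /cmod /= cos2Dsin2 sqrtr1. Qed.
Definition ccvg (z_ : nat -> R[i]) z := cmod (z_ n - z) @[n --> \oo] --> (0 : R).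

Lemma ccvgP (z_ : nat -> R[i]) z : ccvg z_ z <->
  (complex.Re (z_ n) @[n --> \oo] --> complex.Re z /\
   complex.Im (z_ n) @[n --> \oo] --> complex.Im z).
Proof.
split=> [h|[hr hi]].
  split; apply: cvg_zero; apply: norm_cvg0.
    apply: (@squeeze_cvgr _ _ _ _ (cst 0) (fun n => cmod (z_ n - z))) => //; last exact: cvg_cst.
    by apply: nearW => n; rewrite /= normr_ge0 (le_trans _ (Re_le_cmod _))// !cReImE.
  apply: (@squeeze_cvgr _ _ _ _ (cst 0) (fun n => cmod (z_ n - z))) => //; last exact: cvg_cst.
  by apply: nearW => n; rewrite /= normr_ge0 (le_trans _ (Im_le_cmod _))// !cReImE.
have hr0 : `|complex.Re (z_ n) - complex.Re z| @[n --> \oo] --> (0:R).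
  by rewrite -(@normr0 _ R); apply: cvg_norm; rewrite -(subrr (complex.Re z)); apply: cvgB => //; exact: cvg_cst.
have hi0 : `|complex.Im (z_ n) - complex.Im z| @[n --> \oo] --> (0:R).
  by rewrite -(@normr0 _ R); apply: cvg_norm; rewrite -(subrr (complex.Im z)); apply: cvgB => //; exact: cvg_cst.
apply: (@squeeze_cvgr _ _ _ _ (cst 0) (fun n => `|complex.Re (z_ n) - complex.Re z| + `|complex.Im (z_ n) - complex.Im z|)).
- by apply: nearW => n; rewrite /= cmod_ge0 (le_trans (cmod_le_ReIm _))// !cReImE.
- exact: cvg_cst.
- by rewrite -[X in _ --> X](addr0 (0:R)); exact: cvgD.
Qed.

Lemma ccvg_unique (z_ : nat -> R[i]) z w : ccvg z_ z -> ccvg z_ w -> z = w.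
Proof.
move=> /ccvgP[zr zi] /ccvgP[wr wi]; apply: complexP.
  exact: (cvg_unique _ zr wr).
exact: (cvg_unique _ zi wi).
Qed.

Lemma ccvg_cst z : ccvg (fun=> z) z.
Proof. by rewrite /ccvg subrr cmod0; exact: cvg_cst. Qed.

Lemma ccvgD (z_ : nat -> R[i]) z (w_ : nat -> R[i]) w : ccvg z_ z -> ccvg w_ w -> ccvg (fun n => z_ n + w_ n) (z + w).
Proof.
move=> /ccvgP[zr zi] /ccvgP[wr wi]; apply/ccvgP; split.
  by rewrite cReD; under eq_fun do rewrite cReD; exact: cvgD.
by rewrite cImD; under eq_fun do rewrite cImD; exact: cvgD.
Qed.

Lemma ccvgM (z_ : nat -> R[i]) z (w_ : nat -> R[i]) w : ccvg z_ z -> ccvg w_ w -> ccvg (fun n => z_ n * w_ n) (z * w).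
Proof.
move=> /ccvgP[zr zi] /ccvgP[wr wi]; apply/ccvgP; split.
  by rewrite cReM; under eq_fun do rewrite cReM; apply: cvgB; exact: cvgM.
by rewrite cImM; under eq_fun do rewrite cImM; apply: cvgD; exact: cvgM.
Qed.

Lemma ccvgR (x_ : nat -> R) x : x_ n @[n --> \oo] --> x -> ccvg (fun n => (x_ n)%:C) x%:C.
Proof. by move=> h; apply/ccvgP; split => //=; exact: cvg_cst. Qed.

End ComplexModulus.

(** * Integration of complex functions *)

Section ComplexIntegral.
Context {d : measure_display} {T : measurableType d} {R : realType}.
Implicit Types (f g : T -> R[i]) (D : set T).

Lemma cmeas_cst (z : R[i]) : cmeasurable (fun _ : T => z).
Proof. by split; exact: measurable_cst. Qed.
Lemma cmeasD f g : cmeasurable f -> cmeasurable g -> cmeasurable (fun x => f x + g x).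
Proof.
move=> [fr fi] [gr gi]; split.
  by under eq_fun do rewrite cReD; exact: measurable_funD.
by under eq_fun do rewrite cImD; exact: measurable_funD.
Qed.
Lemma cmeasM f g : cmeasurable f -> cmeasurable g -> cmeasurable (fun x => f x * g x).
Proof.
move=> [fr fi] [gr gi]; split.
  by under eq_fun do rewrite cReM; apply: measurable_funB; exact: measurable_funM.
by under eq_fun do rewrite cImM; apply: measurable_funD; exact: measurable_funM.
Qed.
Lemma cmeasN f : cmeasurable f -> cmeasurable (fun x => - f x).
Proof.
move=> [fr fi]; split.
  by under eq_fun do rewrite cReN; exact: measurableT_comp.
by under eq_fun do rewrite cImN; exact: measurableT_comp.
Qed.
Lemma cmeasB f g : cmeasurable f -> cmeasurable g -> cmeasurable (fun x => f x - g x).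
Proof. by move=> mf mg; apply: cmeasD => //; exact: cmeasN. Qed.
Lemma cmeasJ f : cmeasurable f -> cmeasurable (fun x => conjc (f x)).
Proof.
move=> [fr fi]; split.
  by under eq_fun do rewrite cReJ.
by under eq_fun do rewrite cImJ; exact: measurableT_comp.
Qed.
Lemma cmeasR (f : T -> R) : measurable_fun setT f -> cmeasurable (fun x => (f x)%:C).
Proof. by move=> mf; split => //=; exact: measurable_cst. Qed.
Lemma cmeasE f g : cmeasurable f -> f =1 g -> cmeasurable g.
Proof. by move=> mf /funext <-. Qed.

Lemma measurable_cmod D f : measurable_fun D (fun x => complex.Re (f x)) ->
  measurable_fun D (fun x => complex.Im (f x)) -> measurable_fun D (fun x => cmod (f x)).
Proof.
move=> mr mi.
rewrite (_ : (fun x => _) = Num.sqrt \o (fun x => complex.Re (f x) ^+ 2 + complex.Im (f x) ^+ 2)).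
  apply: (@measurableT_comp _ _ _ _ _ _ (@Num.sqrt R)).
    by apply: continuous_measurable_fun; exact: sqrt_continuous.
  by apply: measurable_funD; exact: measurable_funX.
by apply/funext => x /=; case: (f x).
Qed.
Lemma cmeas_cmod f : cmeasurable f -> measurable_fun setT (fun x => cmod (f x)).
Proof. by move=> [? ?]; exact: measurable_cmod. Qed.

Context {mu : {measure set T -> \bar R}}.

Section Domain.
Variables (D : set T) (mD : measurable D).
Let cig f := cintegrable mu D f.

Lemma eq_cintegrable f g : {in D, f =1 g} -> cig f -> cig g.
Proof.
move=> fg [fr fi]; split.
  by apply: eq_integrable fr => // x xD; rewrite fg.
by apply: eq_integrable fi => // x xD; rewrite fg.
Qed.
Lemma eq_cint f g : {in D, f =1 g} -> cint mu D f = cint mu D g.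
Proof. by move=> fg; congr (_ +i* _); apply: eq_Rintegral => x xD; rewrite fg. Qed.

Lemma cintegrable_meas f : cig f -> measurable_fun D (fun x => complex.Re (f x)) /\
  measurable_fun D (fun x => complex.Im (f x)).
Proof. by move=> [/measurable_int fr /measurable_int fi]; split; apply/measurable_EFinP. Qed.

Lemma cintegrable_cmod f : cig f -> mu.-integrable D (fun x => (cmod (f x))%:E).
Proof.
move=> cf; have [mr mi] := cintegrable_meas cf; case: (cf) => fr fi.
apply: (@le_integrable _ _ _ mu D mD _ (fun x => (`|complex.Re (f x)| + `|complex.Im (f x)|)%:E)).
- by apply/measurable_EFinP; exact: measurable_cmod.
- move=> x Dx; rewrite /= lee_fin ger0_norm ?cmod_ge0// ger0_norm ?addr_ge0//.
  exact: cmod_le_ReIm.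
- under eq_fun do rewrite EFinD.
  by apply: integrableD => //; apply: integrable_norm.
Qed.

Lemma cintegrable_le f (g : T -> R) :
  measurable_fun D (fun x => complex.Re (f x)) ->
  measurable_fun D (fun x => complex.Im (f x)) ->
  (forall x, D x -> cmod (f x) <= g x) -> mu.-integrable D (EFin \o g) -> cig f.
Proof.
move=> mr mi fg ig; split; apply: (le_integrable mD _ _ ig) => /=.
- exact/measurable_EFinP.
- move=> x Dx; rewrite lee_fin (le_trans (Re_le_cmod _))//.
  by rewrite (le_trans (fg x Dx))// ler_norm.
- exact/measurable_EFinP.
- move=> x Dx; rewrite lee_fin (le_trans (Im_le_cmod _))//.
  by rewrite (le_trans (fg x Dx))// ler_norm.
Qed.

Lemma cmeas_cintegrable f (g : T -> R) : cmeasurable f ->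
  (forall x, D x -> cmod (f x) <= g x) -> mu.-integrable D (EFin \o g) -> cig f.
Proof.
move=> [mr mi]; apply: cintegrable_le; exact: measurable_funTS.
Qed.

Lemma cintegrableD f g : cig f -> cig g -> cig (fun x => f x + g x).
Proof.
move=> [fr fi] [gr gi]; split.
  by under eq_fun do rewrite cReD EFinD; exact: integrableD.
by under eq_fun do rewrite cImD EFinD; exact: integrableD.
Qed.

Lemma cintegrableZl (z : R[i]) f : cig f -> cig (fun x => z * f x).
Proof.
move=> [fr fi]; split.
  under eq_fun do rewrite cReM EFinB !EFinM.
  by apply: integrableB => //; exact: integrableZl.
under eq_fun do rewrite cImM EFinD !EFinM.
by apply: integrableD => //; exact: integrableZl.
Qed.

Lemma cintegrableN f : cig f -> cig (fun x => - f x).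
Proof. by move=> cf; apply: eq_cintegrable (cintegrableZl (-1) cf) => x _; rewrite mulN1r. Qed.
Lemma cintegrableB f g : cig f -> cig g -> cig (fun x => f x - g x).
Proof. by move=> cf cg; apply: cintegrableD => //; exact: cintegrableN. Qed.
Lemma cintegrableJ f : cig f -> cig (fun x => conjc (f x)).
Proof.
move=> [fr fi]; split.
  by under eq_fun do rewrite cReJ.
by under eq_fun do rewrite cImJ EFinN; exact: integrableN.
Qed.
Lemma cintegrableR (f : T -> R) : mu.-integrable D (EFin \o f) -> cig (fun x => (f x)%:C).
Proof. by move=> fi; split => //=; exact: integrable0. Qed.
Lemma cintegrable0 : cig (fun=> 0).
Proof. by split; exact: integrable0. Qed.

Lemma cintD f g : cig f -> cig g ->
  cint mu D (fun x => f x + g x) = cint mu D f + cint mu D g.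
Proof.
move=> [fr fi] [gr gi]; apply: complexP => /=.
  by rewrite -RintegralD//; apply: eq_Rintegral => x _; rewrite cReD.
by rewrite -RintegralD//; apply: eq_Rintegral => x _; rewrite cImD.
Qed.

Lemma cintZl (z : R[i]) f : cig f -> cint mu D (fun x => z * f x) = z * cint mu D f.
Proof.
move=> [fr fi]; apply: complexP; rewrite ?cReM ?cImM /= -!RintegralZl//.
  rewrite -RintegralB//; last 2 first.
  - by under [X in _.-integrable _ X]funext do rewrite /= EFinM; exact: integrableZl.
  - by under [X in _.-integrable _ X]funext do rewrite /= EFinM; exact: integrableZl.
  by apply: eq_Rintegral => x _; rewrite cReM.
rewrite -RintegralD//; last 2 first.
- by under [X in _.-integrable _ X]funext do rewrite /= EFinM; exact: integrableZl.
- by under [X in _.-integrable _ X]funext do rewrite /= EFinM; exact: integrableZl.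
by apply: eq_Rintegral => x _; rewrite cImM.
Qed.

Lemma cintN f : cig f -> cint mu D (fun x => - f x) = - cint mu D f.
Proof. by move=> cf; rewrite -mulN1r -cintZl//; apply: eq_cint => x _; rewrite mulN1r. Qed.
Lemma cintB f g : cig f -> cig g ->
  cint mu D (fun x => f x - g x) = cint mu D f - cint mu D g.
Proof. by move=> cf cg; rewrite cintD ?cintN//; exact: cintegrableN. Qed.
Lemma cintJ f : cig f -> cint mu D (fun x => conjc (f x)) = conjc (cint mu D f).
Proof.
move=> [fr fi]; apply: complexP; rewrite ?cReJ ?cImJ /=.
  by apply: eq_Rintegral => x _; rewrite cReJ.
rewrite -mulN1r -RintegralZl//.
by apply: eq_Rintegral => x _; rewrite cImJ mulN1r.
Qed.
Lemma cintR (f : T -> R) : cint mu D (fun x => (f x)%:C) = (Rintegral mu D f)%:C.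
Proof.
apply: complexP => //=; rewrite /Rintegral.
by rewrite (eq_integral (cst 0%E)) ?integral0.
Qed.
Lemma cint0 : cint mu D (fun=> 0) = 0.
Proof. by rewrite (cintR (fun=> 0)) /Rintegral integral0. Qed.

(** Rotating the integral onto the positive real axis reduces the estimate to
    that of a real integral. *)
Lemma cmod_cint_le f : cig f -> cmod (cint mu D f) <= Rintegral mu D (fun x => cmod (f x)).
Proof.
move=> cf; have [z0|z0] := eqVneq (cint mu D f) 0.
  by rewrite z0 cmod0 Rintegral_ge0// => x _; exact: cmod_ge0.
set z := cint mu D f in z0 *.
(* the rotation that takes [z] to [|z|] *)
pose u := conjc z * ((cmod z)^-1)%:C.
have cz : 0 < cmod z by exact: cmod_gt0.
have uz : u * z = (cmod z)%:C.
  rewrite /u mulrAC mulrC (mulrC _ z) mulcJ -rmorphM /= expr2 mulrA mulVf ?mul1r//.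
  by rewrite gt_eqF.
have cu : cmod u = 1.
  rewrite cmodM cmodJ cmodR ger0_norm ?invr_ge0 ?cmod_ge0// divff//.
  by rewrite gt_eqF.
have cuf := cintegrableZl u cf.
have -> : cmod z = Rintegral mu D (fun x => complex.Re (u * f x)).
  by have := congr1 (@complex.Re R) (cintZl u cf); rewrite -/z uz /= => ->.
apply: le_Rintegral => //.
- by case: cuf.
- exact: cintegrable_cmod.
- move=> x Dx; rewrite (le_trans (ler_norm _))// (le_trans (Re_le_cmod _))//.
  by rewrite cmodM cu mul1r.
Qed.

(** Dominated convergence for real and imaginary parts, each of which is
    dominated by the same [g]. *)
Lemma cdominated (f_ : nat -> T -> R[i]) f (g : T -> R) :
  (forall n, cmeasurable (f_ n)) -> cmeasurable f ->
  {ae mu, forall x, D x -> ccvg (f_ ^~ x) (f x)} ->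
  mu.-integrable D (EFin \o g) ->
  (forall n x, D x -> cmod (f_ n x) <= g x) ->
  cig f /\ ccvg (fun n => cint mu D (f_ n)) (cint mu D f).
Proof.
move=> mf_ mf cf ig fg.
have [|||||ir _ cr] := @dominated_convergence _ _ _ mu D mD
    (fun n x => (complex.Re (f_ n x))%:E) (fun x => (complex.Re (f x))%:E) (EFin \o g).
- by move=> n; apply/measurable_EFinP/measurable_funTS; case: (mf_ n).
- by apply/measurable_EFinP/measurable_funTS; case: mf.
- apply: filterS cf => x /= h Dx; have /ccvgP[hr _] := h Dx.
  by apply: cvg_EFin; [exact: nearW|exact: hr].
- exact: ig.
- apply: aeW => x n Dx /=; rewrite lee_fin (le_trans (Re_le_cmod _))//; exact: fg.
have [|||||ii _ ci] := @dominated_convergence _ _ _ mu D mD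
    (fun n x => (complex.Im (f_ n x))%:E) (fun x => (complex.Im (f x))%:E) (EFin \o g).
- by move=> n; apply/measurable_EFinP/measurable_funTS; case: (mf_ n).
- by apply/measurable_EFinP/measurable_funTS; case: mf.
- apply: filterS cf => x /= h Dx; have /ccvgP[_ hi] := h Dx.
  by apply: cvg_EFin; [exact: nearW|exact: hi].
- exact: ig.
- apply: aeW => x n Dx /=; rewrite lee_fin (le_trans (Im_le_cmod _))//; exact: fg.
split; first by split.
apply/ccvgP; split; apply: fine_cvg => /=; rewrite fineK//.
  exact: integrable_fin_num.
exact: integrable_fin_num.
Qed.

End Domain.
End ComplexIntegral.

(** * The inner product of square-integrable functions *)

Section L2Space.
Context {d : measure_display} {T : measurableType d} {R : realType}.
Variable mu : {measure set T -> \bar R}.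
Implicit Types (f g : T -> R[i]).

Definition ip f g : R[i] := cint mu setT (fun x => f x * conjc (g x)).
Definition sqnorm f : R := Rintegral mu setT (fun x => cmod (f x) ^+ 2).

Lemma eq_L2 f g : f =1 g -> L2 mu f -> L2 mu g.
Proof. by move=> /funext <-. Qed.

Lemma sqnorm_ge0 f : 0 <= sqnorm f.
Proof. by apply: Rintegral_ge0 => x _; exact: sqr_ge0. Qed.

Lemma cmeas_sqr_cmod f : cmeasurable f -> measurable_fun setT (fun x => cmod (f x) ^+ 2).
Proof. by move=> mf; apply: measurable_funX; exact: cmeas_cmod. Qed.

Lemma L2_integrable f : L2 mu f -> mu.-integrable setT (EFin \o (fun x => cmod (f x) ^+ 2)).
Proof.
move=> [mf lf]; apply/integrableP; split.
  by apply/measurable_EFinP; exact: cmeas_sqr_cmod.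
by under eq_integral do rewrite gee0_abs ?lee_fin ?sqr_ge0//=.
Qed.

Lemma integrable_L2 f : cmeasurable f ->
  mu.-integrable setT (EFin \o (fun x => cmod (f x) ^+ 2)) -> L2 mu f.
Proof.
move=> mf /integrableP[_]; split => //.
by move: b; under eq_integral do rewrite gee0_abs ?lee_fin ?sqr_ge0//=.
Qed.

Lemma L2D f g : L2 mu f -> L2 mu g -> L2 mu (fun x => f x + g x).
Proof.
move=> Lf Lg; apply: integrable_L2; first by apply: cmeasD; [case: Lf|case: Lg].
apply: (@le_integrable _ _ _ mu setT measurableT _
  (fun x => (2 * cmod (f x) ^+ 2 + 2 * cmod (g x) ^+ 2)%:E)).
- by apply/measurable_EFinP; apply: cmeas_sqr_cmod; apply: cmeasD; [case: Lf|case: Lg].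
- move=> x _ /=; rewrite lee_fin !ger0_norm ?addr_ge0 ?mulr_ge0 ?exprn_ge0 ?cmod_ge0//.
  have h1 := cmodD (f x) (g x); have h2 := cmod_ge0 (f x + g x).
  apply: (@le_trans _ _ ((cmod (f x) + cmod (g x)) ^+ 2)).
    by rewrite lerXn2r ?nnegrE ?addr_ge0 ?cmod_ge0.
  rewrite -subr_ge0; have -> : 2 * cmod (f x) ^+ 2 + 2 * cmod (g x) ^+ 2 -
    (cmod (f x) + cmod (g x)) ^+ 2 = (cmod (f x) - cmod (g x)) ^+ 2 by ring.
  exact: sqr_ge0.
- under eq_fun do rewrite EFinD.
  by apply: integrableD => //; (under eq_fun do rewrite EFinM); apply: integrableZl => //; exact: L2_integrable.
Qed.

Lemma L2Z (z : R[i]) f : L2 mu f -> L2 mu (fun x => z * f x).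
Proof.
move=> Lf; apply: integrable_L2; first by apply: cmeasM; [exact: cmeas_cst|case: Lf].
under [X in integrable _ _ X]funext do rewrite /= cmodM exprMn EFinM.
by apply: integrableZl => //; exact: L2_integrable.
Qed.

Lemma L2N f : L2 mu f -> L2 mu (fun x => - f x).
Proof. by move=> Lf; apply: eq_L2 (L2Z (-1) Lf) => x; rewrite mulN1r. Qed.
Lemma L2B f g : L2 mu f -> L2 mu g -> L2 mu (fun x => f x - g x).
Proof. by move=> Lf Lg; apply: L2D => //; exact: L2N. Qed.
Lemma L20 : L2 mu (fun=> 0).
Proof.
apply: integrable_L2; first exact: cmeas_cst.
have -> : EFin \o (fun _ : T => cmod (0 : R[i]) ^+ 2) = cst 0%E.
  by apply/funext => x; congr EFin; rewrite cmod0 expr0n.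
exact: integrable0.
Qed.

Lemma integrable_cmodM f g : L2 mu f -> L2 mu g ->
  mu.-integrable setT (EFin \o (fun x => cmod (f x) * cmod (g x))).
Proof.
move=> Lf Lg; apply: (@le_integrable _ _ _ mu setT measurableT _
  (fun x => (cmod (f x) ^+ 2 + cmod (g x) ^+ 2)%:E)).
- apply/measurable_EFinP; apply: measurable_funM; apply: cmeas_cmod;
  [by case: Lf|by case: Lg].
- move=> x _ /=; rewrite lee_fin !ger0_norm ?addr_ge0 ?sqr_ge0 ?mulr_ge0 ?cmod_ge0//.
  have := sqr_ge0 (cmod (f x) - cmod (g x)).
  have := sqr_ge0 (cmod (f x)); have := sqr_ge0 (cmod (g x)).
  by rewrite sqrrB; lra.
- by under eq_fun do rewrite EFinD; apply: integrableD => //; exact: L2_integrable.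
Qed.

Lemma ip_integrable f g : L2 mu f -> L2 mu g ->
  cintegrable mu setT (fun x => f x * conjc (g x)).
Proof.
move=> Lf Lg; apply: (cmeas_cintegrable measurableT _ _ (integrable_cmodM Lf Lg)).
  by apply: cmeasM; [case: Lf|apply: cmeasJ; case: Lg].
by move=> x _; rewrite cmodM cmodJ.
Qed.

Lemma ipDl f g h : L2 mu f -> L2 mu g -> L2 mu h ->
  ip (fun x => f x + g x) h = ip f h + ip g h.
Proof.
move=> Lf Lg Lh; rewrite /ip -cintD//; try exact: ip_integrable.
by apply: eq_cint => x _; rewrite mulrDl.
Qed.
Lemma ipDr f g h : L2 mu f -> L2 mu g -> L2 mu h ->
  ip f (fun x => g x + h x) = ip f g + ip f h.
Proof.
move=> Lf Lg Lh; rewrite /ip -cintD//; try exact: ip_integrable.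
by apply: eq_cint => x _; rewrite conjcD mulrDr.
Qed.
Lemma ipBl f g h : L2 mu f -> L2 mu g -> L2 mu h ->
  ip (fun x => f x - g x) h = ip f h - ip g h.
Proof.
move=> Lf Lg Lh; rewrite /ip -cintB//; try exact: ip_integrable.
by apply: eq_cint => x _; rewrite mulrBl.
Qed.
Lemma ipBr f g h : L2 mu f -> L2 mu g -> L2 mu h ->
  ip f (fun x => g x - h x) = ip f g - ip f h.
Proof.
move=> Lf Lg Lh; rewrite /ip -cintB//; try exact: ip_integrable.
by apply: eq_cint => x _; rewrite conjcB mulrBr.
Qed.
Lemma ipZl z f g : L2 mu f -> L2 mu g -> ip (fun x => z * f x) g = z * ip f g.
Proof.
move=> Lf Lg; rewrite /ip -cintZl//; try exact: ip_integrable.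
by apply: eq_cint => x _; rewrite mulrA.
Qed.
Lemma ipZr z f g : L2 mu f -> L2 mu g -> ip f (fun x => z * g x) = conjc z * ip f g.
Proof.
move=> Lf Lg; rewrite /ip -cintZl//; try exact: ip_integrable.
by apply: eq_cint => x _; rewrite conjcM; ring.
Qed.
Lemma ip0l f : ip (fun=> 0) f = 0.
Proof. by rewrite /ip (eq_cint _ (g := fun=> 0)) ?cint0// => x _; rewrite mul0r. Qed.
Lemma ip0r f : ip f (fun=> 0) = 0.
Proof. by rewrite /ip (eq_cint _ (g := fun=> 0)) ?cint0// => x _; rewrite conjc0 mulr0. Qed.
Lemma ipC f g : L2 mu f -> L2 mu g -> ip g f = conjc (ip f g).
Proof.
move=> Lf Lg; rewrite /ip -cintJ//; try exact: ip_integrable.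
by apply: eq_cint => x _; rewrite conjcM conjcK mulrC.
Qed.
Lemma ip_self f : ip f f = (sqnorm f)%:C.
Proof. by rewrite /ip /sqnorm -cintR; apply: eq_cint => x _; rewrite mulcJ. Qed.

(** The nonnegative quadratic polynomial [t |-> int (|f| - t |g|)^2] has
    nonpositive discriminant. *)
Lemma cauchy_schwarz f g : L2 mu f -> L2 mu g ->
  cmod (ip f g) <= Num.sqrt (sqnorm f * sqnorm g).
Proof.
move=> Lf Lg.
set B := Rintegral mu setT (fun x => cmod (f x) * cmod (g x)).
have -> : forall z, z <= B -> B ^+ 2 <= sqnorm f * sqnorm g -> z <= Num.sqrt (sqnorm f * sqnorm g).
- move=> z zB B2; rewrite (le_trans zB)// -(@ger0_norm _ B) -?sqrtr_sqr ?ler_wsqrtr//.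
  by apply: Rintegral_ge0 => x _; rewrite mulr_ge0 ?cmod_ge0.
- by [].
- rewrite (le_trans (cmod_cint_le measurableT (ip_integrable Lf Lg)))//.
  by rewrite le_eqVlt; apply/orP; left; apply/eqP/eq_Rintegral => x _; rewrite cmodM cmodJ.
have q t : 0 <= sqnorm f - 2 * t * B + t ^+ 2 * sqnorm g.
  have -> : sqnorm f - 2 * t * B + t ^+ 2 * sqnorm g =
    Rintegral mu setT (fun x => (cmod (f x) - t * cmod (g x)) ^+ 2).
    rewrite /sqnorm /B -!RintegralZl//; last 2 first.
      by first [exact: integrable_cmodM|exact: L2_integrable].
      by first [exact: integrable_cmodM|exact: L2_integrable].
    rewrite -RintegralB//; last 2 first.
      exact: L2_integrable.
      by under [X in integrable _ _ X]funext do rewrite /= EFinM; apply: integrableZl => //; exact: integrable_cmodM.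
    rewrite -RintegralD//; last 2 first.
      under [X in integrable _ _ X]funext do rewrite /= EFinB.
      apply: integrableB => //; first exact: L2_integrable.
      by under [X in integrable _ _ X]funext do rewrite /= EFinM; apply: integrableZl => //; exact: integrable_cmodM.
      by under [X in integrable _ _ X]funext do rewrite /= EFinM; apply: integrableZl => //; exact: L2_integrable.
    by apply: eq_Rintegral => x _; ring.
  by apply: Rintegral_ge0 => x _; exact: sqr_ge0.
have B0 : 0 <= B by apply: Rintegral_ge0 => x _; rewrite mulr_ge0 ?cmod_ge0.
have f0 := sqnorm_ge0 f; have := sqnorm_ge0 g.
rewrite le_eqVlt => /predU1P[g0|g0].
  rewrite -g0 mulr0; have [->|Bn0] := eqVneq B 0; first by rewrite expr0n.
  have Bp : 0 < B by rewrite lt_neqAle eq_sym Bn0.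
  (* if the norm of [g] vanishes, this [t] makes the polynomial, now of degree
     one, equal to [-1] *)
  have := q ((sqnorm f + 1) / (2 * B)); rewrite -g0 mulr0 addr0.
  have -> : 2 * ((sqnorm f + 1) / (2 * B)) * B = sqnorm f + 1 by field.
  by lra.
(* the minimum of the polynomial *)
have := q (B / sqnorm g).
have -> : sqnorm f - 2 * (B / sqnorm g) * B + (B / sqnorm g) ^+ 2 * sqnorm g =
  (sqnorm f * sqnorm g - B ^+ 2) / sqnorm g.
  by field; rewrite gt_eqF.
by rewrite pmulr_lge0 ?invr_gt0// subr_ge0.
Qed.

Lemma sqnorm_cvg (f_ : nat -> T -> R[i]) f :
  sqnormL2 mu (fun x => f x - f_ n x) @[n --> \oo] --> 0%E ->
  sqnorm (fun x => f x - f_ n x) @[n --> \oo] --> (0 : R).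
Proof. by move=> h; apply: fine_cvg. Qed.

(** The error is a sum of three inner products, each containing one of the two
    differences; Cauchy-Schwarz bounds them all. *)
Lemma ip_cvg (f_ g_ : nat -> T -> R[i]) f g :
  L2 mu f -> L2 mu g -> (forall n, L2 mu (f_ n)) -> (forall n, L2 mu (g_ n)) ->
  sqnorm (fun x => f x - f_ n x) @[n --> \oo] --> (0 : R) ->
  sqnorm (fun x => g x - g_ n x) @[n --> \oo] --> (0 : R) ->
  ccvg (fun n => ip (f_ n) (g_ n)) (ip f g).
Proof.
move=> Lf Lg Lf_ Lg_ cf cg.
have Lfn n : L2 mu (fun x => f x - f_ n x) by exact: L2B.
have Lgn n : L2 mu (fun x => g x - g_ n x) by exact: L2B.
have E n : ip (f_ n) (g_ n) - ip f g = ip (fun x => f x - f_ n x) (fun x => g x - g_ n x)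
    - ip (fun x => f x - f_ n x) g - ip f (fun x => g x - g_ n x).
  rewrite !ipBl// !ipBr//; ring.
pose u n := Num.sqrt (sqnorm (fun x => f x - f_ n x) * sqnorm (fun x => g x - g_ n x))
  + Num.sqrt (sqnorm (fun x => f x - f_ n x) * sqnorm g)
  + Num.sqrt (sqnorm f * sqnorm (fun x => g x - g_ n x)).
apply: (@squeeze_cvgr _ _ _ _ (cst 0) u).
- apply: nearW => n; apply/andP; split; [exact: cmod_ge0|rewrite E].
  rewrite (le_trans (cmodB _ _))// lerD ?cauchy_schwarz//.
  by rewrite (le_trans (cmodB _ _))// lerD ?cauchy_schwarz.
- exact: cvg_cst.
- have sq (v : nat -> R) : v n @[n --> \oo] --> (0 : R) -> Num.sqrt (v n) @[n --> \oo] --> (0 : R).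
    move=> v0; rewrite -[X in _ --> X]sqrtr0.
    by apply: (continuous_cvg _ _ v0); exact: sqrt_continuous.
  rewrite -[X in _ --> X](addr0 (0:R)); apply: cvgD; last first.
    by apply: sq; rewrite -[X in _ --> X](mulr0 (sqnorm f)); apply: cvgM => //; exact: cvg_cst.
  rewrite -[X in _ --> X](addr0 (0:R)); apply: cvgD; last first.
    by apply: sq; rewrite -[X in _ --> X](mul0r (sqnorm g)); apply: cvgM => //; exact: cvg_cst.
  by apply: sq; rewrite -[X in _ --> X](mul0r (0:R)); exact: cvgM.
Qed.

Lemma sqnormB f g : L2 mu f -> L2 mu g ->
  (sqnorm (fun x => f x - g x))%:C = ip f f - ip f g - ip g f + ip g g.
Proof. by move=> Lf Lg; rewrite -ip_self ipBl ?ipBr//; [ring|exact: L2B]. Qed.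

End L2Space.

(** * Integration against a density, and translations of the line *)

Section DensityChange.
Context {d : measure_display} {T : measurableType d} {R : realType}.
Variables (mu nu : {measure set T -> \bar R}) (rho : T -> R).
Hypotheses (rho0 : forall x, 0 <= rho x) (mrho : measurable_fun setT rho).
Hypothesis nuE : forall A, measurable A -> nu A = (\int[mu]_(x in A) (rho x)%:E)%E.
Local Open Scope ereal_scope.
Import HBNNSimple.

Let nnsfun_density (h : {nnsfun T >-> R}) :
  \int[nu]_x (h x)%:E = \int[mu]_x ((h x)%:E * (rho x)%:E).
Proof.
have mi r : measurable_fun setT (fun x => (r * \1_(h @^-1` [set r]) x)%:E).
  by apply/measurable_EFinP; exact: measurable_funM.
transitivity (\int[nu]_x (\sum_(y \in range h) (y * \1_(h @^-1` [set y]) x)%:E)).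
  by apply: eq_integral => x _; rewrite fsumEFin// -fimfunE.
rewrite ge0_integral_fsum//; last by move=> n y _; exact: nnfun_muleindic_ge0.
transitivity (\int[mu]_x (\sum_(y \in range h) (y * \1_(h @^-1` [set y]) x)%:E * (rho x)%:E)).
  rewrite ge0_integral_fsum//; last 2 first.
  - by move=> y; apply: emeasurable_funM => //; exact/measurable_EFinP.
  - by move=> n y _; rewrite mule_ge0 ?lee_fin//; exact: nnfun_muleindic_ge0.
  apply: eq_fsbigr => y; rewrite inE => -[t _ <-].
  rewrite integralZl_indic_nnsfun// integral_indic// setIT nuE//.
  under [RHS]eq_integral do rewrite EFinM -muleA.
  rewrite ge0_integralZl//; last 3 first.
  - by apply: emeasurable_funM; apply/measurable_EFinP.
  - by move=> x _; rewrite mule_ge0 ?lee_fin.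
  - by rewrite lee_fin.
  congr (_ * _); rewrite integral_mkcond; apply: eq_integral => x _.
  by rewrite patchE indicE; case: ifPn => _; rewrite ?mul1e ?mul0e.
apply: eq_integral => x _.
rewrite -ge0_mule_fsuml; last by move=> y; exact: nnfun_muleindic_ge0.
by rewrite fsumEFin// -fimfunE.
Qed.

(** Clear for simple functions, and both sides commute with monotone
    limits. *)
Lemma ge0_integral_density (f : T -> \bar R) : (forall x, 0 <= f x) ->
  measurable_fun setT f -> \int[nu]_x f x = \int[mu]_x (f x * (rho x)%:E).
Proof.
move=> f0 mf; pose h := nnsfun_approx measurableT mf.
have hf x : (h n x)%:E @[n --> \oo] --> f x by exact: cvg_nnsfun_approx.
have hnd x m n : (m <= n)%N -> (h m x <= h n x)%R.
  by move=> mn; exact/lefP/nd_nnsfun_approx.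
have -> : \int[nu]_x f x = lim (\int[nu]_x (h n x)%:E @[n --> \oo]).
  rewrite -monotone_convergence//.
  - by apply: eq_integral => x _; apply/esym/cvg_lim.
  - by move=> n; exact/measurable_EFinP.
  - by move=> n x _; rewrite lee_fin.
  - by move=> x _ m n mn; rewrite lee_fin hnd.
have -> : \int[mu]_x (f x * (rho x)%:E) =
    lim (\int[mu]_x ((h n x)%:E * (rho x)%:E) @[n --> \oo]).
  rewrite -monotone_convergence//.
  - by apply: eq_integral => x _; apply/esym/cvg_lim => //; apply: cvgeZr => //; exact: hf.
  - by move=> n; apply: emeasurable_funM; exact/measurable_EFinP.
  - by move=> n x _; rewrite mule_ge0 ?lee_fin.
  - by move=> x _ m n mn; rewrite lee_wpmul2r ?lee_fin ?hnd.
rewrite (_ : (fun n => \int[nu]_x (h n x)%:E) =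
  (fun n => \int[mu]_x ((h n x)%:E * (rho x)%:E)))//.
by apply/funext => n; exact: nnsfun_density.
Qed.

Lemma integrable_density (f : T -> R) : measurable_fun setT f ->
  nu.-integrable setT (EFin \o f) <-> mu.-integrable setT (EFin \o (fun x => f x * rho x)%R).
Proof.
move=> mf.
have E : \int[nu]_x `|(f x)%:E| = \int[mu]_x `|((f x * rho x)%R)%:E|.
  rewrite ge0_integral_density//; last by apply: measurableT_comp => //; exact/measurable_EFinP.
  by apply: eq_integral => x _; rewrite EFinM abseM (gee0_abs (_ : 0 <= (rho x)%:E)%E) ?lee_fin.
split=> /integrableP[_ h]; apply/integrableP; split.
- by apply/measurable_EFinP; exact: measurable_funM.
- by rewrite -E.
- exact/measurable_EFinP.
- by rewrite E.
Qed.

Lemma Rintegral_density (f : T -> R) : nu.-integrable setT (EFin \o f) ->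
  Rintegral nu setT f = Rintegral mu setT (fun x => f x * rho x)%R.
Proof.
move=> fi; have mf : measurable_fun setT f by apply/measurable_EFinP; exact: measurable_int fi.
rewrite /Rintegral integralE [in RHS]integralE.
rewrite !ge0_integral_density//; [|by apply: measurable_funeneg; apply/measurable_EFinP..|by apply: measurable_funepos; apply/measurable_EFinP].
congr (fine (_ - _)); apply: eq_integral => x _.
  by rewrite !funeposE /= EFinM maxe_pMl ?lee_fin// mul0e.
by rewrite !funenegE /= -mulNr EFinM maxe_pMl ?lee_fin// mul0e.
Qed.

Lemma cintegrable_density (f : T -> R[i]) : cmeasurable f ->
  cintegrable nu setT f <-> cintegrable mu setT (fun x => f x * (rho x)%:C)%R.
Proof.
move=> [mr mi].
have Er : (fun x => complex.Re (f x * (rho x)%:C))%R = (fun x => complex.Re (f x) * rho x)%R.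
  by apply/funext => x; rewrite cReM /= mulr0 subr0.
have Ei : (fun x => complex.Im (f x * (rho x)%:C))%R = (fun x => complex.Im (f x) * rho x)%R.
  by apply/funext => x; rewrite cImM /= mulr0 add0r.
split=> -[hr hi]; split.
- by have := (integrable_density mr).1 hr; rewrite -Er.
- by have := (integrable_density mi).1 hi; rewrite -Ei.
- by apply: (integrable_density mr).2; rewrite -Er.
- by apply: (integrable_density mi).2; rewrite -Ei.
Qed.

Lemma cint_density (f : T -> R[i]) : cintegrable nu setT f ->
  cint nu setT f = cint mu setT (fun x => f x * (rho x)%:C)%R.
Proof.
move=> [hr hi]; apply: complexP => /=; rewrite Rintegral_density//; apply: eq_Rintegral => x _.
  by rewrite cReM /= mulr0 subr0.
by rewrite cImM /= mulr0 add0r.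
Qed.

End DensityChange.

Section LebesgueTranslation.
Context {R : realType}.
Implicit Types (f : R -> R) (h : R -> R[i]).
Local Notation leb := (@lebesgue_measure R).

Lemma measurable_addr (s : R) :
  measurable_fun [set: measurableTypeR R]
    ((fun t => t + s) : measurableTypeR R -> measurableTypeR R).
Proof. by apply: measurable_funD. Qed.

Lemma leb_translate (s : R) (A : set (measurableTypeR R)) : measurable A ->
  pushforward leb ((fun t => t + s) : measurableTypeR R -> measurableTypeR R) A = leb A.
Proof.
pose m : {measure set (measurableTypeR R) -> \bar R} :=
  measure_function_pushforward__canonical__measure_function_Measure leb (measurable_addr s).
move=> mA; apply/esym; apply: (@lebesgue_measure_unique R m) => //= _ [[a b]] _ <-.
rewrite /pushforward /=.
rewrite (_ : _ @^-1` _ = `]a - s, b - s]%classic); last first.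
  by apply/seteqP; split => x /=; rewrite !in_itv/= ltrBlDr lerBrDr.
rewrite !lebesgue_measure_itv /= !lte_fin ltrD2r.
by case: ifP => // _; rewrite -!EFinB; congr EFin; ring.
Qed.

Lemma ge0_integral_translate (g : R -> \bar R) (s : R) :
  measurable_fun [set: measurableTypeR R] (g : measurableTypeR R -> \bar R) ->
  (forall x, 0 <= g x)%E -> (\int[leb]_(t in setT) g ((t : R) + s)%R = \int[leb]_(t in setT) g t)%E.
Proof.
move=> mg g0.
have := @ge0_integral_pushforward _ _ (measurableTypeR R) (measurableTypeR R) R
  ((fun t => t + s) : measurableTypeR R -> measurableTypeR R) (measurable_addr s) leb setT g measurableT mg (fun y _ => g0 y).
rewrite preimage_setT => <-.
apply: eq_measure_integral; first exact: measurable_addr.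
by move=> ? A mA _; exact: leb_translate.
Qed.

Lemma integrable_translate f (s : R) : leb.-integrable setT (EFin \o f) ->
  leb.-integrable setT (EFin \o (fun t => f (t + s))).
Proof.
move=> /integrableP[/measurable_EFinP mf fi]; apply/integrableP; split.
  apply/measurable_EFinP; exact: (measurableT_comp mf (measurable_addr s)).
rewrite (ge0_integral_translate (g := fun t => `|(f t)%:E|%E)) //.
by apply: measurableT_comp => //; exact/measurable_EFinP.
Qed.

Lemma Rintegral_translate f (s : R) : measurable_fun setT f ->
  Rintegral leb setT (fun t => f (t + s)) = Rintegral leb setT f.
Proof.
move=> mf0.
have mf : measurable_fun [set: measurableTypeR R] (EFin \o f) by exact/measurable_EFinP.
have mp : measurable_fun [set: measurableTypeR R] (EFin \o f)^\+%E by exact: measurable_funepos.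
have mn : measurable_fun [set: measurableTypeR R] (EFin \o f)^\-%E by exact: measurable_funeneg.
rewrite /Rintegral integralE [in RHS]integralE; congr (fine (_ - _)).
  transitivity (\int[leb]_(t in setT) (EFin \o f)^\+%E (t + s)%R)%E.
    by apply: eq_integral => x _; rewrite !funeposE.
  exact: (ge0_integral_translate s mp (funepos_ge0 _)).
transitivity (\int[leb]_(t in setT) (EFin \o f)^\-%E (t + s)%R)%E.
  by apply: eq_integral => x _; rewrite !funenegE.
exact: (ge0_integral_translate s mn (funeneg_ge0 _)).
Qed.

Lemma cint_translate h (s : R) : cmeasurable h ->
  cint leb setT (fun t => h (t + s)) = cint leb setT h.
Proof.
move=> [mr mi]; apply: complexP => /=.
  exact: (Rintegral_translate (f := fun t => complex.Re (h t))).
exact: (Rintegral_translate (f := fun t => complex.Im (h t))).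
Qed.

Lemma cintegrable_translate h (s : R) : cintegrable leb setT h ->
  cintegrable leb setT (fun t => h (t + s)).
Proof.
by move=> [hr hi]; split; [exact: (integrable_translate s hr)|exact: (integrable_translate s hi)].
Qed.

Lemma Rintegral_derive0 (F f : R -> R) :
  (forall t : R, is_derive t (1 : R) F (f t)) -> continuous f ->
  leb.-integrable setT (EFin \o f) ->
  F n%:R @[n --> \oo] --> (0 : R) -> F (- n%:R) @[n --> \oo] --> (0 : R) ->
  Rintegral leb setT f = 0.
Proof.
move=> dF cf fi F0 F0'.
pose f_ n := (fun t => \1_(`[- n%:R, n%:R]%classic : set R) t * f t).
have mf : measurable_fun setT f by exact: continuous_measurable_fun.
have h : [sequence Rintegral leb setT (f_ n)]_n @ \oo --> Rintegral leb setT f.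
  have [|||||_ _ c] := @dominated_convergence _ (measurableTypeR R) R leb setT measurableT
    (fun n x => (f_ n x)%:E) (EFin \o f) (fun x => `|(f x)%:E|%E).
  - by move=> n; apply/measurable_EFinP; exact: measurable_funM.
  - exact/measurable_EFinP.
  - apply: aeW => x _ /=; apply: cvg_EFin; first exact: nearW.
    apply: cvg_near_cst; near=> n; rewrite /= /f_ indicE mem_set ?mul1r//= in_itv/=.
    by rewrite -ler_norml; near: n; exact: nbhs_infty_ger.
  - exact: integrable_abse.
  - apply: aeW => x n _ /=; rewrite lee_fin /f_ indicE.
    by case: (_ \in _); rewrite ?mul1r ?mul0r ?normr0.
  apply: fine_cvg; rewrite /= fineK//; exact: integrable_fin_num.
have E : forall n, (0 < n)%N -> Rintegral leb setT (f_ n) = F n%:R - F (- n%:R).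
  move=> n n0; rewrite /Rintegral -[RHS]/(fine ((F n%:R)%:E - (F (- n%:R))%:E)); congr fine.
  rewrite -(@continuous_FTC2 R f F (- n%:R) n%:R).
  - rewrite [RHS]integral_mkcond; apply: eq_integral => x _.
    by rewrite patchE /f_ indicE; case: ifPn => _; rewrite ?mul1r ?mul0r.
  - by rewrite gtrN// ltr0n.
  - exact: continuous_subspaceT.
  - split; first by move=> x _; exact: ex_derive.
      by apply: cvg_at_right_filter; apply: differentiable_continuous; apply/derivable1_diffP; exact: ex_derive.
    by apply: cvg_at_left_filter; apply: differentiable_continuous; apply/derivable1_diffP; exact: ex_derive.
  - by move=> x _; rewrite derive1E derive_val.
have h0 : [sequence Rintegral leb setT (f_ n)]_n @ \oo --> (0 : R).
  have : F n%:R - F (- n%:R) @[n --> \oo] --> (0 : R).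
    by rewrite -[X in _ --> X](subr0 (0 : R)); exact: cvgB.
  apply: cvg_trans; apply: near_eq_cvg; near=> n; rewrite /= E//.
  by near: n; exists 1%N.
exact: (cvg_unique _ h h0).
Unshelve. all: by end_near. Qed.

End LebesgueTranslation.

(** * Iterated integrals and Fourier transforms of integrable functions *)

Section ParametricIntegrals.
Context {d1 d2 : measure_display} {T1 : measurableType d1} {T2 : measurableType d2} {R : realType}.
Variables (m1 : {sigma_finite_measure set T1 -> \bar R}) (m2 : {sigma_finite_measure set T2 -> \bar R}).

Lemma measurable_Rintegral (F : T1 -> T2 -> R) (D : set T2) : measurable D ->
  measurable_fun setT (fun z : T1 * T2 => F z.1 z.2) ->
  measurable_fun setT (fun x => Rintegral m2 D (F x)).
Proof.
move=> mD mF.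
pose G (z : T1 * T2) := (F z.1 z.2 * \1_D z.2)%:E.
have mG : measurable_fun setT G.
  apply/measurable_EFinP; apply: measurable_funM => //.
  exact: (measurableT_comp (measurable_indic mD) measurable_snd).
have -> : (fun x => Rintegral m2 D (F x)) = fine \o (fun x =>
    \int[m2]_y G^\+ (x, y) - \int[m2]_y G^\- (x, y))%E.
  apply/funext => x /=; rewrite /Rintegral integral_mkcond; congr fine.
  rewrite integralE; congr (_ - _)%E; apply: eq_integral => y _.
    by rewrite !funeposE /G /= patchE indicE; case: ifPn => _ /=; rewrite ?mulr1 ?mulr0.
  by rewrite !funenegE /G /= patchE indicE; case: ifPn => _ /=; rewrite ?mulr1 ?mulr0.
apply: measurableT_comp => //; apply: emeasurable_funB.
  by apply: (measurable_fun_fubini_tonelli_F (fun z => G^\+ z)%E) => //; exact: measurable_funepos.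
by apply: (measurable_fun_fubini_tonelli_F (fun z => G^\- z)%E) => //; exact: measurable_funeneg.
Qed.

Lemma cmeas_cint (F : T1 -> T2 -> R[i]) (D : set T2) : measurable D ->
  cmeasurable (fun z : T1 * T2 => F z.1 z.2) ->
  cmeasurable (fun x => cint m2 D (F x)).
Proof. by move=> mD [mr mi]; split; exact: measurable_Rintegral. Qed.

(** A product majorant makes [F] integrable on the product space and all its
    sections integrable, which are the side conditions of Fubini's theorem. *)
Lemma RFubini (F : T1 -> T2 -> R) (a : T1 -> R) (b : T2 -> R) :
  measurable_fun setT (fun z : T1 * T2 => F z.1 z.2) ->
  m1.-integrable setT (EFin \o a) -> m2.-integrable setT (EFin \o b) ->
  (forall x, 0 <= a x) -> (forall y, 0 <= b y) ->
  (forall x y, `|F x y| <= a x * b y) ->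
  Rintegral m1 setT (fun x => Rintegral m2 setT (F x)) =
  Rintegral m2 setT (fun y => Rintegral m1 setT (F ^~ y)).
Proof.
move=> mF ia ib a0 b0 Fab.
have mE : measurable_fun setT (fun z : T1 * T2 => (F z.1 z.2)%:E) by exact/measurable_EFinP.
have ix x : m2.-integrable setT (EFin \o F x).
  apply: (@le_integrable _ _ _ m2 setT measurableT _ (fun y => (a x * b y)%:E)).
  - apply/measurable_EFinP; exact: (measurableT_comp mF (measurable_pair1 x)).
  - by move=> y _ /=; rewrite lee_fin (ger0_norm (mulr_ge0 (a0 x) (b0 y))).
  - by under eq_fun do rewrite EFinM; exact: integrableZl.
have iy y : m1.-integrable setT (EFin \o F ^~ y).
  apply: (@le_integrable _ _ _ m1 setT measurableT _ (fun x => (b y * a x)%:E)).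
  - apply/measurable_EFinP; exact: (measurableT_comp mF (measurable_pair2 y)).
  - by move=> x _ /=; rewrite lee_fin (ger0_norm (mulr_ge0 (b0 y) (a0 x))) mulrC.
  - by under eq_fun do rewrite EFinM; exact: integrableZl.
have iF : (m1 \x m2)%E.-integrable setT (fun z : T1 * T2 => (F z.1 z.2)%:E).
  apply/integrable12ltyP => //=.
  apply: (@le_lt_trans _ _ (\int[m1]_x \int[m2]_y (a x * b y)%:E)%E).
    apply: ge0_le_integral => //.
    - by move=> x _; exact: integral_ge0.
    - by apply: (measurable_fun_fubini_tonelli_F (fun z => `|(F z.1 z.2)%:E|)%E) => //; exact: measurableT_comp.
        - apply: (measurable_fun_fubini_tonelli_F (fun z => (a z.1 * b z.2)%:E)); last first.
        by move=> z; rewrite lee_fin mulr_ge0.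
      apply/measurable_EFinP; apply: measurable_funM.
        apply: (measurableT_comp _ measurable_fst); apply/measurable_EFinP; exact: measurable_int ia.
      apply: (measurableT_comp _ measurable_snd); apply/measurable_EFinP; exact: measurable_int ib.
    - move=> x _; apply: ge0_le_integral => //.
      + by apply/measurable_EFinP; apply: measurableT_comp => //; exact: (measurableT_comp mF (measurable_pair1 x)).
      + by apply/measurable_EFinP; apply: measurable_funM => //; apply/measurable_EFinP; exact: measurable_int ib.
      + by move=> y _; rewrite lee_fin.
  under eq_integral.
    move=> x _; rewrite (eq_integral (fun y => (a x)%:E * (b y)%:E)%E) ?integralZl//.
    rewrite -(fineK (integrable_fin_num measurableT ib)) muleC; over.
  rewrite integralZl//.
  by rewrite -(fineK (integrable_fin_num measurableT ia)) -EFinM ltry.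
have E := Fubini iF.
rewrite /Rintegral; congr fine.
transitivity (\int[m1]_x \int[m2]_y (F x y)%:E)%E.
  by apply: eq_integral => x _; rewrite fineK// integrable_fin_num// ix.
rewrite [LHS]E; apply: eq_integral => y _.
by rewrite fineK// integrable_fin_num// iy.
Qed.

Lemma cFubini (F : T1 -> T2 -> R[i]) (a : T1 -> R) (b : T2 -> R) :
  cmeasurable (fun z : T1 * T2 => F z.1 z.2) ->
  m1.-integrable setT (EFin \o a) -> m2.-integrable setT (EFin \o b) ->
  (forall x, 0 <= a x) -> (forall y, 0 <= b y) ->
  (forall x y, cmod (F x y) <= a x * b y) ->
  cint m1 setT (fun x => cint m2 setT (F x)) =
  cint m2 setT (fun y => cint m1 setT (F ^~ y)).
Proof.
move=> [mr mi] ia ib a0 b0 Fab; apply: complexP => /=.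
  apply: (RFubini (F := fun x y => complex.Re (F x y)) mr ia ib a0 b0) => x y.
  exact: le_trans (Re_le_cmod _) (Fab x y).
apply: (RFubini (F := fun x y => complex.Im (F x y)) mi ia ib a0 b0) => x y.
exact: le_trans (Im_le_cmod _) (Fab x y).
Qed.

Lemma cmeas_fst (f : T1 -> R[i]) : cmeasurable f -> cmeasurable (fun z : T1 * T2 => f z.1).
Proof.
by move=> [mr mi]; split; [exact: (measurableT_comp mr measurable_fst)|exact: (measurableT_comp mi measurable_fst)].
Qed.
Lemma cmeas_snd (f : T2 -> R[i]) : cmeasurable f -> cmeasurable (fun z : T1 * T2 => f z.2).
Proof.
by move=> [mr mi]; split; [exact: (measurableT_comp mr measurable_snd)|exact: (measurableT_comp mi measurable_snd)].
Qed.
End ParametricIntegrals.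

Section SchwartzFunctions.
Context {R : realType}.
Implicit Types (phi psi : R -> R[i]) (h f : R -> R[i]).
Local Notation leb := (@lebesgue_measure R).
Local Notation TR := (measurableTypeR R).

Lemma integrable_oneDsqrV : leb.-integrable setT (EFin \o (fun t : R => (1 + t ^+ 2)^-1)).
Proof.
have p (t : R) : 0 <= (1 + t ^+ 2)^-1 by rewrite invr_ge0 addr_ge0// sqr_ge0.
apply/integrableP; split.
  apply/measurable_EFinP; apply: continuous_measurable_fun; exact: continuous_oneDsqrV.
under eq_integral do rewrite gee0_abs ?lee_fin//=.
rewrite ge0_symfun_integralT//.
- rewrite -set_itvcy; have -> := @integral0y_oneDsqr R.
  by rewrite -EFinM ltry.
- exact: continuous_oneDsqrV.
- by move=> t /=; rewrite sqrrN.
Qed.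

Lemma integrable_oneDsqrVZ (C : R) : leb.-integrable setT (EFin \o (fun t : R => C / (1 + t ^+ 2))).
Proof.
by under [X in integrable _ _ X]funext do rewrite /= EFinM; apply: integrableZl => //; exact: integrable_oneDsqrV.
Qed.

Definition cis (x : R) : R[i] := cos x +i* sin x.

Lemma cisD x y : cis (x + y) = cis x * cis y.
Proof. by apply: complexP; rewrite !cReImE /= ?cosD ?sinD//; ring. Qed.
Lemma cmod_cis x : cmod (cis x) = 1. Proof. exact: cmod_cossin. Qed.
Lemma cis0 : cis 0 = 1. Proof. by rewrite /cis cos0 sin0. Qed.
Lemma cisN x : cis (- x) = cos x -i* sin x.
Proof. by rewrite /cis cosN sinN. Qed.
Lemma cmeas_cis d (T : measurableType d) (f : T -> R) : measurable_fun setT f ->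
  cmeasurable (fun x => cis (f x)).
Proof.
move=> mf; split => /=.
  by apply: (measurableT_comp _ mf); apply: continuous_measurable_fun; exact: continuous_cos.
by apply: (measurableT_comp _ mf); apply: continuous_measurable_fun; exact: continuous_sin.
Qed.

Lemma fourierE h w : fourier h w = cint leb setT (fun t => h t * cis (- (t * w))).
Proof. by rewrite /fourier; apply: eq_cint => t _; rewrite cisN. Qed.

Lemma measurable_mulxy : measurable_fun setT (fun z : R * R => - (z.1 * z.2)).
Proof. by apply: measurableT_comp => //; apply: measurable_funM. Qed.

Lemma cmeas_fourier h : cmeasurable h -> cmeasurable (fourier h).
Proof.
move=> mh; apply: (@cmeasE _ TR R (fun w => cint leb setT (fun t => h t * cis (- (w * t))))).
  apply: (@cmeas_cint _ _ TR TR R leb (fun w t => h t * cis (- (w * t))) setT) => //.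
  apply: cmeasM; first exact: cmeas_snd.
  by apply: cmeas_cis; exact: measurable_mulxy.
by move=> w; rewrite fourierE; apply: eq_cint => t _; rewrite (mulrC w).
Qed.

Lemma fourier_integrable h w : cmeasurable h -> cintegrable leb setT h ->
  cintegrable leb setT (fun t => h t * cis (- (t * w))).
Proof.
move=> mh ih; apply: (cmeas_cintegrable measurableT _ _ (cintegrable_cmod measurableT ih)).
  apply: cmeasM => //; apply: cmeas_cis; apply: measurableT_comp => //.
  exact: measurable_funM.
by move=> t _; rewrite cmodM cmod_cis mulr1.
Qed.

Lemma cmod_fourier_le h w : cmeasurable h -> cintegrable leb setT h ->
  cmod (fourier h w) <= Rintegral leb setT (fun t => cmod (h t)).
Proof.
move=> mh ih; rewrite fourierE (le_trans (cmod_cint_le measurableT (fourier_integrable w mh ih)))//.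
by under eq_Rintegral do rewrite cmodM cmod_cis mulr1.
Qed.

(** The multiplication formula: both sides are the double integral of
    [f(t) g(w) e^(-itw)]. *)
Lemma fourier_mult f g : cmeasurable f -> cintegrable leb setT f ->
  cmeasurable g -> cintegrable leb setT g ->
  cint leb setT (fun t => f t * fourier g t) = cint leb setT (fun w => fourier f w * g w).
Proof.
move=> mf jf mg jg.
have jfm := cintegrable_cmod measurableT jf; have jgm := cintegrable_cmod measurableT jg.
transitivity (cint leb setT (fun t => cint leb setT (fun w => f t * g w * cis (- (t * w))))).
  apply: eq_cint => t _; rewrite fourierE -cintZl//; last exact: fourier_integrable.
  by apply: eq_cint => w _; rewrite mulrA (mulrC w).
rewrite (@cFubini _ _ _ _ _ leb leb (fun t w => f t * g w * cis (- (t * w)))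
  (fun t => cmod (f t)) (fun t => cmod (g t)))//.
- apply: eq_cint => w _; rewrite fourierE mulrC -cintZl//; last exact: fourier_integrable.
  by apply: eq_cint => t _; ring.
- apply: cmeasM; last by apply: cmeas_cis; exact: measurable_mulxy.
  by apply: cmeasM; [exact: cmeas_fst|exact: cmeas_snd].
- by move=> t; exact: cmod_ge0.
- by move=> t; exact: cmod_ge0.
- by move=> t w; rewrite !cmodM cmod_cis mulr1.
Qed.

Lemma fourier_translate h s w : cmeasurable h -> cintegrable leb setT h ->
  fourier (fun t => h (t + s)) w = cis (s * w) * fourier h w.
Proof.
move=> mh ih; rewrite !fourierE -cintZl//; last exact: fourier_integrable.
rewrite -[RHS](@cint_translate _ _ s); last first.
  apply: cmeasM; first exact: cmeas_cst.
  apply: cmeasM => //; apply: cmeas_cis; apply: measurableT_comp => //.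
  exact: measurable_funM.
apply: eq_cint => t _; rewrite mulrCA -cisD; congr (_ * cis _); ring.
Qed.

Lemma schwartz_decay phi j k : schwartz phi ->
  exists C, forall t, `|t| ^+ j * cmod (cderiven k phi t) <= C.
Proof. by move=> [_ /(_ j k)[C hC]]; exists C => t; apply: hC; exists t. Qed.

Lemma schwartz_oneDsqr phi k : schwartz phi ->
  exists C, forall t, cmod (cderiven k phi t) <= C / (1 + t ^+ 2).
Proof.
move=> sp; have [C1 h1] := schwartz_decay 0 k sp; have [C2 h2] := schwartz_decay 2 k sp.
exists (C1 + C2) => t; rewrite ler_pdivlMr; last by rewrite ltr_wpDr ?sqr_ge0.
have := lerD (h1 t) (h2 t); rewrite expr0 mul1r real_normK ?num_real//.
by rewrite mulrDr mulr1 (mulrC (t ^+ 2)).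
Qed.

Lemma cderiven0 phi t : cderiven 0 phi t = phi t.
Proof. by rewrite /cderiven !derive1n0; case: (phi t). Qed.

Lemma schwartz_Re phi k (t : R) : schwartz phi ->
  is_derive t (1 : R) (fun u => complex.Re (cderiven k phi u)) (complex.Re (cderiven k.+1 phi t)).
Proof.
move=> [/(_ k t)[dr _] _]; rewrite /cderiven /= -/(derive1n k _) derive1E.
by apply: DeriveDef.
Qed.
Lemma schwartz_Im phi k (t : R) : schwartz phi ->
  is_derive t (1 : R) (fun u => complex.Im (cderiven k phi u)) (complex.Im (cderiven k.+1 phi t)).
Proof.
move=> [/(_ k t)[_ di] _]; rewrite /cderiven /= -/(derive1n k _) derive1E.
by apply: DeriveDef.
Qed.

Lemma is_derive_continuous (F f : R -> R) : (forall t : R, is_derive t (1 : R) F (f t)) -> continuous F.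
Proof.
move=> h t; apply: differentiable_continuous; apply/derivable1_diffP.
exact: ex_derive.
Qed.

Lemma schwartz_Re_continuous phi k : schwartz phi -> continuous (fun u => complex.Re (cderiven k phi u)).
Proof. by move=> sp; apply: (is_derive_continuous (fun t => schwartz_Re k t sp)). Qed.
Lemma schwartz_Im_continuous phi k : schwartz phi -> continuous (fun u => complex.Im (cderiven k phi u)).
Proof. by move=> sp; apply: (is_derive_continuous (fun t => schwartz_Im k t sp)). Qed.

Lemma cmeas_cderiven phi k : schwartz phi -> cmeasurable (cderiven k phi).
Proof.
move=> sp; split; apply: continuous_measurable_fun.
  exact: schwartz_Re_continuous.
exact: schwartz_Im_continuous.
Qed.

Lemma cintegrable_cderiven phi k : schwartz phi -> cintegrable leb setT (cderiven k phi).
Proof.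
move=> sp; have [C hC] := schwartz_oneDsqr k sp.
apply: (@cmeas_cintegrable _ TR _ leb _ measurableT _ _ _ _ (integrable_oneDsqrVZ C)).
  exact: cmeas_cderiven.
by move=> t _; exact: hC.
Qed.

Lemma cmeas_schwartz phi : schwartz phi -> cmeasurable phi.
Proof. by move=> sp; apply: (cmeasE (cmeas_cderiven 0 sp)) => t; exact: cderiven0. Qed.
Lemma cintegrable_schwartz phi : schwartz phi -> cintegrable leb setT phi.
Proof.
by move=> sp; apply: (@eq_cintegrable _ TR _ _ _ measurableT _ _ _ (cintegrable_cderiven 0 sp)) => t _; exact: cderiven0.
Qed.
Lemma schwartz_bounded phi : schwartz phi -> exists C, forall t, cmod (phi t) <= C.
Proof.
by move=> sp; have [C h] := schwartz_decay 0 0 sp; exists C => t; have := h t; rewrite expr0 mul1r cderiven0.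
Qed.

End SchwartzFunctions.

(** * Fourier transforms of Schwartz functions *)

Section ComplexDerivative.
Context {R : realType}.
Implicit Types (F f : R -> R[i]) (phi : R -> R[i]).
Local Notation leb := (@lebesgue_measure R).
Local Notation TR := (measurableTypeR R).

Definition cderive F f := forall t : R,
  is_derive t (1 : R) (fun u => complex.Re (F u)) (complex.Re (f t)) /\
  is_derive t (1 : R) (fun u => complex.Im (F u)) (complex.Im (f t)).
Definition ccont F := continuous (fun u => complex.Re (F u)) /\ continuous (fun u => complex.Im (F u)).

Lemma is_derive_add (f g : R -> R) (t df dg : R) : is_derive t (1 : R) f df ->
  is_derive t (1 : R) g dg -> is_derive t (1 : R) (fun x => f x + g x) (df + dg).
Proof. by move=> h1 h2; exact: (is_deriveD h1 h2). Qed.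
Lemma is_derive_opp (f : R -> R) (t df : R) : is_derive t (1 : R) f df ->
  is_derive t (1 : R) (fun x => - f x) (- df).
Proof. by move=> h; exact: (is_deriveN h). Qed.
Lemma is_derive_mul (f g : R -> R) (t df dg : R) : is_derive t (1 : R) f df ->
  is_derive t (1 : R) g dg -> is_derive t (1 : R) (fun x => f x * g x) (df * g t + f t * dg).
Proof.
move=> h1 h2; apply: (is_derive_eq (is_deriveM h1 h2)).
by rewrite /GRing.scale /= addrC (mulrC (g t)).
Qed.
Lemma is_derive_comp (f g : R -> R) (t df dg : R) : is_derive (g t) (1 : R) f df ->
  is_derive t (1 : R) g dg -> is_derive t (1 : R) (fun x => f (g x)) (df * dg).
Proof. by move=> h1 h2; exact: (is_derive1_comp h1 h2). Qed.

Lemma ccontM F G : ccont F -> ccont G -> ccont (fun t => F t * G t).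
Proof.
move=> [Fr Fi] [Gr Gi]; split => t.
  by under eq_fun do rewrite cReM; apply: cvgB; apply: cvgM; [exact: Fr|exact: Gr|exact: Fi|exact: Gi].
by under eq_fun do rewrite cImM; apply: cvgD; apply: cvgM; [exact: Fr|exact: Gi|exact: Fi|exact: Gr].
Qed.
Lemma ccontD F G : ccont F -> ccont G -> ccont (fun t => F t + G t).
Proof.
move=> [Fr Fi] [Gr Gi]; split => t.
  by under eq_fun do rewrite cReD; apply: cvgD; [exact: Fr|exact: Gr].
by under eq_fun do rewrite cImD; apply: cvgD; [exact: Fi|exact: Gi].
Qed.
Lemma ccont_cst (z : R[i]) : ccont (fun=> z).
Proof. by split => t; exact: cvg_cst. Qed.
Lemma cderive_ccont F f : cderive F f -> ccont F.
Proof.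
move=> dF; split.
  by apply: (is_derive_continuous (f := fun t => complex.Re (f t))) => t; case: (dF t).
by apply: (is_derive_continuous (f := fun t => complex.Im (f t))) => t; case: (dF t).
Qed.
Lemma cderiveM F f G g : cderive F f -> cderive G g ->
  cderive (fun t => F t * G t) (fun t => f t * G t + F t * g t).
Proof.
move=> dF dG t; have [Fr Fi] := dF t; have [Gr Gi] := dG t; split.
  under eq_fun do rewrite cReM.
  apply: (is_derive_eq (is_derive_add (is_derive_mul Fr Gr) (is_derive_opp (is_derive_mul Fi Gi)))).
  by rewrite !cReImE; ring.
under eq_fun do rewrite cImM.
apply: (is_derive_eq (is_derive_add (is_derive_mul Fr Gi) (is_derive_mul Fi Gr))).
by rewrite !cReImE; ring.
Qed.

Lemma is_derive_mulr (w t : R) : is_derive t (1 : R) (fun u => u * w) w.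
Proof.
apply: (is_derive_eq (is_derive_mul (is_derive_id t (1 : R)) (is_derive_cst w t (1 : R)))).
by rewrite mulr0 addr0 mul1r.
Qed.

Lemma cderive_cis (w : R) : cderive (fun t => cis (t * w)) (fun t => 'i * w%:C * cis (t * w)).
Proof.
move=> t; split => /=.
  apply: (is_derive_eq (is_derive_comp (is_derive_cos _) (is_derive_mulr w t))).
  by ring.
apply: (is_derive_eq (is_derive_comp (is_derive_sin _) (is_derive_mulr w t))).
by ring.
Qed.

Lemma cderive_schwartz phi k : schwartz phi -> cderive (cderiven k phi) (cderiven k.+1 phi).
Proof. by move=> sp t; split; [exact: schwartz_Re|exact: schwartz_Im]. Qed.

Lemma cvg_oneDsqrV (C : R) : C / (1 + n%:R ^+ 2) @[n --> \oo] --> (0 : R).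
Proof.
rewrite -[X in _ --> X](mulr0 C); apply: cvgM; first exact: cvg_cst.
apply: (@squeeze_cvgr _ _ _ _ (cst 0) (fun n => n.+1%:R^-1)); [|exact: cvg_cst|exact: cvg_harmonic].
apply: nearW => n; apply/andP; split; first by rewrite invr_ge0 addr_ge0// sqr_ge0.
rewrite lef_pV2 ?posrE ?ltr_wpDr ?sqr_ge0// -natr1 addrC lerD2l -natrX ler_nat.
by case: n => // n; rewrite -{1}[n.+1]muln1 leq_mul.
Qed.

(** The form in which integration by parts is used: the boundary terms are
    killed by the decay of [F] along the integers. *)
Lemma cint_derive0 F f (C : R) : cderive F f -> ccont f -> cintegrable leb setT f ->
  (forall t, cmod (F t) <= C / (1 + t ^+ 2)) -> cint leb setT f = 0.
Proof.
move=> dF [cr ci] [ir ii] FC.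
have c0 (h : R -> R) : (forall t, `|h t| <= C / (1 + t ^+ 2)) ->
    h n%:R @[n --> \oo] --> (0 : R) /\ h (- n%:R) @[n --> \oo] --> (0 : R).
  move=> hC; split; apply: norm_cvg0.
    apply: (@squeeze_cvgr _ _ _ _ (cst 0) (fun n => C / (1 + n%:R ^+ 2))); [|exact: cvg_cst|exact: cvg_oneDsqrV].
    by apply: nearW => n; rewrite /= normr_ge0 hC.
  apply: (@squeeze_cvgr _ _ _ _ (cst 0) (fun n => C / (1 + n%:R ^+ 2))); [|exact: cvg_cst|exact: cvg_oneDsqrV].
  by apply: nearW => n; rewrite /= normr_ge0 (le_trans (hC _))// sqrrN.
have [r1 r2] := c0 (fun t => complex.Re (F t)) (fun t => le_trans (Re_le_cmod _) (FC t)).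
have [i1 i2] := c0 (fun t => complex.Im (F t)) (fun t => le_trans (Im_le_cmod _) (FC t)).
apply: complexP => /=.
  by apply: (Rintegral_derive0 (F := fun t => complex.Re (F t))) => // t; case: (dF t).
by apply: (Rintegral_derive0 (F := fun t => complex.Im (F t))) => // t; case: (dF t).
Qed.

(** Integration by parts turns differentiation into multiplication by [iw]. *)
Lemma fourier_cderiven phi k w : schwartz phi ->
  fourier (cderiven k.+1 phi) w = 'i * w%:C * fourier (cderiven k phi) w.
Proof.
move=> sp; have [C hC] := schwartz_oneDsqr k sp.
have i1 := fourier_integrable w (cmeas_cderiven k.+1 sp) (cintegrable_cderiven k.+1 sp).
have i0 := fourier_integrable w (cmeas_cderiven k sp) (cintegrable_cderiven k sp).
apply/eqP; rewrite -subr_eq0; apply/eqP.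
rewrite !fourierE -cintZl// -cintB//; last exact: cintegrableZl.
have dE := cderive_cis (- w).
have h := cderiveM (cderive_schwartz k sp) dE.
rewrite -(@cint_derive0 _ _ C h); last 3 first.
- apply: ccontD; apply: ccontM.
  + exact: cderive_ccont (cderive_schwartz k.+1 sp).
  + exact: cderive_ccont dE.
  + exact: cderive_ccont (cderive_schwartz k sp).
  + by apply: ccontM; [exact: ccont_cst|exact: cderive_ccont dE].
- apply: (@eq_cintegrable _ TR _ _ _ measurableT (fun t => cderiven k.+1 phi t * cis (- (t * w))
     - 'i * w%:C * (cderiven k phi t * cis (- (t * w))))).
    by move=> t _; rewrite mulrN rmorphN; ring.
  by apply: cintegrableB => //; exact: cintegrableZl.
- by move=> t; rewrite cmodM cmod_cis mulr1.
by apply: eq_cint => t _; rewrite mulrN rmorphN; ring.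
Qed.

Lemma fourier_cderiven0 phi k w : schwartz phi ->
  fourier (cderiven k phi) w = ('i * w%:C) ^+ k * fourier phi w.
Proof.
move=> sp; elim: k => [|k ih]; last by rewrite fourier_cderiven// ih exprS mulrA.
by rewrite expr0 mul1r /fourier; apply: eq_cint => t _; rewrite cderiven0.
Qed.

Lemma fourier_decay_pow phi k : schwartz phi ->
  exists C, forall w, `|w| ^+ k * cmod (fourier phi w) <= C.
Proof.
move=> sp; exists (Rintegral leb setT (fun t => cmod (cderiven k phi t))) => w.
have := cmod_fourier_le w (cmeas_cderiven k sp) (cintegrable_cderiven k sp).
by rewrite fourier_cderiven0// cmodM cmodX cmodM cmodi mul1r cmodR.
Qed.

Lemma pow_oneD_le (x : R) n : 0 <= x -> (1 + x) ^+ n <= 2 ^+ n * (1 + x ^+ n).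
Proof.
move=> x0; have [x1|x1] := leP x 1.
  apply: (@le_trans _ _ (2 ^+ n)); first by rewrite lerXn2r ?nnegrE ?addr_ge0//; lra.
  by rewrite ler_peMr ?exprn_ge0// lerDl exprn_ge0.
apply: (@le_trans _ _ ((2 * x) ^+ n)); first by rewrite lerXn2r ?nnegrE ?addr_ge0 ?mulr_ge0//; lra.
by rewrite exprMn ler_wpM2l ?exprn_ge0// lerDr.
Qed.

(** Differentiability becomes decay: by [fourier_cderiven0] the product [w^k
    phi^] is the transform of an integrable function, hence bounded. *)
Lemma fourier_decay phi n : schwartz phi ->
  exists C, forall w, cmod (fourier phi w) <= C / (1 + w ^+ 2) ^+ n.
Proof.
move=> sp; have [C1 h1] := fourier_decay_pow 0 sp; have [C2 h2] := fourier_decay_pow (2 * n) sp.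
exists (2 ^+ n * (C1 + C2)) => w.
have p : 0 < (1 + w ^+ 2) ^+ n by rewrite exprn_gt0// ltr_wpDr ?sqr_ge0.
rewrite ler_pdivlMr//.
apply: (@le_trans _ _ (cmod (fourier phi w) * (2 ^+ n * (1 + (w ^+ 2) ^+ n)))).
  by rewrite ler_wpM2l ?cmod_ge0// pow_oneD_le ?sqr_ge0.
have := lerD (h1 w) (h2 w); rewrite expr0 mul1r.
rewrite exprM real_normK ?num_real// => h.
rewrite mulrCA ler_wpM2l ?exprn_ge0//.
by rewrite mulrDr mulr1 (mulrC _ ((w ^+ 2) ^+ n)).
Qed.

Lemma cintegrable_fourier phi : schwartz phi -> cintegrable leb setT (fourier phi).
Proof.
move=> sp; have [C hC] := fourier_decay 1 sp.
apply: (@cmeas_cintegrable _ TR _ leb _ measurableT _ _ _ _ (integrable_oneDsqrVZ C)).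
  by apply: cmeas_fourier; exact: cmeas_schwartz.
by move=> t _; have := hC t; rewrite expr1.
Qed.

Lemma cmeas_opp_deriv phi : schwartz phi -> cmeasurable (opp_deriv phi).
Proof. by move=> sp; apply: cmeasN; exact: cmeas_cderiven. Qed.
Lemma cintegrable_opp_deriv phi : schwartz phi -> cintegrable leb setT (opp_deriv phi).
Proof. by move=> sp; apply: (@cintegrableN _ TR) => //; exact: cintegrable_cderiven. Qed.

Lemma fourierN f w : cmeasurable f -> cintegrable leb setT f ->
  fourier (fun t => - f t) w = - fourier f w.
Proof.
move=> mf jf; rewrite !fourierE -cintN//; last exact: fourier_integrable.
by apply: eq_cint => t _; rewrite mulNr.
Qed.
Lemma fourierZ z f w : cmeasurable f -> cintegrable leb setT f ->
  fourier (fun t => z * f t) w = z * fourier f w.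
Proof.
move=> mf jf; rewrite !fourierE -cintZl//; last exact: fourier_integrable.
by apply: eq_cint => t _; rewrite mulrA.
Qed.
Lemma fourierD f g w : cmeasurable f -> cintegrable leb setT f ->
  cmeasurable g -> cintegrable leb setT g ->
  fourier (fun t => f t + g t) w = fourier f w + fourier g w.
Proof.
move=> mf jf mg jg; rewrite !fourierE -cintD//; try exact: fourier_integrable.
by apply: eq_cint => t _; rewrite mulrDl.
Qed.

Lemma fourier_opp_deriv phi w : schwartz phi ->
  fourier (opp_deriv phi) w = - ('i * w%:C) * fourier phi w.
Proof.
move=> sp; rewrite fourierN; [|exact: cmeas_cderiven|exact: cintegrable_cderiven].
by rewrite fourier_cderiven0// expr1 mulNr.
Qed.

End ComplexDerivative.

Section FunctionDistributions.
Context {R : realType}.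
Implicit Types (f h phi psi : R -> R[i]).
Local Notation leb := (@lebesgue_measure R).
Local Notation TR := (measurableTypeR R).

Lemma cintegrable_bounded_mul f phi (B : R) : cmeasurable f -> (forall t, cmod (f t) <= B) ->
  cmeasurable phi -> cintegrable leb setT phi -> cintegrable leb setT (fun t => f t * phi t).
Proof.
move=> mf fB mp jp.
apply: (@cmeas_cintegrable _ TR _ leb _ measurableT _ (fun t => B * cmod (phi t))).
- exact: cmeasM.
- by move=> t _; rewrite cmodM ler_wpM2r ?cmod_ge0.
- under [X in integrable _ _ X]funext do rewrite /= EFinM.
  by apply: integrableZl => //; exact: (@cintegrable_cmod _ TR).
Qed.

Lemma schwartz_seminorm_ge j k phi t : schwartz phi ->
  `|t| ^+ j * cmod (cderiven k phi t) <= schwartz_seminorm j k phi.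
Proof. by move=> [_ /(_ j k) ub]; apply: ub_le_sup => //; exists t. Qed.

Lemma schwartz_seminorm_ge0 j k phi : schwartz phi -> 0 <= schwartz_seminorm j k phi.
Proof.
move=> sp; apply: le_trans (schwartz_seminorm_ge j k 0 sp).
by rewrite mulr_ge0 ?exprn_ge0 ?cmod_ge0.
Qed.

Lemma tempered_distr f (B : R) : cmeasurable f -> (forall t, cmod (f t) <= B) ->
  tempered (distr f).
Proof.
move=> mf fB.
have B0 : 0 <= B by rewrite (le_trans (cmod_ge0 _) (fB 0)).
have ji phi : schwartz phi -> cintegrable leb setT (fun t => f t * phi t).
  by move=> sp; apply: cintegrable_bounded_mul (fB) _ _ => //; [exact: cmeas_schwartz|exact: cintegrable_schwartz].
split.
  move=> a phi1 phi2 s1 s2; rewrite /distr -cintZl; [|exact: measurableT|exact: ji].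
  rewrite -cintD; [|exact: measurableT|by apply: (@cintegrableZl _ TR) => //; exact: ji|exact: ji].
  by apply: eq_cint => t _; ring.
set I := Rintegral leb setT (fun t : R => (1 + t ^+ 2)^-1).
exists (B * I), 3%N => phi sp.
set S := \sum_(j < 3) _.
have S0 t : cmod (phi t) <= S * (1 + t ^+ 2)^-1.
  have q : 0 < 1 + t ^+ 2 by rewrite ltr_wpDr ?sqr_ge0.
  rewrite ler_pdivlMr//.
  have h0 := schwartz_seminorm_ge 0 0 t sp; have h2 := schwartz_seminorm_ge 2 0 t sp.
  move: h0 h2; rewrite !cderiven0 expr0 mul1r real_normK ?num_real// => h0 h2.
  have -> : cmod (phi t) * (1 + t ^+ 2) = cmod (phi t) + t ^+ 2 * cmod (phi t) by ring.
  apply: (le_trans (lerD h0 h2)).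
  rewrite /S !big_ord_recl !big_ord0 /=.
  have aux (a b c d e f' g h i : R) : 0 <= b -> 0 <= c -> 0 <= d -> 0 <= e -> 0 <= f' ->
    0 <= h -> 0 <= i -> a + g <= a + (b + (c + 0)) + (d + (e + (f' + 0)) + (g + (h + (i + 0)) + 0)).
    by lra.
  by apply: aux; exact: schwartz_seminorm_ge0.
rewrite /distr (le_trans (cmod_cint_le (measurableT : measurable (setT : set TR)) (ji _ sp)))//.
have -> : B * I * S = Rintegral leb setT (fun t : R => B * S * (1 + t ^+ 2)^-1).
  by rewrite RintegralZl// ?/I; [ring|exact: integrable_oneDsqrV].
apply: (@le_Rintegral _ TR).
- exact: measurableT.
- by apply: (@cintegrable_cmod _ TR) => //; exact: ji.
- exact: integrable_oneDsqrVZ.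
- by move=> t _; rewrite cmodM -mulrA ler_pM ?cmod_ge0.
Qed.

(** For integrable functions the distributional transform is the classical
    one, by the multiplication formula. *)
Lemma fourier_is_fun_L1 f : cmeasurable f -> cintegrable leb setT f ->
  fourier_is_fun (distr f) (fourier f).
Proof.
move=> mf jf; split; first exact: cmeas_fourier.
move=> psi sp; split.
  apply: (cintegrable_bounded_mul (cmeas_fourier mf) (fun w => cmod_fourier_le w mf jf)).
    exact: cmeas_schwartz.
  exact: cintegrable_schwartz.
by apply: fourier_mult => //; [exact: cmeas_schwartz|exact: cintegrable_schwartz].
Qed.

End FunctionDistributions.

(** * Gaussian Schwartz functions *)

Section GaussianSchwartz.
Context {R : realType}.
Local Notation leb := (@lebesgue_measure R).
Local Notation TR := (measurableTypeR R).

(** Schwartz functions are recognized from an explicit list of their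
    derivatives, which avoids computing iterated derivatives. *)
Lemma rapid_schwartz (Fr Fi : nat -> R -> R) :
  (forall n (t : R), is_derive t (1 : R) (Fr n) (Fr n.+1 t)) ->
  (forall n (t : R), is_derive t (1 : R) (Fi n) (Fi n.+1 t)) ->
  (forall n j, exists C : R, forall t, `|t| ^+ j * `|Fr n t| <= C) ->
  (forall n j, exists C : R, forall t, `|t| ^+ j * `|Fi n t| <= C) ->
  schwartz (fun t => Fr 0 t +i* Fi 0 t).
Proof.
move=> dr di br bi.
have E (F : nat -> R -> R) : (forall n (t : R), is_derive t (1 : R) (F n) (F n.+1 t)) ->
    forall n, derive1n n (F 0) = F n.
  move=> dF; elim=> // n ih; rewrite derive1nS ih.
  by apply/funext => t; rewrite derive1E derive_val.
split.
  move=> n t /=; rewrite (E Fr dr) (E Fi di); split; exact: ex_derive.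
move=> j k; have [C hC] := br k j; have [C' hC'] := bi k j.
exists (C + C') => _ [t _ <-]; rewrite /cderiven /= (E Fr dr) (E Fi di).
apply: (@le_trans _ _ (`|t| ^+ j * (`|Fr k t| + `|Fi k t|))).
  by rewrite ler_wpM2l ?exprn_ge0//; exact: (cmod_le_ReIm (Fr k t +i* Fi k t)).
by rewrite mulrDr lerD.
Qed.

Definition gauss (c t : R) : R := expR (- (c * t ^+ 2)).

Lemma gauss_ge0 c t : 0 <= gauss c t. Proof. exact: expR_ge0. Qed.

Lemma is_derive_gauss (c t : R) : is_derive t (1 : R) (gauss c) (- (2 * c * t) * gauss c t).
Proof.
have d : is_derive t (1 : R) (fun u => - (c * u ^+ 2)) (- (2 * c * t)).
  apply: (is_derive_eq (is_derive_opp (is_derive_mul (is_derive_cst c t (1 : R))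
    (is_derive_mul (is_derive_id t (1 : R)) (is_derive_id t (1 : R)))))).
  by rewrite /=; ring.
by apply: (is_derive_eq (is_derive_comp (is_derive_expR _) d)); rewrite /gauss; ring.
Qed.

Lemma gauss_pow_bound (c : R) m : 0 < c -> exists C : R, forall t, `|t| ^+ m * gauss c t <= C.
Proof.
move=> c0; exists (1 + m.+1`!%:R / c ^+ m.+1) => t.
have g1 : gauss c t <= 1.
  by rewrite -expR0 ler_expR oppr_le0 mulr_ge0 ?sqr_ge0// ltW.
have h : `|t| ^+ m <= 1 + (t ^+ 2) ^+ m.+1.
  rewrite -(real_normK (num_real t)) -exprM.
  have [t1|t1] := leP `|t| 1.
    by rewrite (le_trans (exprn_ile1 m _ t1))// lerDl exprn_ge0.
  rewrite -[leLHS]add0r lerD// ler_weXn2l// ?ltW//.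
  by rewrite mul2n -addnn addSn ltnW// ltnS leq_addr.
apply: (@le_trans _ _ ((1 + (t ^+ 2) ^+ m.+1) * gauss c t)).
  by rewrite ler_wpM2r ?gauss_ge0.
rewrite mulrDl mul1r lerD//.
have := @expR_ge1Dxn R (c * t ^+ 2) m (mulr_ge0 (ltW c0) (sqr_ge0 t)).
rewrite exprMn => h2.
have e0 := expR_gt0 (c * t ^+ 2).
rewrite /gauss expRN ler_pdivrMr// mulrAC ler_pdivlMr ?exprn_gt0//.
have f0 : (0 : R) < m.+1`!%:R by rewrite ltr0n fact_gt0.
rewrite mulrC -ler_pdivrMl// mulrC.
apply: (le_trans _ h2).
rewrite (_ : _ * (_ * _) = c ^+ m.+1 * (t ^+ 2) ^+ m.+1 / m.+1`!%:R); first by rewrite lerDr.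
by ring.
Qed.

Lemma gauss_poly_bound (c : R) (p : {poly R}) j : 0 < c ->
  exists C : R, forall t, `|t| ^+ j * (gauss c t * `|p.[t]|) <= C.
Proof.
move=> c0; elim/poly_ind: p j => [|p a ih] j.
  by exists 0 => t; rewrite horner0 normr0 !mulr0.
have [C1 h1] := ih j.+1; have [C2 h2] := gauss_pow_bound j c0.
exists (C1 + C2 * `|a|) => t; rewrite hornerMXaddC.
apply: (@le_trans _ _ (`|t| ^+ j * (gauss c t * (`|p.[t]| * `|t| + `|a|)))).
  by rewrite ler_wpM2l ?exprn_ge0// ler_wpM2l ?gauss_ge0// (le_trans (ler_normD _ _))// normrM.
have := lerD (h1 t) (ler_wpM2r (normr_ge0 a) (h2 t)).
by rewrite exprS; apply: le_trans; rewrite le_eqVlt; apply/orP; left; apply/eqP; ring.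
Qed.

Section GaussTimesBounded.
Variables (c : R) (U : nat -> R -> R).
Hypotheses (c0 : 0 < c) (dU : forall n (t : R), is_derive t (1 : R) (U n) (U n.+1 t)).
Hypothesis bU : forall n, exists C : R, forall t, `|U n t| <= C.

(* A list of pairs [(p, k)] denotes the sum of the functions
   [gauss c * p * U k]; such sums are closed under differentiation. *)
Let ev (l : seq ({poly R} * nat)) (t : R) := \sum_(a <- l) gauss c t * a.1.[t] * U a.2 t.
Let der (l : seq ({poly R} * nat)) : seq ({poly R} * nat) :=
  flatten [seq [:: (a.1^`() - (2 * c) *: ('X * a.1), a.2); (a.1, a.2.+1)] | a <- l].
Let F n := ev (iter n der [:: (1, 0%N)]).

Let is_derive_ev l (t : R) : is_derive t (1 : R) (ev l) (ev (der l) t).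
Proof.
elim: l => [|a l ih].
  have -> : ev [::] = cst 0 by apply/funext => u; rewrite /ev big_nil.
  exact: is_derive_cst.
have -> : ev (a :: l) = (fun u => gauss c u * a.1.[u] * U a.2 u + ev l u).
  by apply/funext => u; rewrite /ev big_cons.
apply: (is_derive_eq (is_derive_add (is_derive_mul (is_derive_mul
  (is_derive_gauss c t) (is_derive_poly a.1 t)) (dU a.2 t)) ih)).
rewrite /ev /= !big_cons /= addrA; congr (_ + _).
by rewrite hornerD hornerN hornerZ hornerM hornerX; ring.
Qed.

Let ev_bound l j : exists C : R, forall t, `|t| ^+ j * `|ev l t| <= C.
Proof.
elim: l => [|a l [C ih]].
  by exists 0 => t; rewrite /ev big_nil normr0 mulr0.
have [B hB] := bU a.2; have [C1 h1] := gauss_poly_bound a.1 j c0.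
have B0 : 0 <= B by rewrite (le_trans _ (hB 0)).
exists (C1 * B + C) => t; rewrite /ev big_cons -/(ev l t).
apply: (@le_trans _ _ (`|t| ^+ j * (gauss c t * `|a.1.[t]|) * `|U a.2 t| + `|t| ^+ j * `|ev l t|)).
  have -> : `|t| ^+ j * (gauss c t * `|a.1.[t]|) * `|U a.2 t| + `|t| ^+ j * `|ev l t| =
    `|t| ^+ j * (gauss c t * `|a.1.[t]| * `|U a.2 t| + `|ev l t|) by ring.
  rewrite ler_wpM2l ?exprn_ge0// (le_trans (ler_normD _ _))//.
  by rewrite !normrM (ger0_norm (gauss_ge0 _ _)).
by rewrite lerD// ler_pM// !mulr_ge0 ?exprn_ge0 ?gauss_ge0.
Qed.

Lemma gauss_rapid : exists G : nat -> R -> R, [/\ G 0%N = (fun t => gauss c t * U 0%N t),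
  forall n (t : R), is_derive t (1 : R) (G n) (G n.+1 t) &
  forall n j, exists C : R, forall t, `|t| ^+ j * `|G n t| <= C].
Proof.
exists F; split.
- by apply/funext => t; rewrite /F /ev /= big_seq1 /= hornerC mulr1.
- by move=> n t; rewrite /F iterS; exact: is_derive_ev.
- by move=> n j; exact: ev_bound.
Qed.
End GaussTimesBounded.

(** Every derivative is a finite sum of products of the Gaussian, a polynomial
    and a derivative of the bounded factor, so the Gaussian wins. *)
Lemma schwartz_gaussM (c : R) (U V : nat -> R -> R) : 0 < c ->
  (forall n (t : R), is_derive t (1 : R) (U n) (U n.+1 t)) ->
  (forall n, exists C : R, forall t, `|U n t| <= C) ->
  (forall n (t : R), is_derive t (1 : R) (V n) (V n.+1 t)) ->
  (forall n, exists C : R, forall t, `|V n t| <= C) ->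
  schwartz (fun t => (gauss c t)%:C * (U 0%N t +i* V 0%N t)).
Proof.
move=> c0 dU bU dV bV.
have [F [F0 dF bF]] := gauss_rapid c0 dU bU; have [G [G0 dG bG]] := gauss_rapid c0 dV bV.
have := rapid_schwartz dF dG bF bG; rewrite F0 G0.
congr schwartz; apply/funext => t; apply: complexP; rewrite !cReImE /=; ring.
Qed.

(** Differentiating a sine or a cosine adds a quarter turn to its phase; with
    the phase as a parameter all derivatives have one and the same shape. *)
Definition trig_phase (n : nat) : R := n%:R * (pi / 2).

Lemma trig_phaseS n x : x + trig_phase n.+1 = (x + trig_phase n) + pi / 2.
Proof. by rewrite /trig_phase -natr1; ring. Qed.

Lemma is_derive_cos_phase (a : R) n (t : R) :
  is_derive t (1 : R) (fun t => a ^+ n * cos (t * a + trig_phase n))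
    (a ^+ n.+1 * cos (t * a + trig_phase n.+1)).
Proof.
apply: (is_derive_eq (is_derive_mul (is_derive_cst (a ^+ n) t (1 : R))
  (is_derive_comp (is_derive_cos _) (is_derive_add (is_derive_mulr a t)
    (is_derive_cst (trig_phase n) t (1 : R)))))).
by rewrite trig_phaseS cosDpihalf /cst exprS; ring.
Qed.
Lemma is_derive_sin_phase (a : R) n (t : R) :
  is_derive t (1 : R) (fun t => a ^+ n * sin (t * a + trig_phase n))
    (a ^+ n.+1 * sin (t * a + trig_phase n.+1)).
Proof.
apply: (is_derive_eq (is_derive_mul (is_derive_cst (a ^+ n) t (1 : R))
  (is_derive_comp (is_derive_sin _) (is_derive_add (is_derive_mulr a t)
    (is_derive_cst (trig_phase n) t (1 : R)))))).
by rewrite trig_phaseS sinDpihalf /cst exprS; ring.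
Qed.

Lemma normM_cos_le (a x : R) n : `|a ^+ n * cos x| <= `|a| ^+ n.
Proof. by rewrite normrM normrX ler_piMr ?exprn_ge0// cos_max. Qed.
Lemma normM_sin_le (a x : R) n : `|a ^+ n * sin x| <= `|a| ^+ n.
Proof. by rewrite normrM normrX ler_piMr ?exprn_ge0// sin_max. Qed.

Lemma schwartz_gauss_cis (c a : R) : 0 < c -> schwartz (fun t => (gauss c t)%:C * cis (t * a)).
Proof.
move=> c0.
have := @schwartz_gaussM c (fun n t => a ^+ n * cos (t * a + trig_phase n))
  (fun n t => a ^+ n * sin (t * a + trig_phase n)) c0.
have -> : (fun t => (gauss c t)%:C * cis (t * a)) = (fun t => (gauss c t)%:C *
  ((a ^+ 0 * cos (t * a + trig_phase 0)) +i* (a ^+ 0 * sin (t * a + trig_phase 0)))).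
  by apply/funext => t; rewrite /trig_phase expr0 mul0r addr0 !mul1r.
apply.
- by move=> n t; exact: is_derive_cos_phase.
- by move=> n; exists (`|a| ^+ n) => t; exact: normM_cos_le.
- by move=> n t; exact: is_derive_sin_phase.
- by move=> n; exists (`|a| ^+ n) => t; exact: normM_sin_le.
Qed.

Lemma itv_norm_le (a b x : R) : a <= x <= b -> `|x| <= `|a| + `|b|.
Proof.
move=> /andP[ax xb]; have := ler_norm (- a); rewrite normrN; have := ler_norm b.
by have [x0|x0] := leP 0 x; [rewrite (ger0_norm x0)|rewrite (ltr0_norm x0)];
  have := normr_ge0 a; have := normr_ge0 b; lra.
Qed.

Lemma itv_sqr_le (a b x : R) : a <= x <= b -> x ^+ 2 <= (`|a| + `|b|) ^+ 2.
Proof.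
by move=> /itv_norm_le h; rewrite -(real_normK (num_real x)) lerXn2r ?nnegrE ?addr_ge0.
Qed.

(** Differentiation under the integral sign; on the bounded interval of
    frequencies all derivatives are bounded uniformly in [t]. *)
Lemma is_derive_int_trig (c d : R) n (f : nat -> R -> R -> R) (t : R) :
  (forall n a (t : R), is_derive t (1 : R) (fun t => f n t a) (f n.+1 t a)) ->
  (forall n t, continuous (f n t)) ->
  (forall n t a, `|f n t a| <= `|a| ^+ n) ->
  is_derive t (1 : R) (fun t => Rintegral leb `[c, d] (f n t)) (Rintegral leb `[c, d] (f n.+1 t)).
Proof.
move=> df cf bf; set M : R := `|c| + `|d|.
have aM a : `[c, d]%classic a -> `|a| <= M by rewrite /= in_itv /=; exact: itv_norm_le.
have fin k : leb.-integrable `[c, d] (EFin \o (fun _ : R => M ^+ k)).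
  apply: (@continuous_compact_integrable R); first exact: segment_compact.
  by apply: continuous_subspaceT => x; exact: cvg_cst.
have Ia : `]t - 1, t + 1[%classic t by rewrite /= in_itv /=; apply/andP; split; lra.
have H1 : forall x, `]t - 1, t + 1[%classic x -> leb.-integrable `[c, d] (EFin \o f n x).
  move=> x _; apply: (@continuous_compact_integrable R); first exact: segment_compact.
  exact: continuous_subspaceT.
have H2 : forall x y, `]t - 1, t + 1[%classic x -> `[c, d]%classic y -> derivable ((f n)^~ y) x 1.
  by move=> x y _ _; have := df n y x => h; exact: ex_derive.
have E x y : partial1of2 (f n) x y = f n.+1 x y.
  by rewrite partial1of2E; have := df n y x => h; rewrite derive_val.
have H3 : forall x y, `]t - 1, t + 1[%classic x -> `[c, d]%classic y ->
    `|partial1of2 (f n) x y| <= (fun _ => M ^+ n.+1) y.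
  move=> x y _ ycd; rewrite E (le_trans (bf _ _ _))//.
  by rewrite lerXn2r ?nnegrE ?aM// (le_trans _ (aM _ ycd)).
have M0 : forall y : R, 0 <= (fun _ => M ^+ n.+1) y by move=> _; rewrite exprn_ge0// addr_ge0.
have md : measurable (`[c, d]%classic : set TR) by exact: measurable_itv.
have D := @derivable_under_integral _ _ _ leb _ _ md t _ _ Ia H1 H2 _ M0 (fin n.+1) H3.
have V := @differentiation_under_integral _ _ _ leb _ _ md t _ _ Ia H1 H2 _ M0 (fin n.+1) H3.
apply: DeriveDef; first exact: D.
rewrite -derive1E V; apply: eq_Rintegral => y _; exact: E.
Qed.

Lemma int_trig_bound (c d : R) n (f : R -> R) :
  continuous f -> (forall a, `|f a| <= `|a| ^+ n) ->
  `|Rintegral leb `[c, d] f| <= Rintegral leb `[c, d] (fun a => `|a| ^+ n).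
Proof.
move=> cf bf.
have fin (g : R -> R) : continuous g -> leb.-integrable `[c, d] (EFin \o g).
  move=> cg; apply: (@continuous_compact_integrable R); first exact: segment_compact.
  exact: continuous_subspaceT.
have md : measurable (`[c, d]%classic : set TR) by exact: measurable_itv.
rewrite (le_trans (le_normr_Rintegral md (fin _ cf)))//.
apply: le_Rintegral => //.
- by apply: (fin (fun x => `|f x|)) => x; apply: cvg_norm; exact: cf.
- by apply: (fin (fun x => `|x| ^+ n)) => x; apply: (@continuous_comp _ _ _ (fun x : R => `|x|) (fun y => y ^+ n));
    [exact: norm_continuous|exact: exprn_continuous].
Qed.

(** The integral of [e^(itx)] over [[a, b]] is a smooth function of [t] with
    bounded derivatives. Its transform is the indicator of [[a, b]], up to a
    constant; the Gaussian factor is what smooths this indicator. *)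
Lemma schwartz_gauss_window (c a b : R) : 0 < c ->
  schwartz (fun t => (gauss c t)%:C * cint leb `[a, b] (fun x => cis (t * x))).
Proof.
move=> c0.
have cc (g : R -> R) (k : nat) (t th : R) : continuous g -> continuous (fun x : R => x ^+ k * g (t * x + th)).
  move=> cg x; apply: cvgM; first exact: exprn_continuous.
  apply: (@continuous_comp _ _ _ (fun x => t * x + th) g); last exact: cg.
  by apply: cvgD; [apply: cvgM; [exact: cvg_cst|exact: cvg_id]|exact: cvg_cst].
pose fc k t x : R := x ^+ k * cos (t * x + trig_phase k).
pose fs k t x : R := x ^+ k * sin (t * x + trig_phase k).
have := @schwartz_gaussM c (fun n t => Rintegral leb `[a, b] (fc n t))
  (fun n t => Rintegral leb `[a, b] (fs n t)) c0.
have -> : (fun t => (gauss c t)%:C * cint leb `[a, b] (fun x => cis (t * x))) =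
  (fun t => (gauss c t)%:C * (Rintegral leb `[a, b] (fc 0%N t) +i* Rintegral leb `[a, b] (fs 0%N t))).
  apply/funext => t; congr (_ * _); rewrite /cint; congr (_ +i* _); apply: eq_Rintegral => x _.
    by rewrite /fc /trig_phase expr0 mul0r addr0 mul1r.
  by rewrite /fs /trig_phase expr0 mul0r addr0 mul1r.
apply.
- move=> n t; apply: is_derive_int_trig => [k x u|k u|k u x].
  + exact: is_derive_cos_phase.
  + by apply: cc; exact: continuous_cos.
  + exact: normM_cos_le.
- move=> n; exists (Rintegral leb `[a, b] (fun a => `|a| ^+ n)) => t; apply: int_trig_bound => [|x].
    by apply: cc; exact: continuous_cos.
  exact: normM_cos_le.
- move=> n t; apply: is_derive_int_trig => [k x u|k u|k u x].
  + exact: is_derive_sin_phase.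
  + by apply: cc; exact: continuous_sin.
  + exact: normM_sin_le.
- move=> n; exists (Rintegral leb `[a, b] (fun a => `|a| ^+ n)) => t; apply: int_trig_bound => [|x].
    by apply: cc; exact: continuous_sin.
  exact: normM_sin_le.
Qed.

End GaussianSchwartz.

(** * Smoothed windows *)

Section GaussianFourier.
Context {R : realType}.
Local Notation leb := (@lebesgue_measure R).
Local Notation TR := (measurableTypeR R).

Lemma schwartz_gauss (c : R) : 0 < c -> schwartz (fun t => (gauss c t)%:C).
Proof.
move=> c0; have := schwartz_gauss_cis 0 c0; congr schwartz; apply/funext => t.
by rewrite mulr0 cis0 mulr1.
Qed.

Lemma cderiven1_gauss (c : R) : cderiven 1 (fun t => (gauss c t)%:C) = fun t => (- (2 * c * t) * gauss c t)%:C.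
Proof.
apply/funext => t; apply: complexP => /=; rewrite derive1E.
  by have h := is_derive_gauss c t; rewrite derive_val.
exact: derive_cst.
Qed.

(** The quotient of [y] by the Gaussian has derivative zero. *)
Lemma linear_ode (k : R) (y : R -> R) : (forall w : R, is_derive w (1 : R) y (- (2 * k * w) * y w)) ->
  forall w, y w = y 0 * gauss k w.
Proof.
move=> dy w; pose z u := y u * gauss (- k) u.
have dz (u : R) : is_derive u (1 : R) z 0.
  by apply: (is_derive_eq (is_derive_mul (dy u) (is_derive_gauss (- k) u))); ring.
have : z w = z 0 by apply: is_derive_0_is_cst.
have gg u : gauss (- k) u * gauss k u = 1 by rewrite /gauss -expRD -expR0; congr expR; ring.
rewrite /z {2}/gauss expr0n /= mulr0 oppr0 expR0 mulr1 => <-.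
by rewrite -mulrA gg mulr1.
Qed.

Lemma measurable_gauss (c : R) : measurable_fun setT (gauss c).
Proof.
apply: continuous_measurable_fun; apply: (is_derive_continuous (f := fun t => - (2 * c * t) * gauss c t)).
exact: is_derive_gauss.
Qed.

Lemma integrable_gauss (c : R) : 0 < c -> leb.-integrable setT (EFin \o gauss c).
Proof. by move=> c0; have [] := cintegrable_schwartz (schwartz_gauss c0). Qed.

(** The transform [y] of the Gaussian satisfies [y' = - w y / (2 c)]:
    differentiating under the integral sign brings down a factor [-it], and [t
    gauss c t] is a multiple of the derivative of the Gaussian, whose
    transform is [iw y]. The solution of this equation is again a Gaussian. *)
Lemma fourier_gauss (c w : R) : 0 < c ->
  fourier (fun t => (gauss c t)%:C) w = (Rintegral leb setT (gauss c) * gauss ((4 * c)^-1) w)%:C.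
Proof.
move=> c0; set g := (fun t => _).
have sg : schwartz g by exact: schwartz_gauss.
pose fr w := Rintegral leb setT (fun t => gauss c t * cos (t * w)).
pose fi w := Rintegral leb setT (fun t => - (gauss c t * sin (t * w))).
have gE u : fourier g u = fr u +i* fi u.
  rewrite fourierE /fr /fi /cint; congr (_ +i* _); apply: eq_Rintegral => t _; rewrite cisN !cReImE /=; ring.
have g'E u : fourier (cderiven 1 g) u =
  (2 * c)%:C * (Rintegral leb setT (fun t => - (t * gauss c t * cos (t * u)))
               +i* Rintegral leb setT (fun t => t * gauss c t * sin (t * u))).
  rewrite fourierE cderiven1_gauss.
  have i1 : cintegrable leb setT (fun t : R => (- (t * gauss c t * cos (t * u))) +i* (t * gauss c t * sin (t * u))).
    have := fourier_integrable u (cmeas_cderiven 1 sg) (cintegrable_cderiven 1 sg).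
    move=> /(@cintegrableZl _ TR _ leb setT measurableT ((2 * c)^-1)%:C).
    apply: (@eq_cintegrable _ TR) => // t _; rewrite cderiven1_gauss cisN.
    by apply: complexP; rewrite !cReImE /=; field; rewrite gt_eqF.
  transitivity ((2 * c)%:C * cint leb setT (fun t : R => (- (t * gauss c t * cos (t * u))) +i* (t * gauss c t * sin (t * u)))); last by [].
  rewrite -cintZl//; apply: eq_cint => t _; rewrite cisN.
  by apply: complexP; rewrite !cReImE /=; ring.
have parts u : fourier (cderiven 1 g) u = 'i * u%:C * fourier g u.
  by rewrite fourier_cderiven0// expr1.
have E1 u : Rintegral leb setT (fun t => - (t * gauss c t * cos (t * u))) = - (2 * (4 * c)^-1 * u) * fi u.
  have := congr1 (@complex.Re R) (parts u); rewrite g'E gE !cReImE /= => h.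
  apply: (@mulfI _ (2 * c)); [by rewrite gt_eqF// mulr_gt0|
    have -> : 2 * c * (- (2 * (4 * c)^-1 * u) * fi u) = - (u * fi u) by (field; rewrite gt_eqF)].
  by apply: (etrans _ (etrans h _)); ring.
have E2 u : Rintegral leb setT (fun t => - (t * gauss c t * sin (t * u))) = - (2 * (4 * c)^-1 * u) * fr u.
  have -> : Rintegral leb setT (fun t => - (t * gauss c t * sin (t * u))) =
      - Rintegral leb setT (fun t => t * gauss c t * sin (t * u)).
    rewrite -mulN1r -RintegralZl//.
      by apply: eq_Rintegral => t _; rewrite mulN1r.
    have [_] := @cintegrableZl _ TR _ leb setT measurableT ((2 * c)^-1)%:C _ (fourier_integrable u (cmeas_cderiven 1 sg) (cintegrable_cderiven 1 sg)).
    apply: eq_integrable => // t _; rewrite cderiven1_gauss cisN !cReImE /=; congr EFin.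
    by field; rewrite gt_eqF.
  have := congr1 (@complex.Im R) (parts u); rewrite g'E gE !cReImE /= => h.
  apply: (@mulfI _ (2 * c)); [by rewrite gt_eqF// mulr_gt0|
    have -> : 2 * c * (- (2 * (4 * c)^-1 * u) * fr u) = - (u * fr u) by (field; rewrite gt_eqF)].
  have hh : forall x y z v : R, 2 * c * x + 0 * y = (0 * u - 1 * 0) * z + (0 * 0 + 1 * u) * v -> 2 * c * - x = - (u * v).
    by move=> x y z v h'; rewrite mulrN; congr (- _); apply: (etrans _ (etrans h' _)); ring.
  by apply: hh; exact: h.
have iG : leb.-integrable setT (EFin \o (fun t : R => `|t| * gauss c t)).
  have := @cintegrable_cmod _ TR _ _ _ measurableT _ (cintegrable_cderiven 1 sg).
  move=> /(@integrableZl _ TR R leb setT measurableT (2 * c)^-1).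
  apply: eq_integrable => // t _; rewrite /g cderiven1_gauss cmodR /=.
  rewrite normrM normrN !normrM (ger0_norm (gauss_ge0 _ _)) (gtr0_norm c0) (@ger0_norm _ 2)//.
  by rewrite -EFinM; congr EFin; field; rewrite gt_eqF.
have G0 (t : R) : 0 <= `|t| * gauss c t by rewrite mulr_ge0 ?gauss_ge0.
have bnd (h : R -> R) (t u : R) : (forall x, `|h x| <= 1) -> `|- (t * gauss c t * h (t * u))| <= `|t| * gauss c t.
  by move=> h1; rewrite normrN !normrM (ger0_norm (gauss_ge0 _ _)) ler_piMr// mulr_ge0 ?gauss_ge0.
have ib (h : R -> R) u : continuous h -> (forall x, `|h x| <= 1) -> leb.-integrable setT (EFin \o (fun t => gauss c t * h (t * u))).
  move=> ch h1; apply: (@le_integrable _ TR _ leb setT measurableT _ _ _ _ (integrable_gauss c0)).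
    apply/measurable_EFinP; apply: measurable_funM; first exact: measurable_gauss.
    apply: (measurableT_comp (continuous_measurable_fun ch)); exact: measurable_funM.
  by move=> t _ /=; rewrite lee_fin normrM ler_piMr.
have Iu (u : R) : `]u - 1, u + 1[%classic u by rewrite /= in_itv /=; apply/andP; split; lra.
have dcos (t u : R) : is_derive u (1 : R) (fun x => cos (t * x)) (- (t * sin (t * u))).
  apply: (is_derive_eq (is_derive_comp (is_derive_cos _) (is_derive_mul (is_derive_cst t u (1 : R)) (is_derive_id u (1 : R))))).
  by rewrite /cst; ring.
have dsin (t u : R) : is_derive u (1 : R) (fun x => sin (t * x)) (t * cos (t * u)).
  apply: (is_derive_eq (is_derive_comp (is_derive_sin _) (is_derive_mul (is_derive_cst t u (1 : R)) (is_derive_id u (1 : R))))).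
  by rewrite /cst; ring.
have dr (u : R) : is_derive u (1 : R) fr (- (2 * (4 * c)^-1 * u) * fr u).
  pose F (u t : R) := gauss c t * cos (t * u).
  have dF (x t : R) : is_derive x (1 : R) (F^~ t) (- (t * gauss c t * sin (t * x))).
    by apply: (is_derive_eq (is_derive_mul (is_derive_cst (gauss c t) x (1 : R)) (dcos t x))); rewrite /cst; ring.
  have PE x t : partial1of2 F x t = - (t * gauss c t * sin (t * x)).
    by rewrite partial1of2E; have h := dF x t; rewrite derive_val.
  have H1 : forall x, `]u - 1, u + 1[%classic x -> leb.-integrable setT (EFin \o F x).
    by move=> x _; apply: (ib cos); [exact: continuous_cos|exact: cos_max].
  have H2 : forall x y : R, `]u - 1, u + 1[%classic x -> [set: TR] y -> derivable (F^~ y) x 1.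
    by move=> x y _ _; have h := dF x y; exact: ex_derive.
  have H3 : forall x y : R, `]u - 1, u + 1[%classic x -> [set: TR] y -> `|partial1of2 F x y| <= `|y| * gauss c y.
    by move=> x y _ _; rewrite PE; apply: bnd; exact: sin_max.
  have D := @derivable_under_integral _ _ TR leb F setT measurableT u _ _ (Iu u) H1 H2 _ G0 iG H3.
  have V := @differentiation_under_integral _ _ TR leb F setT measurableT u _ _ (Iu u) H1 H2 _ G0 iG H3.
  apply: DeriveDef; first exact: D.
  by rewrite -derive1E V -E2; apply: eq_Rintegral => y _; exact: PE.
have di (u : R) : is_derive u (1 : R) fi (- (2 * (4 * c)^-1 * u) * fi u).
  pose F (u t : R) := - (gauss c t * sin (t * u)).
  have dF (x t : R) : is_derive x (1 : R) (F^~ t) (- (t * gauss c t * cos (t * x))).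
    apply: (is_derive_eq (is_derive_opp (is_derive_mul (is_derive_cst (gauss c t) x (1 : R)) (dsin t x)))).
    by rewrite /cst; ring.
  have PE x t : partial1of2 F x t = - (t * gauss c t * cos (t * x)).
    by rewrite partial1of2E; have h := dF x t; rewrite derive_val.
  have H1 : forall x, `]u - 1, u + 1[%classic x -> leb.-integrable setT (EFin \o F x).
    move=> x _; apply: (@eq_integrable _ TR _ _ _ measurableT (fun t => - (gauss c t * sin (t * x))%:E)%E).
      by move=> t _ /=; rewrite EFinN.
    by apply: integrableN; apply: (ib sin); [exact: continuous_sin|exact: sin_max].
  have H2 : forall x y : R, `]u - 1, u + 1[%classic x -> [set: TR] y -> derivable (F^~ y) x 1.
    by move=> x y _ _; have h := dF x y; exact: ex_derive.
  have H3 : forall x y : R, `]u - 1, u + 1[%classic x -> [set: TR] y -> `|partial1of2 F x y| <= `|y| * gauss c y.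
    by move=> x y _ _; rewrite PE; apply: bnd; exact: cos_max.
  have D := @derivable_under_integral _ _ TR leb F setT measurableT u _ _ (Iu u) H1 H2 _ G0 iG H3.
  have V := @differentiation_under_integral _ _ TR leb F setT measurableT u _ _ (Iu u) H1 H2 _ G0 iG H3.
  apply: DeriveDef; first exact: D.
  by rewrite -derive1E V -E1; apply: eq_Rintegral => y _; exact: PE.
rewrite gE (linear_ode dr) (linear_ode di).
have -> : fi 0 = 0.
  rewrite /fi (_ : (fun t => _) = cst 0) ?Rintegral_cst// ?mul0r//.
  by apply/funext => t; rewrite mulr0 sin0 mulr0 oppr0.
have -> : fr 0 = Rintegral leb setT (gauss c).
  by apply: eq_Rintegral => t _; rewrite mulr0 cos0 mulr1.
by rewrite mul0r.
Qed.

Lemma cint_mkcond (mu : {measure set TR -> \bar R}) (D : set TR) (f : R -> R[i]) :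
  cint mu D f = cint mu setT (fun x => f x * (\1_D x)%:C).
Proof.
rewrite /cint !(Rintegral_mkcond _ D); congr (_ +i* _); apply: eq_Rintegral => x _.
  by rewrite patchE indicE cReM /=; case: ifPn => _ /=; rewrite ?mulr1 ?mulr0 ?subr0.
by rewrite patchE indicE cImM /=; case: ifPn => _ /=; rewrite ?mulr1 ?mulr0 ?add0r.
Qed.

(** The mass that the normal law of mean [w] and deviation [s] gives to
    [[a, b]]. *)
Definition window (s a b w : R) : R := Rintegral leb `[a, b] (normal_pdf w s).

Lemma normal_pdf_gauss (w s x : R) : s != 0 -> normal_pdf w s x = normal_peak s * gauss ((2 * s ^+ 2)^-1) (w - x).
Proof.
move=> s0; rewrite normal_pdfE// /gauss /normal_fun; congr (_ * expR _).
by rewrite -(mulr_natl (s ^+ 2)); field.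
Qed.

Lemma schwartzZ (k : R) (phi : R -> R[i]) : schwartz phi -> schwartz (fun t => k%:C * phi t).
Proof.
move=> sp.
have Er : (fun u => complex.Re (k%:C * phi u)) = k *: (fun u => complex.Re (phi u)).
  by apply/funext => u; rewrite cReM /= mul0r subr0.
have Ei : (fun u => complex.Im (k%:C * phi u)) = k *: (fun u => complex.Im (phi u)).
  by apply/funext => u; rewrite cImM /= mul0r addr0.
have [sm _] := sp.
have Z (f : R -> R) : (forall n (t : R), derivable (derive1n n f) t 1) -> forall n, derive1n n (k *: f) = k *: derive1n n f.
  move=> df; elim=> // n ih; rewrite !derive1nS ih; apply/funext => t.
  transitivity (k *: 'D_1 (derive1n n f) t); last by rewrite -derive1E.
  by rewrite derive1E deriveZ//; exact: df.
have Zr := Z _ (fun n t => (sm n t).1); have Zi := Z _ (fun n t => (sm n t).2).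
split.
  by move=> n t; rewrite Er Ei Zr Zi; have [d1 d2] := sm n t; split; exact: derivableZ.
move=> i j; have [C hC] := schwartz_decay i j sp.
exists (`|k| * C) => _ [t _ <-]; rewrite /cderiven Er Ei Zr Zi.
rewrite (_ : _ +i* _ = k%:C * cderiven j phi t); last by apply: complexP; rewrite !cReImE /= ?mul0r ?subr0 ?addr0.
by rewrite cmodM cmodR mulrCA ler_wpM2l.
Qed.

(** The transform of a Gaussian times the integral of [e^(itx)] over [[a, b]]
    is, by Fubini, the integral over [[a, b]] of the translates by [x] of the
    transform of the Gaussian, and these are normal densities up to a
    constant. *)
Lemma window_fourier (s a b : R) : 0 < s -> exists phi,
  schwartz phi /\ forall w, fourier phi w = (window s a b w)%:C.
Proof.
move=> s0; pose c := s ^+ 2 / 2; have c0 : 0 < c by rewrite divr_gt0// exprn_gt0.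
set A := Rintegral leb setT (gauss c).
have A0 : A != 0.
  have iV : s^-1 != 0 by rewrite invr_eq0 gt_eqF.
  have := @integral_normal_pdf R 0 s^-1.
  move=> /(congr1 fine); rewrite -/(Rintegral leb setT (normal_pdf 0 s^-1)).
  have -> : normal_pdf 0 s^-1 = (fun x => normal_peak s^-1 * gauss c x).
    apply/funext => x; rewrite (normal_pdf_gauss _ _ iV); congr (_ * expR _); rewrite /c sub0r.
    by field; rewrite gt_eqF.
  rewrite RintegralZl//; last exact: integrable_gauss.
  by rewrite -/A => h; apply/eqP => A0; move: h; rewrite A0 mulr0 /= => /esym/eqP; rewrite oner_eq0.
(* [c] is chosen so that the transform of [gauss c] has deviation [s] *)
pose phi0 t := (gauss c t)%:C * cint leb `[a, b] (fun x => cis (t * x)).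
have sp0 : schwartz phi0 by exact: schwartz_gauss_window.
have F0 w : fourier phi0 w = (A * Rintegral leb `[a, b] (fun x => gauss ((4 * c)^-1) (w - x)))%:C.
  have mab : measurable (`[a, b]%classic : set TR) by exact: measurable_itv.
  have iab : leb.-integrable setT (EFin \o (\1_(`[a, b]%classic : set TR))).
    exact: integrable_indic_itv.
  pose F (t x : R) : R[i] := (gauss c t)%:C * cis (t * x) * cis (- (t * w)) * (\1_(`[a, b]%classic : set TR) x)%:C.
  transitivity (cint leb setT (fun t => cint leb setT (F t))).
    rewrite fourierE; apply: eq_cint => t _; rewrite /phi0 cint_mkcond.
    rewrite mulrAC -cintZl//.
      by apply: eq_cint => x _; rewrite /F; ring.
    apply: (@cmeas_cintegrable _ TR _ leb _ measurableT _ (fun x => \1_(`[a, b]%classic : set TR) x)) => //.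
      apply: cmeasM; first by apply: cmeas_cis; exact: mulrl_measurable.
      by apply: cmeasR; exact: measurable_indic.
    by move=> x _; rewrite cmodM cmod_cis mul1r cmodR ger0_norm// indicE ler0n.
  rewrite (@cFubini _ _ TR TR R leb leb F (gauss c) (\1_(`[a, b]%classic : set TR))).
  - rewrite -RintegralZl//; last first.
      have c4 : 0 < (4 * c)^-1 by rewrite invr_gt0 mulr_gt0.
      have := integrable_translate (- w) (integrable_gauss c4).
      move=> /(integrableS measurableT mab (@subsetT _ _)).
      by apply: eq_integrable => // x _ /=; congr EFin; rewrite /gauss -[in RHS]sqrrN opprB.
    rewrite -cintR cint_mkcond; apply: eq_cint => x _; rewrite -fourier_gauss// fourierE.
    rewrite mulrC -cintZl//.
      apply: eq_cint => t _; rewrite /F.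
      have -> : cis (- (t * (w - x))) = cis (t * x) * cis (- (t * w)) by rewrite -cisD; congr cis; ring.
      by ring.
    have := fourier_integrable (w - x) (cmeas_schwartz (schwartz_gauss c0)) (cintegrable_schwartz (schwartz_gauss c0)).
    by [].
  - apply: cmeasM; last first.
      apply: (@cmeas_snd _ _ TR TR R (fun x : R => (\1_(`[a, b]%classic : set TR) x)%:C)).
      by apply: cmeasR; exact: measurable_indic.
    apply: cmeasM; last by apply: cmeas_cis; apply: measurableT_comp => //; exact: measurable_funM.
    apply: cmeasM; last by apply: cmeas_cis; exact: measurable_funM.
    by apply: (@cmeas_fst _ _ TR TR R (fun x : R => (gauss c x)%:C)); apply: cmeasR; exact: measurable_gauss.
  - exact: integrable_gauss.
  - exact: iab.
  - by move=> t; exact: gauss_ge0.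
  - by move=> x; rewrite indicE ler0n.
  - move=> t x; rewrite /F !cmodM !cmod_cis !mulr1 !cmodR ger0_norm ?gauss_ge0//.
    by rewrite ger0_norm// indicE ler0n.
pose k : R := normal_peak s / A.
exists (fun t => k%:C * phi0 t); split.
  exact: schwartzZ.
move=> w; rewrite fourierZ; [|exact: cmeas_schwartz|exact: cintegrable_schwartz].
rewrite F0 -rmorphM; congr (_%:C); rewrite /k /window mulrA divfK// -RintegralZl//.
  have -> // : normal_pdf w s = (fun x => normal_peak s * gauss ((4 * c)^-1) (w - x)).
  have -> : (4 * c)^-1 = (2 * s ^+ 2)^-1 by congr (_^-1); rewrite /c; field.
  by apply/funext => x; rewrite normal_pdf_gauss ?gt_eqF.
have c4 : 0 < (4 * c)^-1 by rewrite invr_gt0 mulr_gt0.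
have := integrable_translate (- w) (integrable_gauss c4).
have mab : measurable (`[a, b]%classic : set TR) by exact: measurable_itv.
move=> /(integrableS measurableT mab (@subsetT _ _)).
by apply: eq_integrable => // x _ /=; congr EFin; rewrite /gauss -[in RHS]sqrrN opprB.
Qed.

Lemma window_ge0 s a b w : 0 <= window s a b w.
Proof. by apply: Rintegral_ge0 => x _; exact: normal_pdf_ge0. Qed.

Let ipdf w s (D : set TR) : measurable D -> leb.-integrable D (EFin \o normal_pdf w s).
Proof.
by move=> mD; apply: (integrableS measurableT mD (@subsetT _ _)); exact: integrable_normal_pdf.
Qed.

Lemma Rintegral_normal_pdf (w s : R) : Rintegral leb setT (normal_pdf w s) = 1.
Proof. by rewrite /Rintegral integral_normal_pdf. Qed.

Lemma Rintegral_subset_le (D : set TR) (f : R -> R) : measurable D ->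
  leb.-integrable setT (EFin \o f) -> (forall x, 0 <= f x) -> Rintegral leb D f <= Rintegral leb setT f.
Proof.
move=> mD fi f0; rewrite fine_le//.
- by apply: integrable_fin_num => //; apply: (integrableS measurableT mD (@subsetT _ _)).
- by apply: integrable_fin_num.
- apply: ge0_subset_integral => //; first exact: measurable_int fi.
  by move=> x _; rewrite lee_fin.
Qed.

Lemma window_le1 s a b w : window s a b w <= 1.
Proof.
rewrite -[leRHS](Rintegral_normal_pdf w s); apply: Rintegral_subset_le.
- exact: measurable_itv.
- exact: integrable_normal_pdf.
- by move=> x; exact: normal_pdf_ge0.
Qed.

(** Halving the exponent of the density frees the Gaussian factor at distance
    [delta] and leaves the density of deviation [sqrt 2 s]. *)
Lemma normal_tail (s w delta : R) (D : set TR) : 0 < s -> 0 <= delta -> measurable D ->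
  (forall x, D x -> delta <= `|w - x|) ->
  Rintegral leb D (normal_pdf w s) <= Num.sqrt 2 * gauss ((4 * s ^+ 2)^-1) delta.
Proof.
move=> s0 d0 mD hD; set s' := Num.sqrt 2 * s.
have s'0 : 0 < s' by rewrite mulr_gt0 ?sqrtr_gt0.
have s'2 : s' ^+ 2 = 2 * s ^+ 2 by rewrite exprMn sqr_sqrtr.
set k := Num.sqrt 2 * gauss ((4 * s ^+ 2)^-1) delta.
have k0 : 0 <= k by rewrite mulr_ge0 ?sqrtr_ge0 ?gauss_ge0.
have pk : normal_peak s = Num.sqrt 2 * normal_peak s'.
  rewrite /normal_peak (_ : s' ^+ 2 * pi *+ 2 = 2 * (s ^+ 2 * pi *+ 2)); last by rewrite s'2; ring.
  by rewrite sqrtrM// invfM mulrA divff ?mul1r// gt_eqF// sqrtr_gt0.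
have le x : D x -> normal_pdf w s x <= k * normal_pdf w s' x.
  move=> Dx; rewrite !normal_pdf_gauss ?gt_eqF// pk s'2 /k.
  rewrite [leRHS](_ : _ = Num.sqrt 2 * normal_peak s' * (gauss (4 * s ^+ 2)^-1 delta * gauss (2 * (2 * s ^+ 2))^-1 (w - x))); last by ring.
  rewrite ler_wpM2l ?mulr_ge0 ?sqrtr_ge0 ?normal_peak_ge0//.
  rewrite /gauss -expRD ler_expR.
  have dx : delta ^+ 2 <= (w - x) ^+ 2.
    by rewrite -(real_normK (num_real (w - x))) lerXn2r ?nnegrE ?normr_ge0 ?hD.
  have v0 : 0 < (4 * s ^+ 2)^-1 by rewrite invr_gt0 mulr_gt0// exprn_gt0.
  have -> : (2 * s ^+ 2)^-1 = 2 * (4 * s ^+ 2)^-1 by field; rewrite gt_eqF.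
  have -> : (2 * (2 * s ^+ 2))^-1 = (4 * s ^+ 2)^-1 by field; rewrite gt_eqF.
  have := ler_wpM2l (ltW v0) dx.
  by rewrite -(mulrA 2) => h; lra.
apply: (@le_trans _ _ (Rintegral leb D (fun x => k * normal_pdf w s' x))).
  apply: le_Rintegral => //; first exact: ipdf.
  under [X in integrable _ _ X]funext do rewrite /= EFinM.
  by apply: integrableZl => //; exact: ipdf.
rewrite RintegralZl//; last exact: ipdf.
rewrite ler_piMr// -[leRHS](Rintegral_normal_pdf w s'); apply: Rintegral_subset_le => //.
  exact: integrable_normal_pdf.
by move=> x; exact: normal_pdf_ge0.
Qed.

(** One Gaussian dominates the windows of all deviations [s <= 1]: near the
    interval the bound exceeds 1, and far from it the tail estimate
    applies. *)
Lemma window_gauss_bound (s a b w : R) : 0 < s <= 1 ->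
  window s a b w <= (2 + expR ((2 * (`|a| + `|b|)) ^+ 2)) * gauss (16^-1) w.
Proof.
move=> /andP[s0 s1]; set M := `|a| + `|b|.
have M0 : 0 <= M by rewrite addr_ge0.
have [wM|wM] := leP `|w| (2 * M).
  apply: (le_trans (window_le1 _ _ _ _)).
  rewrite mulrDl -[leLHS]add0r lerD//; first by rewrite mulr_ge0 ?gauss_ge0.
  rewrite /gauss -expRD -[leLHS]expR0 ler_expR.
  have : w ^+ 2 <= (2 * M) ^+ 2.
    by rewrite -(real_normK (num_real w)) lerXn2r ?nnegrE ?mulr_ge0.
  by have := sqr_ge0 w; lra.
have aM x : `[a, b]%classic x -> `|x| <= M by rewrite /= in_itv /=; exact: itv_norm_le.
apply: (@le_trans _ _ (Num.sqrt 2 * gauss ((4 * s ^+ 2)^-1) (`|w| / 2))).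
  have w2 : 0 <= `|w| / 2 by rewrite divr_ge0.
  have mi : measurable (`[a, b]%classic : set TR) by exact: measurable_itv.
  apply: (normal_tail s0 w2 mi) => x /aM xM.
  by have := ler_normD (w - x) x; rewrite subrK; lra.
apply: ler_pM => //; rewrite ?sqrtr_ge0 ?gauss_ge0//.
  apply: (@le_trans _ _ 2); last by rewrite lerDl expR_ge0.
  by rewrite -[leRHS]ger0_norm// -sqrtr_sqr ler_wsqrtr//; lra.
rewrite /gauss ler_expR lerN2 expr_div_n real_normK ?num_real//.
have -> : (4 * s ^+ 2)^-1 * (w ^+ 2 / 2 ^+ 2) = (s ^+ 2)^-1 * (16^-1 * w ^+ 2) by field; rewrite gt_eqF.
rewrite ler_peMl//; first by apply: mulr_ge0 => //; exact: sqr_ge0.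
by rewrite -[leLHS]invr1 lef_pV2 ?posrE ?exprn_gt0// exprn_ile1// ltW.
Qed.

Definition win (a b : R) (n : nat) (w : R) : R := window (n.+1%:R^-1) a b w.

Lemma win_gt0 n : 0 < (n.+1%:R^-1 : R).
Proof. by rewrite invr_gt0. Qed.

Let gauss_small (delta : R) : 0 < delta ->
  Num.sqrt 2 * gauss ((4 * (n.+1%:R^-1) ^+ 2)^-1) delta @[n --> \oo] --> (0 : R).
Proof.
move=> d0; set k := delta ^+ 2 / 4.
have k0 : 0 < k by rewrite divr_gt0// exprn_gt0.
apply: (@squeeze_cvgr _ _ _ _ (cst 0) (fun n => Num.sqrt 2 * k^-1 * n.+1%:R^-1)); [|exact: cvg_cst|].
  apply: nearW => n; apply/andP; split; first by rewrite mulr_ge0 ?sqrtr_ge0 ?gauss_ge0.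
  rewrite -mulrA ler_wpM2l ?sqrtr_ge0// /gauss expRN -invfM lef_pV2 ?posrE ?expR_gt0 ?mulr_gt0//.
  apply: (le_trans _ (expR_ge1Dx _)).
  have -> : (4 * n.+1%:R^-1 ^+ 2)^-1 * delta ^+ 2 = k * (n.+1%:R * n.+1%:R).
    by rewrite /k; field.
  apply: (@le_trans _ _ (k * (n.+1%:R * n.+1%:R))); last by rewrite lerDr.
  by rewrite ler_wpM2l ?(ltW k0)// ler_peMr// ler1n.
rewrite -[X in _ --> X](mulr0 (Num.sqrt 2 * k^-1)); apply: cvgM; first exact: cvg_cst.
exact: cvg_harmonic.
Qed.

(** Inside the interval, and outside it, [w] keeps a positive distance from
    the set whose mass has to vanish, so the tail estimate applies. *)
Lemma win_cvg a b w : w != a -> w != b -> win a b n w @[n --> \oo] --> (\1_(`[a, b]%classic : set R) w : R).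
Proof.
move=> wa wb; rewrite indicE.
have mab : measurable (`[a, b]%classic : set TR) by exact: measurable_itv.
have [/set_mem|wab] := boolP (w \in _).
  rewrite /= in_itv /= => /andP[aw wb'].
  have {}aw : a < w by rewrite lt_neqAle eq_sym wa.
  have {}wb' : w < b by rewrite lt_neqAle wb.
  set delta := Num.min (w - a) (b - w).
  have d0 : 0 < delta by rewrite lt_min !subr_gt0 aw.
  have h0 := gauss_small d0.
  have E n : 1 - win a b n w = Rintegral leb (~` `[a, b]%classic) (normal_pdf w (n.+1%:R^-1)).
    rewrite -[X in X - _](Rintegral_normal_pdf w (n.+1%:R^-1)) -(setUv `[a, b]%classic).
    rewrite Rintegral_setU//.
    - by rewrite /win /window addrC addKr.
    - exact: measurableC.
    - by rewrite setUv; exact: integrable_normal_pdf.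
    - by apply/disj_setPCl.
  have -> : (fun n => win a b n w) = (fun n => 1 - (1 - win a b n w)) by apply/funext => n; ring.
  rewrite -[X in _ --> X](subr0 (1 : R)); apply: cvgB; first exact: cvg_cst.
  apply: (@squeeze_cvgr _ _ _ _ (cst 0) _ _ _ _ _ h0); last exact: cvg_cst.
  apply: nearW => n; apply/andP; split; first by rewrite subr_ge0 window_le1.
  rewrite E; apply: normal_tail => //; [exact: ltW|exact: measurableC|].
  move=> x /= /negP; rewrite in_itv /= negb_and -!ltNge => /orP[xa|xb].
    by rewrite ge_min ger0_norm; [rewrite lerD2l lerN2 ltW// |lra].
  by rewrite ge_min orbC ler0_norm; [rewrite opprB lerD2r ltW|lra].
have [delta d0 hd] : exists2 delta, 0 < delta & forall x, `[a, b]%classic x -> delta <= `|w - x|.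
  move: wab; rewrite notin_setE /= => /negP; rewrite in_itv /= negb_and -!ltNge => /orP[h|h].
    exists (a - w); first by rewrite subr_gt0.
    by move=> x; rewrite /= in_itv /= => /andP[ax xb]; rewrite ler0_norm; lra.
  exists (w - b); first by rewrite subr_gt0.
  by move=> x; rewrite /= in_itv /= => /andP[ax xb]; rewrite ger0_norm; lra.
have h0 := gauss_small d0.
apply: (@squeeze_cvgr _ _ _ _ (cst 0) _ _ _ _ _ h0); last exact: cvg_cst.
apply: nearW => n; apply/andP; split; first exact: window_ge0.
by apply: normal_tail => //; exact: ltW.
Qed.

End GaussianFourier.

(** * Oscillatory integrals of decreasing functions *)

Section Oscillation.
Context {R : realType}.
Local Notation leb := (@lebesgue_measure R).
Local Notation TR := (measurableTypeR R).

(** Shifting by half a period [h = pi / |w|] changes the sign of the character,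
    so that twice the integral is the integral of [g(s) - g(s + h)] against
    it.  That difference is nonnegative to the right of [A] and has vanishing
    total integral, so its total variation is controlled by the mass that the
    shifted function has on [(A - h, A]]. *)
Lemma oscillation_decreasing (g : R -> R) (A G w : R) : w != 0 ->
  measurable_fun setT g -> leb.-integrable setT (EFin \o g) ->
  (forall s, 0 <= g s <= G) -> (forall s, s <= A -> g s = 0) ->
  (forall s t, A < s -> s <= t -> g t <= g s) ->
  cmod (cint leb setT (fun s => (g s)%:C * cis (s * w))) <= pi * G / `|w|.
Proof.
move=> w0 mg ig gG gA gd; pose h := pi / `|w|.
have nw : 0 < `|w| by rewrite normr_gt0.
have h0 : 0 < h by rewrite divr_gt0// pi_gt0.
have G0 : 0 <= G by have /andP[] := gG 0; exact: le_trans.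
have ch s : cis ((s + h) * w) = - cis (s * w).
  rewrite mulrDl cisD (_ : cis (h * w) = -1) ?mulrN1//.
  rewrite /h; have [wp|wn] := leP 0 w.
    by rewrite ger0_norm// divfK// /cis cospi sinpi; apply: complexP => //=; rewrite oppr0.
  rewrite ltr0_norm// invrN mulrN mulNr divfK// cisN cospi sinpi.
  by apply: complexP => //=; rewrite oppr0.
have mc : cmeasurable (fun s : R => cis (s * w)) by apply: cmeas_cis; exact: measurable_funM.
have mgc : cmeasurable (fun s : R => (g s)%:C * cis (s * w)).
  by apply: cmeasM => //; exact: cmeasR.
have igh := integrable_translate h ig.
have mgh : measurable_fun setT (fun s : R => g (s + h)) by exact: (measurableT_comp mg (measurable_addr h)).
have ic (f : R -> R) : measurable_fun setT f -> leb.-integrable setT (EFin \o f) ->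
    cintegrable leb setT (fun s => (f s)%:C * cis (s * w)).
  move=> mf jf; apply: (@cmeas_cintegrable _ TR _ leb _ measurableT _ (fun s => `|f s|)).
  - by apply: cmeasM => //; exact: cmeasR.
  - by move=> s _; rewrite cmodM cmod_cis mulr1 cmodR.
  - exact: (integrable_norm jf).
set I := cint _ _ _.
have I2 : 2 * I = cint leb setT (fun s => (g s - g (s + h))%:C * cis (s * w)).
  have E : I = - cint leb setT (fun s => (g (s + h))%:C * cis (s * w)).
    rewrite /I -(@cint_translate _ _ h)// -cintN; [|exact: measurableT|exact: (ic (fun s => g (s + h)))].
    by apply: eq_cint => s _; rewrite ch mulrN.
  have -> : 2 * I = I + I by ring.
  rewrite {2}E /I -cintB; [|exact: measurableT|exact: ic|exact: (ic (fun s => g (s + h)))].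
  by apply: eq_cint => s _; rewrite rmorphB mulrBl.
have mA : measurable (`]A - h, A]%classic : set TR) by exact: measurable_itv.
have bnd : cmod (2 * I) <= 2 * G * h.
  have id0 : leb.-integrable setT (EFin \o (fun s => g s - g (s + h))).
    by under [X in integrable _ _ X]funext do rewrite /= EFinB; exact: integrableB.
  have id1 : leb.-integrable setT (EFin \o (fun s => (2 * G) * \1_(`]A - h, A]%classic : set TR) s)).
    by under [X in integrable _ _ X]funext do rewrite /= EFinM; apply: integrableZl => //; exact: integrable_indic_itv.
  rewrite I2 (le_trans (@cmod_cint_le _ TR _ _ _ measurableT _ (ic _ _ _)))//.
    exact: measurable_funB.
  have -> : 2 * G * h = Rintegral leb setT (fun s => (g s - g (s + h)) + (2 * G) * \1_(`]A - h, A]%classic : set TR) s).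
    rewrite RintegralD// RintegralB// (Rintegral_translate h mg) subrr add0r.
    rewrite RintegralZl//; last exact: integrable_indic_itv.
    congr (_ * _); rewrite /Rintegral integral_indic// setIT.
    have E : leb (`]A - h, A]%classic : set TR) = h%:E.
      rewrite lebesgue_measure_itv /= lte_fin ifT; last by lra.
      by rewrite -EFinB; congr EFin; ring.
    exact: (congr1 fine (esym E)).
  apply: le_Rintegral => //.
  - apply: (@cintegrable_cmod _ TR) => //; apply: ic => //; exact: measurable_funB.
  - by under [X in integrable _ _ X]funext do rewrite /= EFinD; exact: integrableD.
  move=> s _; rewrite cmodM cmod_cis mulr1 cmodR.
  have /andP[s0 sG] := gG s; have /andP[sh0 shG] := gG (s + h).
  have i0 : 0 <= \1_(`]A - h, A]%classic : set TR) s :> R by rewrite indicE ler0n.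
  have [sA|As] := leP s A.
    rewrite gA// sub0r normrN ger0_norm//.
    have [shA|shA] := leP (s + h) A; first by rewrite gA//; have := mulr_ge0 (mulr_ge0 (ler0n R 2) G0) i0; lra.
    rewrite indicE mem_set ?mulr1 /=; last by rewrite in_itv /=; apply/andP; split; lra.
    lra.
  have := gd s (s + h) As; rewrite lerDl => /(_ (ltW h0)) hh.
  rewrite ger0_norm ?subr_ge0// lerDl; apply: mulr_ge0 => //.
  by rewrite mulr_ge0.
move: bnd; rewrite cmodM (_ : cmod 2 = 2); last by rewrite (_ : 2 = (2 : R)%:C) ?cmodR ?ger0_norm// rmorph_nat.
by rewrite -mulrA ler_pM2l// /h mulrCA mulrA.
Qed.

Lemma integrable_reflect (f : R -> R) : leb.-integrable setT (EFin \o f) ->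
  leb.-integrable setT (EFin \o (fun t => f (- t))).
Proof.
move=> /integrableP[/measurable_EFinP mf fi]; apply/integrableP; split.
  by apply/measurable_EFinP; apply: (measurableT_comp mf); exact: oppr_measurable.
have mN : measurable_fun [set: TR] (-%R : TR -> TR) by exact: oppr_measurable.
have mF : measurable_fun [set: TR] (fun t => `|(f t)%:E|%E).
  by apply: measurableT_comp => //; exact/measurable_EFinP.
have := @ge0_integral_pushforward _ _ TR TR R (-%R : TR -> TR) mN leb setT _ measurableT mF
  (fun y _ => abse_ge0 _).
rewrite preimage_setT => E; rewrite -[X in (X < _)%E]E.
apply: le_lt_trans fi; rewrite le_eqVlt; apply/orP; left; apply/eqP.
by apply: eq_measure_integral => A mA _; exact: lebesgue_measureN.
Qed.

Lemma int_powR (b x y : R) : 0 < b < 1 -> 0 < x -> x < y ->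
  (\int[leb]_(s in `[x, y]) (s `^ (- b))%:E =
   ((y `^ (1 - b) - x `^ (1 - b)) / (1 - b))%:E)%E.
Proof.
move=> /andP[b0 b1] x0 xy.
have b1' : 1 - b != 0 by rewrite subr_eq0 gt_eqF.
pose F (s : R) := (1 - b)^-1 * s `^ (1 - b).
have dF (s : R) : 0 < s -> is_derive s (1 : R) F (s `^ (- b)).
  move=> s0; apply: (is_derive_eq (is_derive_mul (is_derive_cst (1 - b)^-1 s (1 : R)) (is_derive1_powR (1 - b) s0))).
  by rewrite mul0r add0r /cst mulrA mulVf// mul1r; congr (_ `^ _); ring.
have cF (s : R) : 0 < s -> {for s, continuous F}.
  by move=> s0; apply: differentiable_continuous; apply/derivable1_diffP; have h := dF s s0; exact: ex_derive.
have cp (s : R) : 0 < s -> {for s, continuous (fun s : R => s `^ (- b))}.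
  move=> s0; apply: differentiable_continuous; apply/derivable1_diffP.
  by have h := is_derive1_powR (- b) s0; exact: ex_derive.
rewrite (@continuous_FTC2 R _ F x y)//.
- by rewrite -EFinB /F; congr EFin; field.
- apply: continuous_in_subspaceT => s; rewrite inE /= in_itv /= => /andP[xs _].
  by apply: cp; exact: lt_le_trans xs.
- split.
  + move=> s; rewrite in_itv /= => /andP[xs _].
    by have h := dF s (lt_trans x0 xs); exact: ex_derive.
  + by apply: cvg_at_right_filter; exact: cF.
  + by apply: cvg_at_left_filter; apply: cF; exact: lt_trans xy.
- move=> s; rewrite in_itv /= => /andP[xs _]; rewrite derive1E.
  by have h := dF s (lt_trans x0 xs); rewrite derive_val.
Qed.

(** The primitive of [w^-b] is bounded at the origin because [b < 1]; the
    integral over [(0, 1]] is the limit of those over [[1/(n+2), 1]]. *)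
Lemma integrable_powR_near0 (b : R) : 0 < b < 1 ->
  leb.-integrable setT (EFin \o (fun w : R => `|w| `^ (- b) * \1_(`[-1, 1]%classic : set R) w)).
Proof.
move=> bb; have /andP[b0 b1] := bb.
pose f (w : R) := w `^ (- b) * \1_(`]0, 1]%classic : set R) w.
have mf : measurable_fun setT f.
  apply: measurable_funM; first exact: measurable_powR.
  by apply: measurable_indic; exact: measurable_itv.
have f0 w : 0 <= f w by rewrite mulr_ge0 ?powR_ge0// indicE ler0n.
have fi : leb.-integrable setT (EFin \o f).
  apply/integrableP; split; first exact/measurable_EFinP.
  under eq_integral do rewrite gee0_abs ?lee_fin//=.
  pose g (n : nat) (w : R) := (w `^ (- b) * \1_(`[n.+2%:R^-1, 1]%classic : set R) w).
  have mi n : measurable (`[n.+2%:R^-1, 1]%classic : set TR) by exact: measurable_itv.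
  have g0 n w : 0 <= g n w by rewrite mulr_ge0 ?powR_ge0// indicE ler0n.
  have nd w m n : (m <= n)%N -> g m w <= g n w.
    move=> mn; rewrite ler_wpM2l ?powR_ge0// !indicE.
    case: (boolP (w \in `[m.+2%:R^-1, 1]%classic)) => [/set_mem|_]; last by rewrite ler0n.
    rewrite /= in_itv /= => /andP[mw w1]; rewrite mem_set// /= in_itv /= w1 andbT.
    by apply: le_trans mw; rewrite lef_pV2 ?posrE// ler_nat !ltnS.
  have gf w : (g n w)%:E @[n --> \oo] --> (f w)%:E.
    apply: cvg_EFin; first exact: nearW.
    apply: cvg_near_cst; near=> n; rewrite /= /g /f; congr (_ * _); rewrite !indicE.
    have [w0|w0] := leP w 0.
      rewrite !memNset//=; rewrite in_itv /= ?(le_gtF w0)//.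
      by move=> /andP[h _]; have := le_trans h w0; rewrite leNgt invr_gt0 ltr0n.
    have [w1|w1] := leP w 1; last first.
      by rewrite !memNset//= in_itv /= (lt_geF w1) andbF.
    rewrite !mem_set//= in_itv /= ?w0 ?w1//= andbT.
    rewrite -[leRHS]invrK lef_pV2 ?posrE ?invr_gt0//.
    apply: (@le_trans _ _ n%:R); last by rewrite ler_nat -addn2 leq_addr.
    by near: n; exact: nbhs_infty_ger.
  have E : (\int[leb]_x (f x)%:E = lim ((\int[leb]_x (g n x)%:E) @[n --> \oo]))%E.
    rewrite -monotone_convergence//.
    - by apply: eq_integral => w _; apply/esym/cvg_lim => //; exact: gf.
    - move=> n; apply/measurable_EFinP; apply: measurable_funM; first exact: measurable_powR.
      exact: measurable_indic.
    - by move=> n w _; rewrite lee_fin.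
    - by move=> w _ m n mn; rewrite lee_fin nd.
  rewrite E.
  apply: (@le_lt_trans _ _ ((1 - b)^-1)%:E); last exact: ltry.
  apply: lime_le.
    apply: ereal_nondecreasing_is_cvgn => m n mn; apply: ge0_le_integral => //.
    - by move=> w _; rewrite lee_fin.
    - apply/measurable_EFinP; apply: measurable_funM; first exact: measurable_powR.
      exact: measurable_indic.
    - apply/measurable_EFinP; apply: measurable_funM; first exact: measurable_powR.
      exact: measurable_indic.
    - by move=> w _; rewrite lee_fin nd.
  apply: nearW => n.
  have -> : (\int[leb]_x (g n x)%:E = \int[leb]_(x in `[n.+2%:R^-1%R, 1%R]) ((x : R) `^ (- b))%:E)%E.
    rewrite [RHS]integral_mkcond; apply: eq_integral => w _.
    by rewrite patchE /g indicE; case: ifPn => _; rewrite ?mulr1 ?mulr0.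
  rewrite int_powR//; last by rewrite invf_lt1// ltr1n.
  by rewrite lee_fin powR1 ler_pdivrMr ?subr_gt0// mulVf ?subr_eq0 ?gt_eqF// gerBl powR_ge0.
apply: (@le_integrable _ TR _ leb setT measurableT _ (fun w => (f w + f (- w))%:E)).
- apply/measurable_EFinP; apply: measurable_funM.
    by apply: (measurableT_comp (measurable_powR _)); exact: normr_measurable.
  by apply: measurable_indic; exact: measurable_itv.
- move=> w _ /=; rewrite lee_fin (ger0_norm (addr_ge0 (f0 _) (f0 _))).
  rewrite ger0_norm; last by rewrite mulr_ge0 ?powR_ge0// indicE ler0n.
  have [->|w0] := eqVneq w 0.
    by rewrite normr0 powR0 ?oppr_eq0 ?gt_eqF// mul0r addr_ge0.
  rewrite indicE; case: (boolP (w \in _)) => [/set_mem|_]; last by rewrite mulr0 addr_ge0.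
  rewrite /= in_itv /= mulr1 => /andP[w1 w2].
  have [wp|wn] := ltP 0 w.
    have fE : f w = w `^ (- b) by rewrite /f indicE mem_set ?mulr1//= in_itv /= wp.
    by rewrite gtr0_norm// fE lerDl.
  have fE : f (- w) = (- w) `^ (- b).
    rewrite /f indicE mem_set ?mulr1//= in_itv /= oppr_gt0 lt_neqAle w0 wn /=; lra.
  by rewrite ler0_norm// fE lerDr.
- under eq_fun do rewrite EFinD.
  apply: integrableD => //; exact: integrable_reflect.
Unshelve. all: by end_near. Qed.

End Oscillation.

(** * The half-line transform of the kernel *)

Section KernelBounds.
Context {R : realType}.
Local Notation leb := (@lebesgue_measure R).
Local Notation TR := (measurableTypeR R).
Variable K : R -> \bar R.
Hypotheses (Kv : kernel_valued K) (KI : kernel_I K) (KII : kernel_II K).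
Local Notation k := (kreal K).

Lemma kreal_gt0 t : t != 0 -> 0 < k t.
Proof.
move=> t0; have [_ _ Kp _ _] := KI; have [_ Kf] := Kv.
by apply: fine_gt0; rewrite Kp//= ltey_eq Kf.
Qed.

Lemma measurable_kreal : measurable_fun setT k.
Proof. by have [[]] := KI. Qed.

Lemma integrable_kreal b : leb.-integrable `[0, b] (EFin \o k).
Proof.
have [[mk _ fk] _ _ _ _] := KI; apply/integrableP; split.
  by apply/measurable_EFinP; exact: measurable_funTS.
by apply: fk => //; exact: segment_compact.
Qed.

Lemma kreal_decr : exists2 M, 1 <= M & forall s t, M <= s -> s <= t -> k t <= k s.
Proof.
have [_ _ _ [_ [M hM]] _] := KI; have [_ Kf] := Kv.
exists (Num.max M 1); first by rewrite le_max lexx orbT.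
move=> s t; rewrite ge_max => /andP[Ms s1] st.
by apply: fine_le; [apply: Kf; rewrite gt_eqF//; lra|apply: Kf; rewrite gt_eqF//; lra|exact: hM].
Qed.

Let asymp_bound (f g : R -> R) : (forall t, 1 <= t -> 0 < g t) -> asymp f g ->
  exists2 M, 1 <= M & exists2 C, 0 <= C & forall t, M <= t -> f t <= C * g t.
Proof.
move=> g0 [c c0 fc].
have : \forall t \near +oo, f t / g t <= c + 1.
  have : \forall t \near +oo, `|c - f t / g t| <= 1 by move/cvgrPdist_le : fc; apply.
  apply: filterS => t; rewrite ler_norml => /andP[h1 h2]; lra.
move=> [M [_ hM]]; exists (Num.max 1 (M + 1)); first by rewrite le_max lexx.
exists (c + 1); first by rewrite addr_ge0// ltW.
move=> t; rewrite ge_max => /andP[t1 tM].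
by rewrite -ler_pdivrMr ?g0//; apply: hM; lra.
Qed.

(** In each of the three cases the kernel is eventually dominated by a power
    [t^-alpha] with exponent in [(0, 1)]: an integrable decreasing kernel is
    even [O(1/t)]. *)
Lemma kreal_power_bound : exists M C alpha : R, [/\ 0 < alpha < 1, 1 <= M, 0 <= C,
  forall s t, M <= s -> s <= t -> k t <= k s &
  forall t, M <= t -> k t <= C * t `^ (- alpha)].
Proof.
have [M M1 hM] := kreal_decr.
have half : 0 < (2^-1 : R) < 1 by rewrite invr_gt0 ltr0n /= invf_lt1 ?ltr1n.
have inv_half (t : R) : 1 <= t -> t^-1 <= t `^ (- 2^-1).
  by move=> t1; rewrite -powR_inv1 ?(le_trans _ t1)//; apply: ler_powR => //; lra.
case: KII => [ik|/asymp_bound h|[alpha a01 /asymp_bound h]].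
- set I := Rintegral leb setT (fun s => `|k s|).
  have I0 : 0 <= I by apply: Rintegral_ge0.
  (* [k t * t / 2] is at most the integral of [k] over [[t / 2, t]] because
     [k] decreases from [M] on, hence [t >= 2 M]; and [1 / t <= t^(-1/2)] *)
  exists (2 * M), (2 * I), 2^-1; split => //; first lra.
  + by rewrite mulr_ge0.
  + by move=> s t Ms st; apply: hM => //; lra.
  move=> t Mt; have t0 : 0 < t by lra.
  apply: (@le_trans _ _ (2 * I * t^-1)); last by rewrite ler_wpM2l ?mulr_ge0// inv_half//; lra.
  rewrite ler_pdivlMr// -ler_pdivrMl// mulrC.
  have mt : measurable (`[t / 2, t]%classic : set TR) by exact: measurable_itv.
  have ink := integrable_norm ik.
  apply: (@le_trans _ _ (Rintegral leb `[t / 2, t] (fun s => `|k s|))); last first.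
    by apply: Rintegral_subset_le => //.
  have -> : k t * t / 2 = Rintegral leb `[t / 2, t] (fun _ => k t).
    rewrite Rintegral_cst// -mulrA; congr (_ * _).
    have E : leb (`[t / 2, t]%classic : set TR) = (t / 2)%:E.
      rewrite lebesgue_measure_itv /= lte_fin ifT; last by lra.
      by rewrite -EFinB; congr EFin; lra.
    exact: (congr1 fine (esym E)).
  apply: le_Rintegral => //.
  + apply: (@continuous_compact_integrable R); first exact: segment_compact.
    by apply: continuous_subspaceT => x; exact: cvg_cst.
  + by apply: (integrableS measurableT mt (@subsetT _ _)).
  + move=> s; rewrite /= in_itv /= => /andP[ts st].
    by rewrite (le_trans _ (ler_norm _))// hM//; lra.
- have [t t1|M' M'1 [C C0 hC]] := h; first by rewrite invr_gt0; lra.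
  exists (Num.max M M'), C, 2^-1; split => //.
  + by rewrite le_max M1.
  + by move=> s t; rewrite ge_max => /andP[Ms _] st; exact: hM.
  + move=> t; rewrite ge_max => /andP[_ Mt]; apply: (le_trans (hC _ Mt)).
    by rewrite ler_wpM2l// inv_half//; lra.
- have [t t1|M' M'1 [C C0 hC]] := h; first by rewrite powR_gt0; lra.
  exists (Num.max M M'), C, alpha; split => //.
  + by rewrite le_max M1.
  + by move=> s t; rewrite ge_max => /andP[Ms _] st; exact: hM.
  + by move=> t; rewrite ge_max => /andP[_ Mt]; exact: hC.
Qed.

(** The exponent is [+isw]: the memory term looks forward in the argument of
    the test function, so the conjugate of the transform of [K^+] appears. *)
Definition ktrunc (b w : R) : R[i] := cint leb `[0, b] (fun s => (k s)%:C * cis (s * w)).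

Lemma cintegrable_ktrunc b w : cintegrable leb `[0, b] (fun s => (k s)%:C * cis (s * w)).
Proof.
have mb : measurable (`[0, b]%classic : set TR) by exact: measurable_itv.
apply: (@cmeas_cintegrable _ TR _ leb _ mb _ (fun s => `|k s|)).
- by apply: cmeasM; [apply: cmeasR; exact: measurable_kreal|apply: cmeas_cis; exact: measurable_funM].
- by move=> s _; rewrite cmodM cmod_cis mulr1 cmodR.
- by apply: (integrable_norm (integrable_kreal b)).
Qed.

(** Beyond [M] the truncated kernel is decreasing and bounded by [k A], so the
    oscillation bound applies to it. *)
Lemma ktrunc_tail M : 1 <= M -> (forall s t, M <= s -> s <= t -> k t <= k s) ->
  forall A b w, M <= A -> A <= b -> w != 0 ->
  cmod (ktrunc b w - ktrunc A w) <= pi * k A / `|w|.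
Proof.
move=> M1 kd A b w MA Ab w0.
have mAb : measurable (`]A, b]%classic : set TR) by exact: measurable_itv.
have A0 : 0 <= A by lra.
pose g s := k s * \1_(`]A, b]%classic : set TR) s.
have iAb : leb.-integrable `]A, b] (EFin \o k).
  apply: integrableS (integrable_kreal b) => //.
  by move=> s; rewrite /= !in_itv /= => /andP[h1 ->]; rewrite andbT; lra.
have gE s : g s = (k \_ (`]A, b]%classic : set TR)) s.
  by rewrite /g patchE indicE; case: ifPn => _; rewrite ?mulr1 ?mulr0.
have -> : ktrunc b w - ktrunc A w = cint leb setT (fun s => (g s)%:C * cis (s * w)).
  rewrite /ktrunc.
  have [ir ii] := cintegrable_ktrunc b w.
  have -> : cint leb `[0, b] (fun s => (k s)%:C * cis (s * w)) - cint leb `[0, A] (fun s => (k s)%:C * cis (s * w)) =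
     cint leb `]A, b] (fun s => (k s)%:C * cis (s * w)).
    apply: complexP; rewrite !cReImE /=; apply: Rintegral_itvB => //; by rewrite bnd_simp.
  rewrite cint_mkcond; apply: eq_cint => s _; rewrite /g rmorphM; ring.
have gin s : A < s -> s <= b -> g s = k s.
  by move=> As sb; rewrite /g indicE mem_set ?mulr1//= in_itv /= As sb.
have gout s : ~~ ((A < s) && (s <= b)) -> g s = 0.
  by move=> h; rewrite /g indicE memNset ?mulr0//= in_itv /=; exact/negP.
have g0 s : 0 <= g s.
  have [/andP[As sb]|h] := boolP ((A < s) && (s <= b)); last by rewrite gout.
  by rewrite gin// ltW// kreal_gt0// gt_eqF//; lra.
apply: (@oscillation_decreasing _ _ A) => //.
- apply: measurable_funM; first exact: measurable_kreal.
  by apply: measurable_indic.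
- have -> : EFin \o g = (EFin \o k) \_ (`]A, b]%classic : set TR).
    by apply/funext => s; rewrite /= gE !patchE; case: ifPn.
  exact/(integrable_mkcond _ mAb).
- move=> s; rewrite g0 /=.
  have [/andP[As sb]|h] := boolP ((A < s) && (s <= b)); last by rewrite gout// ltW// kreal_gt0// gt_eqF//; lra.
  by rewrite gin//; apply: kd => //; exact: ltW.
- by move=> s sA; apply: gout; rewrite ltNge sA.
- move=> s t As st; have [tb|bt] := leP t b; last by rewrite gout ?g0// negb_and -!ltNge bt orbT.
  by rewrite !gin//; [apply: kd => //; lra|exact: le_trans tb|exact: lt_le_trans st].
Qed.

Lemma kreal_cvg0 : k t @[t --> +oo] --> (0 : R).
Proof. by have [_ _ _ []] := KI. Qed.

Let cvgy_of_tail (F : R -> R) (M w : R) : w != 0 ->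
  (forall A b, M <= A -> A <= b -> `|F b - F A| <= pi * k A / `|w|) -> cvg (F b @[b --> +oo]).
Proof.
move=> w0 hF; apply: cauchy_cvg; apply: cauchy_exP => e e0.
have k0 : pi * k t / `|w| @[t --> +oo] --> (0 : R).
  rewrite -[X in _ --> X](mul0r (`|w|^-1)) -[X in X * _](mulr0 pi).
  apply: cvgM; last exact: cvg_cst.
  by apply: cvgM; [exact: cvg_cst|exact: kreal_cvg0].
have : \forall A \near +oo, `|pi * k A / `|w| | < e by apply: cvgr0_norm_lt.
move=> [N [_ hN]]; pose A := Num.max M (N + 1).
have AM : M <= A by rewrite le_max lexx.
have AN : N < A by rewrite lt_max ltrDl ltr01 orbT.
exists (F A); exists A; split; first exact: num_real.
move=> b Ab; rewrite /ball /= distrC.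
apply: (le_lt_trans (hF A b AM (ltW Ab))); apply: le_lt_trans (hN A AN).
exact: ler_norm.
Qed.

(** As the kernel tends to zero, the tail bound is Cauchy's criterion for both
    improper integrals. *)
Lemma Kcos_Ksin_cvg w : w != 0 ->
  (Rintegral leb `[0, b] (fun t => k t * cos (w * t)) @[b --> +oo] --> Kcos K w) /\
  (Rintegral leb `[0, b] (fun t => k t * sin (w * t)) @[b --> +oo] --> Ksin K w).
Proof.
move=> w0; have [M M1 kd] := kreal_decr.
have h := ktrunc_tail M1 kd.
have Er b : Rintegral leb `[0, b] (fun t => k t * cos (w * t)) = complex.Re (ktrunc b w).
  by apply: eq_Rintegral => s _; rewrite !cReImE /= mul0r subr0 mulrC (mulrC w) mulrC.
have Ei b : Rintegral leb `[0, b] (fun t => k t * sin (w * t)) = complex.Im (ktrunc b w).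
  by apply: eq_Rintegral => s _; rewrite !cReImE /= mul0r addr0 mulrC (mulrC w) mulrC.
split.
  apply: (@cvgy_of_tail _ M w) => // A b MA Ab; rewrite !Er.
  by apply: le_trans (h A b w MA Ab w0); apply: le_trans (Re_le_cmod _); rewrite !cReImE.
apply: (@cvgy_of_tail _ M w) => // A b MA Ab; rewrite !Ei.
by apply: le_trans (h A b w MA Ab w0); apply: le_trans (Im_le_cmod _); rewrite !cReImE.
Qed.

Definition khat (w : R) : R[i] := Kcos K w +i* Ksin K w.

Lemma ktrunc_cvg w : w != 0 -> ccvg (fun n => ktrunc n%:R w) (khat w).
Proof.
move=> w0; have [hr hi] := Kcos_Ksin_cvg w0; apply/ccvgP; split.
  have := cvg_comp _ _ (@cvgr_idn R) hr; apply: cvg_trans; apply: near_eq_cvg; apply: nearW => n.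
  by apply: eq_Rintegral => s _; rewrite !cReImE /= mul0r subr0 (mulrC w).
have := cvg_comp _ _ (@cvgr_idn R) hi; apply: cvg_trans; apply: near_eq_cvg; apply: nearW => n.
by apply: eq_Rintegral => s _; rewrite !cReImE /= mul0r addr0 (mulrC w).
Qed.

(** Up to time [max M (1/|w|)] the kernel is integrated in absolute value;
    beyond it, the oscillation bound applies. *)
Lemma ktrunc_bound : exists D beta : R, [/\ 0 <= D, 0 < beta < 1 &
  forall b w, w != 0 -> cmod (ktrunc b w) <= D * (1 + `|w| `^ (- beta))].
Proof.
have [M [C [alpha [/andP[a0 a1] M1 C0 kd kp]]]] := kreal_power_bound.
set IM := Rintegral leb `[0, M] (fun s => `|k s|).
have IM0 : 0 <= IM by apply: Rintegral_ge0.
have kM0 : 0 <= k M by rewrite ltW// kreal_gt0// gt_eqF//; lra.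
have a1' : 0 < 1 - alpha by rewrite subr_gt0.
have pi0 := pi_gt0 R.
have mi a b : measurable (`[a, b]%classic : set TR) by exact: measurable_itv.
have inb b : leb.-integrable `[0, b] (EFin \o (fun s => `|k s|)) by exact: (integrable_norm (integrable_kreal b)).
exists (IM + C / (1 - alpha) * M + pi * C + pi * k M * M), (1 - alpha); split.
- have MM : 0 <= M by lra.
  have c1 : 0 <= C / (1 - alpha) by rewrite divr_ge0// ltW.
  have q1 := mulr_ge0 c1 MM; have q2 := mulr_ge0 (ltW pi0) C0.
  have q3 := mulr_ge0 (mulr_ge0 (ltW pi0) kM0) MM.
  exact: (addr_ge0 (addr_ge0 (addr_ge0 IM0 q1) q2) q3).
- by apply/andP; split; lra.
have abs b w : cmod (ktrunc b w) <= Rintegral leb `[0, b] (fun s => `|k s|).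
  rewrite (le_trans (@cmod_cint_le _ TR _ _ _ (mi 0 b) _ (cintegrable_ktrunc b w)))//.
  by under eq_Rintegral do rewrite cmodM cmod_cis mulr1 cmodR.
have absle a b : a <= b -> Rintegral leb `[0, a] (fun s => `|k s|) <= Rintegral leb `[0, b] (fun s => `|k s|).
  move=> ab; rewrite fine_le//.
  - by apply: integrable_fin_num => //; exact: inb.
  - by apply: integrable_fin_num => //; exact: inb.
  - apply: ge0_subset_integral => //; first exact: measurable_int (inb b).
    by move=> s; rewrite /= !in_itv /= => /andP[-> h] /=; exact: le_trans ab.
have absA A : M <= A -> Rintegral leb `[0, A] (fun s => `|k s|) <= IM + C * (A `^ (1 - alpha) / (1 - alpha)).
  rewrite le_eqVlt => /predU1P[<-|MA].
    by rewrite lerDl mulr_ge0// divr_ge0 ?powR_ge0// ltW.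
  have -> : Rintegral leb `[0, A] (fun s => `|k s|) = IM + Rintegral leb `]M, A] (fun s => `|k s|).
    rewrite -(@Rintegral_itvB _ (fun s => `|k s|) (BLeft 0) (BRight A) M).
    - by rewrite /IM addrC subrK.
    - exact: inb.
    - by rewrite bnd_simp; lra.
    - by rewrite bnd_simp; exact: ltW.
  rewrite lerD2l.
  have iMA : leb.-integrable `[M, A] (EFin \o (fun s => `|k s|)).
    apply: integrableS (inb A) => //; move=> s; rewrite /= !in_itv /= => /andP[h ->].
    by rewrite andbT; lra.
  rewrite Rintegral_itv_obnd_cbnd; last first.
    apply: integrableS iMA => //; exact: subset_itv_oc_cc.
  have ipow : leb.-integrable `[M, A] (EFin \o (fun s : R => s `^ (- alpha))).
    apply/integrableP; split.
      by apply/measurable_EFinP; apply: measurable_funTS; exact: measurable_powR.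
    under eq_integral do rewrite gee0_abs ?lee_fin ?powR_ge0//=.
    by rewrite int_powR ?ltry//; [apply/andP|lra].
  apply: (@le_trans _ _ (Rintegral leb `[M, A] (fun s : R => C * s `^ (- alpha)))).
    apply: le_Rintegral => //.
      under [X in integrable _ _ X]funext do rewrite /= EFinM.
      exact: integrableZl.
    move=> s; rewrite /= in_itv /= => /andP[Ms _].
    by rewrite gtr0_norm ?kp// kreal_gt0// gt_eqF//; lra.
  rewrite RintegralZl// ler_wpM2l// /Rintegral int_powR//; [|exact/andP|lra].
  rewrite /= ler_pM2r ?invr_gt0//.
  by rewrite gerBl powR_ge0.
move=> b w w0; have nw : 0 < `|w| by rewrite normr_gt0.
have W0 : 0 <= `|w| `^ (- (1 - alpha)) by rewrite powR_ge0.
have main A : M <= A -> cmod (ktrunc b w) <= IM + C * (A `^ (1 - alpha) / (1 - alpha)) + pi * k A / `|w|.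
  move=> MA; have kA0 : 0 <= pi * k A / `|w|.
    by rewrite divr_ge0// mulr_ge0 ?(ltW pi0)// ltW// kreal_gt0// gt_eqF//; lra.
  have [bA|Ab] := leP b A.
    rewrite (le_trans (abs b w))// (le_trans (absle _ _ bA))// (le_trans (absA _ MA))//.
    by rewrite lerDl.
  rewrite -(subrK (ktrunc A w) (ktrunc b w)) (le_trans (cmodD _ _))// addrC lerD//.
    by rewrite (le_trans (abs A w))// absA.
  by apply: (ktrunc_tail M1 kd) => //; exact: ltW.
have C1 : 0 <= C / (1 - alpha) by rewrite divr_ge0// ltW.
have piC : 0 <= pi * C by rewrite mulr_ge0// ltW.
have piM : 0 <= pi * k M * M by rewrite !mulr_ge0// ?(ltW pi0)//; lra.
(* the two errors balance at [A = 1 / |w|], provided that this is in the range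
   where the kernel decreases *)
have [wM|Mw] := leP M `|w|^-1.
  apply: (le_trans (main _ wM)).
  have pE : `|w|^-1 `^ (1 - alpha) = `|w| `^ (- (1 - alpha)).
    by rewrite -(powR_inv1 (ltW nw)) -powRrM mulN1r.
  have kE : pi * k `|w|^-1 / `|w| <= pi * C * `|w| `^ (- (1 - alpha)).
    have := kp _ wM; rewrite -{2}(powR_inv1 (ltW nw)) -powRrM mulN1r opprK => h.
    rewrite -!mulrA ler_wpM2l ?(ltW pi0)//.
    apply: (@le_trans _ _ (C * `|w| `^ alpha * `|w|^-1)).
      by rewrite ler_wpM2r ?invr_ge0.
    rewrite -mulrA ler_wpM2l// -(powR_inv1 (ltW nw)) -powRD; last by apply/implyP => _; rewrite gt_eqF.
    by rewrite (_ : alpha + -1 = - (1 - alpha))//; ring.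
  rewrite pE; move: W0 kE; set W := `|w| `^ _ => W0 kE.
  apply: (@le_trans _ _ (IM + C / (1 - alpha) * W + pi * C * W)).
    by rewrite lerD// lerD2l mulrA mulrAC.
  have q1M : C / (1 - alpha) * W <= C / (1 - alpha) * M * W.
    by rewrite ler_wpM2r// ler_peMr.
  have C1M : 0 <= C / (1 - alpha) * M by rewrite mulr_ge0//; lra.
  have := mulr_ge0 IM0 W0; have := mulr_ge0 C1M W0; have := mulr_ge0 piC W0; have := mulr_ge0 piM W0.
  have aux (i p1 q1 q2 q3 v : R) : 0 <= q1 -> 0 <= q2 -> 0 <= q3 -> p1 <= q1 * v ->
    0 <= q3 * v -> 0 <= q2 * v -> 0 <= q1 * v -> 0 <= i * v ->
    i + p1 + q2 * v <= (i + q1 + q2 + q3) * (1 + v).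
    by move=> *; rewrite mulrDr mulr1 !mulrDl; lra.
  by move=> *; apply: aux.
have hM := main M (lexx M).
have iM : `|w|^-1 <= M by exact: ltW.
have MM : M `^ (1 - alpha) <= M.
  by rewrite -[leRHS]powRr1 ?(le_trans _ M1)//; apply: ler_powR => //; lra.
have e1 : C * (M `^ (1 - alpha) / (1 - alpha)) <= C / (1 - alpha) * M.
  rewrite [leLHS](_ : _ = C / (1 - alpha) * M `^ (1 - alpha)); last by ring.
  by rewrite ler_wpM2l.
have e2 : pi * k M / `|w| <= pi * k M * M.
  by rewrite ler_wpM2l// mulr_ge0// ltW.
set D := IM + _ + _ + _.
have D0 : 0 <= D by rewrite /D !addr_ge0// mulr_ge0//; lra.
have DW := mulr_ge0 D0 W0.
by rewrite mulrDr mulr1; rewrite /D in DW *; lra.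
Qed.

End KernelBounds.

(** * The Fourier transform of the memory term *)

Section AlmostEverywhere.
Context {R : realType}.
Local Notation leb := (@lebesgue_measure R).
Local Notation TR := (measurableTypeR R).

Lemma ccvg_bound (z_ : nat -> R[i]) z (B : R) : ccvg z_ z -> (forall n, cmod (z_ n) <= B) -> cmod z <= B.
Proof.
move=> zz zB; apply/ler_addgt0Pr => e e0.
have : \forall n \near \oo, `|cmod (z_ n - z)| < e by apply: cvgr0_norm_lt.
move=> [N _ /(_ N (leqnn N))]; rewrite ger0_norm ?cmod_ge0// => h.
by rewrite -[z](subKr (z_ N)) (le_trans (cmodB _ _))// lerD// ltW.
Qed.

Lemma eq_Rintegral_neq0 (f g : R -> R) : measurable_fun setT f -> measurable_fun setT g ->
  (forall w, w != 0 -> f w = g w) -> Rintegral leb setT f = Rintegral leb setT g.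
Proof.
move=> mf mg fg; congr fine; apply: ae_eq_integral => //.
- exact/measurable_EFinP.
- exact/measurable_EFinP.
exists [set (0 : R)]; split; first exact: measurable_set1.
  exact: lebesgue_measure_set1.
move=> w /= /not_implyP[_ h]; apply: contrapT => /eqP w0; apply: h.
by rewrite fg.
Qed.

Lemma eq_cint_neq0 (f g : R -> R[i]) : cmeasurable f -> cmeasurable g ->
  (forall w, w != 0 -> f w = g w) -> cint leb setT f = cint leb setT g.
Proof.
move=> [mf mf'] [mg mg'] fg.
by congr (_ +i* _); apply: eq_Rintegral_neq0 => // w w0; rewrite fg.
Qed.

Lemma cmeas_lim (f_ : nat -> R -> R[i]) (f : R -> R[i]) : (forall n, cmeasurable (f_ n)) ->
  (forall w, ccvg (f_ ^~ w) (f w)) -> cmeasurable f.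
Proof.
move=> mf ff; split.
  apply: (@measurable_fun_cvg _ _ R setT (fun n w => complex.Re (f_ n w))).
  - by move=> n; have [] := mf n.
  - by move=> w _; have /ccvgP[] := ff w.
apply: (@measurable_fun_cvg _ _ R setT (fun n w => complex.Im (f_ n w))).
- by move=> n; have [] := mf n.
- by move=> w _; have /ccvgP[] := ff w.
Qed.

End AlmostEverywhere.

Section FourierIsFun.
Context {R : realType}.
Local Notation leb := (@lebesgue_measure R).
Local Notation TR := (measurableTypeR R).

Lemma fourier_is_funD (f g h1 h2 : R -> R[i]) (B1 B2 : R) (z : R[i]) :
  cmeasurable f -> (forall t, cmod (f t) <= B1) ->
  cmeasurable g -> (forall t, cmod (g t) <= B2) ->
  fourier_is_fun (distr f) h1 -> fourier_is_fun (distr g) h2 ->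
  fourier_is_fun (distr (fun t => f t + z * g t)) (fun w => h1 w + z * h2 w).
Proof.
move=> mf bf mg bg [mh1 H1] [mh2 H2]; split.
  by apply: cmeasD => //; apply: cmeasM => //; exact: cmeas_cst.
move=> psi Spsi; have [i1 e1] := H1 _ Spsi; have [i2 e2] := H2 _ Spsi.
have iz2 := @cintegrableZl _ TR _ leb _ measurableT z _ i2.
have ipsi := cintegrable_fourier Spsi.
have mpsi := cmeas_fourier (cmeas_schwartz Spsi).
have if1 := cintegrable_bounded_mul mf bf mpsi ipsi.
have ig1 := cintegrable_bounded_mul mg bg mpsi ipsi.
have izg := @cintegrableZl _ TR _ leb _ measurableT z _ ig1.
split.
  apply: (@eq_cintegrable _ TR _ _ _ measurableT (fun w => h1 w * psi w + z * (h2 w * psi w))).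
    by move=> w _; ring.
  exact: (@cintegrableD _ TR).
rewrite /distr.
transitivity (cint leb setT (fun t => f t * fourier psi t + z * (g t * fourier psi t))).
  by apply: eq_cint => t _; ring.
rewrite (@cintD _ TR _ leb _ measurableT _ _ if1 izg) (@cintZl _ TR _ leb _ measurableT _ _ ig1).
rewrite -/(distr f _) -/(distr g _) e1 e2 /distr.
rewrite -(@cintZl _ TR _ leb _ measurableT _ _ i2) -(@cintD _ TR _ leb _ measurableT _ _ i1 iz2).
by apply: eq_cint => t _; ring.
Qed.

End FourierIsFun.

Section KernelTransform.
Context {R : realType}.
Local Notation leb := (@lebesgue_measure R).
Local Notation TR := (measurableTypeR R).
Variable K : R -> \bar R.
Hypotheses (Kv : kernel_valued K) (KI : kernel_I K) (KII : kernel_II K).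
Local Notation k := (kreal K).

Let cmeas_ind (D : set TR) : measurable D -> cmeasurable (fun w : TR => (\1_D w : R)%:C : R[i]).
Proof. by move=> mD; apply: cmeasR; exact: measurable_indic. Qed.

Lemma cmeas_ktrunc b : cmeasurable (ktrunc K b).
Proof.
apply: (@cmeas_cint _ _ TR TR R leb) => //.
apply: cmeasM.
  by apply: (@cmeas_snd _ _ TR TR R (fun s => (k s)%:C)); apply: cmeasR; exact: measurable_kreal.
apply: cmeas_cis; apply: measurable_funM.
  exact: measurable_snd.
exact: measurable_fst.
Qed.

Let i0 (w : R) : R[i] := (\1_(~` [set (0 : TR)] : set TR) w : R)%:C.

Let cmeas_neq0 : cmeasurable i0.
Proof. by apply: cmeas_ind; apply: measurableC; exact: measurable_set1. Qed.

Let ind_neq0 (w : R) : w != 0 -> i0 w = 1 :> R[i].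
Proof. by move=> w0; rewrite /i0 indicE mem_set//=; exact/eqP. Qed.

Let ind_0 : i0 0 = 0 :> R[i].
Proof. by rewrite /i0 indicE memNset//=; apply. Qed.

Let ktrunc_neq0_cvg w : ccvg (fun n => ktrunc K n%:R w * i0 w)
   (khat K w * i0 w).
Proof.
have [->|w0] := eqVneq w 0.
  by rewrite ind_0 mulr0; under eq_fun do rewrite mulr0; exact: ccvg_cst.
by apply: ccvgM; [exact: ktrunc_cvg|exact: ccvg_cst].
Qed.

(** Nothing is known of the improper integrals at the origin, so the limit of
    the truncated transforms is taken off the origin, where they are
    multiplied by 1, and the value at the origin is restored by hand. *)
Lemma cmeas_khat : cmeasurable (khat K).
Proof.
apply: (@cmeasE _ _ _ (fun w => khat K w * i0 w +
  khat K 0 * (1 - i0 w))).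
  apply: cmeasD.
    apply: (cmeas_lim _ ktrunc_neq0_cvg) => n.
    by apply: (@cmeasM _ TR) => //; exact: cmeas_ktrunc.
  apply: cmeasM; first exact: cmeas_cst.
  by apply: cmeasB; [exact: cmeas_cst|].
move=> w; have [->|w0] := eqVneq w 0; first by rewrite ind_0; ring.
by rewrite (ind_neq0 w0); ring.
Qed.

Lemma khat_bound : exists D beta : R, [/\ 0 <= D, 0 < beta < 1,
  forall w, cmod (khat K w) <= D * (1 + `|w| `^ (- beta)) &
  forall b w, w != 0 -> cmod (ktrunc K b w) <= D * (1 + `|w| `^ (- beta))].
Proof.
have [D [beta [D0 b01 H]]] := ktrunc_bound Kv KI KII.
exists (Num.max D (cmod (khat K 0))), beta.
have W w : 0 <= 1 + `|w| `^ (- beta) by rewrite addr_ge0// powR_ge0.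
have H' b w : w != 0 -> cmod (ktrunc K b w) <= Num.max D (cmod (khat K 0)) * (1 + `|w| `^ (- beta)).
  by move=> w0; rewrite (le_trans (H b w w0))// ler_wpM2r// le_max lexx.
split => //; first by rewrite le_max D0.
move=> w; have [->|w0] := eqVneq w 0.
  apply: (@le_trans _ _ (Num.max D (cmod (khat K 0)))); first by rewrite le_max lexx orbT.
  by rewrite ler_peMr ?le_max ?D0// lerDl powR_ge0.
by apply: (ccvg_bound (ktrunc_cvg Kv KI w0)) => n; exact: H'.
Qed.

(** Near the origin [psi] is bounded and [|w|^-beta] is integrable; away from
    it [|w|^-beta] is bounded by 1 and [psi] is integrable. *)
Lemma integrable_singular_bound (D beta C : R) psi : 0 <= D -> 0 < beta < 1 -> cmeasurable psi ->
  cintegrable leb setT psi -> (forall w, cmod (psi w) <= C) ->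
  leb.-integrable setT (EFin \o (fun w => D * (1 + `|w| `^ (- beta)) * cmod (psi w))).
Proof.
move=> D0 b01 mpsi ipsi bpsi; have C0 : 0 <= C := le_trans (cmod_ge0 _) (bpsi 0).
apply: (@le_integrable _ TR _ leb setT measurableT _ (EFin \o (fun w => (2 * D) * cmod (psi w) + (D * C) * (`|w| `^ (- beta) * \1_(`[-1, 1]%classic : set R) w)))).
- apply/measurable_EFinP; apply: measurable_funM; last exact: cmeas_cmod.
  apply: measurable_funM => //; apply: measurable_funD => //.
  by apply: (measurableT_comp (measurable_powR _)); exact: normr_measurable.
- move=> w _; rewrite /= lee_fin.
  have W0 : 0 <= `|w| `^ (- beta) by rewrite powR_ge0.
  have c0 := cmod_ge0 (psi w).
  rewrite ger0_norm; last by rewrite !mulr_ge0// addr_ge0.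
  rewrite [leRHS]ger0_norm; last first.
    by rewrite addr_ge0// !mulr_ge0// indicE; case: (_ \in _).
  have [w1|w1] := boolP (w \in (`[-1, 1]%classic : set R)).
    rewrite indicE w1 mulr1 mulrDr mulr1 mulrDl lerD//.
      by rewrite ler_wpM2r// ler_peMl// ler1n.
    by rewrite -!mulrA ler_wpM2l// mulrC ler_wpM2r.
  rewrite indicE (negbTE w1) mulr0 mulr0 addr0 ler_wpM2r// mulrC ler_wpM2r//.
  rewrite -[leRHS]/(1 + 1) lerD2l -(powRr0 `|w|) ler_powR//; last by case/andP: b01; lra.
  by move: w1; rewrite notin_setE /= in_itv /= => /negP; rewrite -ler_norml -ltNge => /ltW.
- under [X in integrable _ _ X]funext do rewrite /= EFinD EFinM (EFinM (D * C)).
  apply: integrableD => //.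
    by apply: integrableZl => //; exact: (cintegrable_cmod measurableT ipsi).
  by apply: integrableZl => //; exact: integrable_powR_near0.
Qed.

(** The correlation of a test function with the causal kernel: the memory term
    of the equation, moved onto the test function. *)
Definition memory (phi : R -> R[i]) (t : R) : R[i] := cint leb `[0, +oo[ (fun s => (k s)%:C * phi (t + s)).

Let memN (b : R) (phi : R -> R[i]) (t : R) : R[i] := cint leb `[0, b] (fun s => (k s)%:C * phi (t + s)).

Let cmeas_pair phi : cmeasurable phi ->
  cmeasurable (fun z : TR * TR => (k z.2)%:C * phi (z.1 + z.2)).
Proof.
move=> mphi; apply: cmeasM.
  by apply: (@cmeas_snd _ _ TR TR R (fun s => (k s)%:C)); apply: cmeasR; exact: measurable_kreal.
have mD : measurable_fun setT (fun z : TR * TR => (z.1 + z.2 : TR)).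
  by apply: measurable_funD; [exact: measurable_fst|exact: measurable_snd].
split; first exact: (measurableT_comp mphi.1 mD).
exact: (measurableT_comp mphi.2 mD).
Qed.

Lemma cmeas_memory phi : cmeasurable phi -> cmeasurable (memory phi).
Proof.
by move=> mphi; apply: (@cmeas_cint _ _ TR TR R leb); [|exact: cmeas_pair].
Qed.

Let cmeas_memN b phi : cmeasurable phi -> cmeasurable (memN b phi).
Proof.
by move=> mphi; apply: (@cmeas_cint _ _ TR TR R leb); [|exact: cmeas_pair].
Qed.

(** The kernel is split at a point [M] from which on it decreases: on [[0, M]]
    it is integrable and [phi] is bounded, beyond [M] it is bounded and [phi]
    is integrable. By translation invariance the resulting bound does not
    depend on [t]. *)
Lemma memory_cvg_bound phi : schwartz phi -> exists B : R,
  [/\ forall t, ccvg (fun n => memN n%:R phi t) (memory phi t),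
      forall n t, cmod (memN n%:R phi t) <= B & forall t, cmod (memory phi t) <= B].
Proof.
move=> Sphi; have mphi := cmeas_schwartz Sphi; have iphi := cintegrable_schwartz Sphi.
have [C bC] := schwartz_bounded Sphi; have C0 : 0 <= C := le_trans (cmod_ge0 _) (bC 0).
have [M M1 kd] := kreal_decr Kv KI.
have kM0 : 0 <= k M by rewrite ltW// kreal_gt0// gt_eqF//; lra.
have mM : measurable (`[0, M]%classic : set TR) by exact: measurable_itv.
(* only integrability is known of the kernel on [[0, M]], where it may be
   unbounded *)
pose kM s := `|k s| * \1_(`[0, M]%classic : set TR) s.
have ikM : leb.-integrable setT (EFin \o kM).
  have -> : EFin \o kM = (EFin \o (fun s => `|k s|)) \_ (`[0, M]%classic : set TR).
    by apply/funext => s; rewrite /= patchE /kM indicE; case: ifP => _; rewrite ?mulr1 ?mulr0.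
  by apply/(integrable_mkcond _ mM); exact: (integrable_norm (integrable_kreal KI M)).
pose g t s := C * kM s + k M * cmod (phi (s + t)).
have iphit t : leb.-integrable setT (EFin \o (fun s => cmod (phi (s + t)))).
  by apply: (@integrable_translate _ (fun s => cmod (phi s)) t); exact: (cintegrable_cmod measurableT iphi).
have ig t : leb.-integrable setT (EFin \o g t).
  under [X in integrable _ _ X]funext do rewrite /= EFinD EFinM (EFinM (k M)).
  by apply: integrableD => //; apply: integrableZl => //; exact: iphit.
have fE (D : set TR) t : cint leb D (fun s => (k s)%:C * phi (t + s)) =
    cint leb setT (fun s => (k s)%:C * phi (t + s) * (\1_D s)%:C) by exact: cint_mkcond.
have bound (D : set TR) t s : D `<=` `[0, +oo[ -> cmod ((k s)%:C * phi (t + s) * (\1_D s)%:C) <= g t s.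
  move=> D0; have kMs0 : 0 <= kM s by rewrite /kM mulr_ge0// indicE; case: (_ \in _).
  have cp := cmod_ge0 (phi (s + t)).
  have g0 : 0 <= g t s by rewrite /g addr_ge0// mulr_ge0.
  rewrite !cmodM !cmodR indicE; have [Ds|] := boolP (s \in D); last by rewrite normr0 mulr0.
  rewrite normr1 mulr1 (addrC t); have : (`[0, +oo[%classic : set R) s by apply: D0; rewrite inE in Ds.
  rewrite /= in_itv /= andbT => s0.
  have [sM|Ms] := leP s M.
    rewrite /g /kM indicE mem_set /=; last by rewrite in_itv /= s0.
    rewrite mulr1 (mulrC C); apply: (@le_trans _ _ (`|k s| * C)); first exact: ler_wpM2l.
    by rewrite lerDl mulr_ge0.
  rewrite ler_wpDl ?mulr_ge0// ler_wpM2r// ger0_norm; last by rewrite ltW// kreal_gt0// gt_eqF//; lra.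
  by apply: kd => //; exact: ltW.
have mint (D : set TR) t : measurable D -> cmeasurable (fun s : TR => (k s)%:C * phi (t + s) * (\1_D s : R)%:C).
  move=> mD; apply: cmeasM; last exact: cmeas_ind.
  apply: cmeasM; first by apply: cmeasR; exact: measurable_kreal.
  have mt : measurable_fun setT (fun s : TR => (t + s : TR)) by exact: measurable_funD.
  by split; [exact: (measurableT_comp mphi.1 mt)|exact: (measurableT_comp mphi.2 mt)].
have i0oo : `[0, +oo[%classic `<=` (`[0, +oo[%classic : set R) by [].
have i0n b : `[0, b]%classic `<=` (`[0, +oo[%classic : set R).
  by move=> s; rewrite /= !in_itv /= andbT => /andP[].
have mi (i : interval R) : measurable ([set` i] : set TR) by exact: measurable_itv.
pose B : R := C * Rintegral leb setT kM + k M * Rintegral leb setT (fun s => cmod (phi s)).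
have intg t : Rintegral leb setT (g t) = B.
  rewrite /B -(@Rintegral_translate _ (fun s => cmod (phi s)) t); last exact: cmeas_cmod.
  have i1 : leb.-integrable setT (EFin \o (fun s => C * kM s)).
    by under [X in integrable _ _ X]funext do rewrite /= EFinM; exact: integrableZl.
  have i2 : leb.-integrable setT (EFin \o (fun s => k M * cmod (phi (s + t)))).
    by under [X in integrable _ _ X]funext do rewrite /= EFinM; apply: integrableZl => //; exact: iphit.
  by rewrite /g RintegralD//; congr (_ + _); rewrite RintegralZl//; exact: iphit.
have le_B (D : set TR) t : measurable D -> D `<=` `[0, +oo[ ->
   cmod (cint leb D (fun s => (k s)%:C * phi (t + s))) <= B.
  move=> mD D0; rewrite fE -(intg t).
  have ci := @cmeas_cintegrable _ TR _ leb _ measurableT _ _ (mint D t mD) (fun s _ => bound D t s D0) (ig t).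
  rewrite (le_trans (@cmod_cint_le _ TR _ _ _ measurableT _ ci))//.
  apply: le_Rintegral => //; [|exact: ig|by move=> s _; exact: bound].
  exact: (cintegrable_cmod measurableT ci).
exists B; split; last 2 first.
- by move=> n t; apply: le_B.
- by move=> t; apply: le_B.
move=> t; rewrite /memN /memory fE; under eq_fun do rewrite fE.
apply: (@cdominated _ TR _ leb _ measurableT _ _ (g t) _ _ _ (ig t) _).2.
- by move=> n; exact: mint.
- exact: mint.
- apply: aeW => s _; apply: ccvgM; first exact: ccvg_cst.
  apply: ccvgR; apply: cvg_near_cst; near=> n.
  rewrite !indicE; congr (_%:R); congr nat_of_bool; apply/idP/idP; rewrite !inE /= !in_itv /= ?andbT.
    by case/andP.
  move=> -> /=; near: n; exact: nbhs_infty_ger.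
- by move=> n s _; exact: bound.
Unshelve. all: by end_near.
Qed.

Let memN_fourier (b : R) phi psi : schwartz phi -> schwartz psi ->
  cint leb setT (fun t => memN b phi t * fourier psi t) =
  cint leb setT (fun w => ktrunc K b w * (fourier phi w * psi w)).
Proof.
move=> Sphi Spsi; have mphi := cmeas_schwartz Sphi; have iphi := cintegrable_schwartz Sphi.
have mpsi := cmeas_schwartz Spsi; have ipsi := cintegrable_schwartz Spsi.
have [C bC] := schwartz_bounded Sphi; have C0 : 0 <= C := le_trans (cmod_ge0 _) (bC 0).
have mb : measurable (`[0, b]%classic : set TR) by exact: measurable_itv.
pose kb (s : TR) : R[i] := (k s)%:C * (\1_(`[0, b]%classic : set TR) s : R)%:C.
have mkb : cmeasurable kb.
  by apply: cmeasM; [apply: cmeasR; exact: measurable_kreal|exact: cmeas_ind].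
have ikb : leb.-integrable setT (EFin \o (fun s => cmod (kb s))).
  have -> : EFin \o (fun s => cmod (kb s)) = (EFin \o (fun s => `|k s|)) \_ (`[0, b]%classic : set TR).
    have kbE s : cmod (kb s) = `|k s| * \1_(`[0, b]%classic : set TR) s.
      by rewrite /kb cmodM !cmodR indicE (ger0_norm (ler0n _ _)).
    apply/funext => s; rewrite patchE /comp kbE indicE.
    by case: ifP => _; rewrite ?mulr1 ?mulr0.
  by apply/(integrable_mkcond _ mb); exact: (integrable_norm (integrable_kreal KI b)).
have kbd s : kb s = (k s)%:C * (\1_(`[0, b]%classic : set TR) s : R)%:C by [].
clearbody kb.
have mfpsi := cmeas_fourier mpsi; have ifpsi := cintegrable_fourier Spsi.
have mfphi := cmeas_fourier mphi.
have bfphi w := cmod_fourier_le w mphi iphi.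
have ip := @cintegrable_bounded_mul _ _ _ _ mfphi bfphi mpsi ipsi.
have mp : cmeasurable (fun w => fourier phi w * psi w) by apply: cmeasM.
have mphis (s : R) : cmeasurable (fun t : TR => phi (t + s)).
  have mt : measurable_fun setT (fun t : TR => (t + s : TR)) by exact: measurable_funD.
  by split; [exact: (measurableT_comp mphi.1 mt)|exact: (measurableT_comp mphi.2 mt)].
have mphit (t : R) : cmeasurable (fun s : TR => phi (t + s)).
  have mt : measurable_fun setT (fun s : TR => (t + s : TR)) by exact: measurable_funD.
  by split; [exact: (measurableT_comp mphi.1 mt)|exact: (measurableT_comp mphi.2 mt)].
have iphis (s : R) := cintegrable_translate s iphi.
pose F (t s : TR) := fourier psi t * (kb s * phi (t + s)).
transitivity (cint leb setT (fun t => cint leb setT (F t))).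
  apply: eq_cint => t _; rewrite /memN cint_mkcond mulrC.
  have it : cintegrable leb setT (fun s => kb s * phi (t + s)).
    apply: (@cmeas_cintegrable _ TR _ leb _ measurableT _ (fun s => C * cmod (kb s))).
    - by apply: (@cmeasM _ TR).
    - by move=> s _; rewrite cmodM mulrC ler_wpM2r// cmod_ge0.
    - by under [X in integrable _ _ X]funext do rewrite /= EFinM; exact: integrableZl.
  rewrite /F (@cintZl _ TR _ leb _ measurableT _ _ it); congr (_ * _).
  by apply: eq_cint => s _; rewrite kbd; ring.
rewrite (@cFubini _ _ TR TR R leb leb F (fun t => C * cmod (fourier psi t)) (fun s => cmod (kb s))); first last.
- move=> t s; rewrite /F !cmodM (mulrC (cmod (kb s))) mulrA.
  by rewrite ler_wpM2r ?cmod_ge0// mulrC ler_wpM2r ?cmod_ge0.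
- by move=> s; exact: cmod_ge0.
- by move=> t; rewrite mulr_ge0// cmod_ge0.
- exact: ikb.
- under [X in integrable _ _ X]funext do rewrite /= EFinM.
  by apply: integrableZl => //; exact: (cintegrable_cmod measurableT ifpsi).
- apply: cmeasM; first exact: (@cmeas_fst _ _ TR TR R _ mfpsi).
  apply: cmeasM; first exact: (@cmeas_snd _ _ TR TR R _ mkb).
  have mD : measurable_fun setT (fun z : TR * TR => (z.1 + z.2 : TR)).
    by apply: measurable_funD; [exact: measurable_fst|exact: measurable_snd].
  split; first exact: (measurableT_comp mphi.1 mD).
  exact: (measurableT_comp mphi.2 mD).
pose G (s w : TR) := kb s * cis (s * w) * (fourier phi w * psi w).
transitivity (cint leb setT (fun s => cint leb setT (G s))).
  apply: eq_cint => s _.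
  transitivity (kb s * cint leb setT (fun t => phi (t + s) * fourier psi t)).
    rewrite -(@cintZl _ TR _ leb _ measurableT); last first.
      exact: (@cintegrable_bounded_mul _ _ _ C (mphis s) (fun t => bC (t + s)) mfpsi ifpsi).
    by apply: eq_cint => t _; rewrite /F; ring.
  rewrite (fourier_mult (mphis s) (iphis s) mpsi ipsi).
  rewrite -(@cintZl _ TR _ leb _ measurableT); last first.
    apply: (@cintegrable_bounded_mul _ _ _ (Rintegral leb setT (fun t => cmod (phi t)))) => //.
      exact: (cmeas_fourier (mphis s)).
    by move=> w; rewrite fourier_translate// cmodM cmod_cis mul1r.
  by apply: eq_cint => w _; rewrite /G fourier_translate//; ring.
rewrite (@cFubini _ _ TR TR R leb leb G (fun s => cmod (kb s)) (fun w => cmod (fourier phi w * psi w))); first last.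
- by move=> s w; rewrite /G !cmodM cmod_cis mulr1.
- by move=> w; exact: cmod_ge0.
- by move=> s; exact: cmod_ge0.
- exact: (cintegrable_cmod measurableT ip).
- exact: ikb.
- apply: cmeasM; last exact: (@cmeas_snd _ _ TR TR R _ mp).
  apply: cmeasM; first exact: (@cmeas_fst _ _ TR TR R _ mkb).
  apply: cmeas_cis; apply: measurable_funM; first exact: measurable_fst.
  exact: measurable_snd.
apply: eq_cint => w _; rewrite mulrC /ktrunc cint_mkcond.
have iw : cintegrable leb setT (fun s => kb s * cis (s * w)).
  apply: (@cmeas_cintegrable _ TR _ leb _ measurableT _ (fun s => cmod (kb s))) => //.
  - by apply: (@cmeasM _ TR) => //; apply: cmeas_cis; exact: measurable_funM.
  - by move=> s _; rewrite cmodM cmod_cis mulr1.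
transitivity (fourier phi w * psi w * cint leb setT (fun s => kb s * cis (s * w))).
  by rewrite -(@cintZl _ TR _ leb _ measurableT _ _ iw); apply: eq_cint => s _; rewrite /G; ring.
by congr (_ * _); apply: eq_cint => s _; rewrite kbd; ring.
Qed.

(** The kernel truncated to [[0, n]] is integrable, so that for it this is
    Fubini; the singularity [|w|^-beta] left in the limit is integrable. *)
Lemma memory_fourier_is_fun phi : schwartz phi ->
  fourier_is_fun (distr (memory phi)) (fun w => khat K w * fourier phi w).
Proof.
move=> Sphi; have mphi := cmeas_schwartz Sphi; have iphi := cintegrable_schwartz Sphi.
have mfphi := cmeas_fourier mphi.
split; first by apply: cmeasM => //; exact: cmeas_khat.
move=> psi Spsi; have mpsi := cmeas_schwartz Spsi; have ipsi := cintegrable_schwartz Spsi.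
have mfpsi := cmeas_fourier mpsi; have ifpsi := cintegrable_fourier Spsi.
have bfphi w := cmod_fourier_le w mphi iphi.
have ip := @cintegrable_bounded_mul _ _ _ _ mfphi bfphi mpsi ipsi.
have mp : cmeasurable (fun w => fourier phi w * psi w) by apply: cmeasM.
have [C bC] := schwartz_bounded Spsi.
have bp w : cmod (fourier phi w * psi w) <= Rintegral leb setT (fun t => cmod (phi t)) * C.
  by rewrite cmodM ler_pM ?cmod_ge0.
have [D [beta [D0 b01 bk bkn]]] := khat_bound.
have ib := integrable_singular_bound D0 b01 mp ip bp.
have ik : cintegrable leb setT (fun w => khat K w * fourier phi w * psi w).
  apply: (@cmeas_cintegrable _ TR _ leb _ measurableT _ _ _ _ ib).
    by apply: cmeasM => //; apply: cmeasM => //; exact: cmeas_khat.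
  by move=> w _; rewrite -mulrA cmodM ler_wpM2r// cmod_ge0.
split => //; have [B [cB bnB bB]] := memory_cvg_bound Sphi.
have l1 : ccvg (fun n => cint leb setT (fun t => memN n%:R phi t * fourier psi t))
    (distr (memory phi) (fourier psi)).
  apply: (@cdominated _ TR _ leb _ measurableT _ _ (fun t => B * cmod (fourier psi t)) _ _ _ _ _).2.
  - by move=> n; apply: (@cmeasM _ TR) => //; exact: cmeas_memN.
  - by apply: (@cmeasM _ TR) => //; exact: cmeas_memory.
  - by apply: aeW => t _; apply: ccvgM; [exact: cB|exact: ccvg_cst].
  - under [X in integrable _ _ X]funext do rewrite /= EFinM.
    by apply: integrableZl => //; exact: (cintegrable_cmod measurableT ifpsi).
  - by move=> n t _; rewrite cmodM ler_wpM2r// cmod_ge0.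
apply: (ccvg_unique l1).
have -> : distr (fun w => khat K w * fourier phi w) psi =
    cint leb setT (fun w => khat K w * i0 w * (fourier phi w * psi w)).
  apply: eq_cint_neq0.
  - by apply: cmeasM => //; apply: cmeasM => //; exact: cmeas_khat.
  - by apply: cmeasM => //; apply: cmeasM => //; exact: cmeas_khat.
  - by move=> w w0; rewrite (ind_neq0 w0); ring.
have e n : cint leb setT (fun t => memN n%:R phi t * fourier psi t) =
    cint leb setT (fun w => ktrunc K n%:R w * i0 w * (fourier phi w * psi w)).
  rewrite memN_fourier//; apply: eq_cint_neq0.
  - by apply: cmeasM => //; exact: cmeas_ktrunc.
  - by apply: cmeasM => //; apply: cmeasM => //; exact: cmeas_ktrunc.
  - by move=> w w0; rewrite (ind_neq0 w0); ring.
under eq_fun do rewrite e.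
apply: (@cdominated _ TR _ leb _ measurableT _ _ _ _ _ _ ib _).2.
- by move=> n; apply: (@cmeasM _ TR) => //; apply: (@cmeasM _ TR) => //; exact: cmeas_ktrunc.
- by apply: (@cmeasM _ TR) => //; apply: (@cmeasM _ TR) => //; exact: cmeas_khat.
- by apply: aeW => w _; apply: ccvgM; [exact: ktrunc_neq0_cvg|exact: ccvg_cst].
- move=> n w _; rewrite cmodM ler_wpM2r ?cmod_ge0//.
  have [->|w0] := eqVneq w 0; last by rewrite (ind_neq0 w0) mulr1 bkn.
  by rewrite ind_0 mulr0 cmod0 mulr_ge0// addr_ge0// powR_ge0.
Qed.

End KernelTransform.

(** * Domains of the stationary operators *)

Section SpectralDomain.
Context {R : realType}.
Local Notation leb := (@lebesgue_measure R).
Local Notation TR := (measurableTypeR R).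
Variable nu : @matrix_data R.
Hypothesis nu_spectral : spectral_measure nu.

Lemma ord2P (i : 'I_2) : i = ord0 \/ i = ord_max.
Proof. by case: i => [[|[|]]]//= h; [left|right]; exact: val_inj. Qed.

Lemma integral_diag_le (f : TR -> R) i : (forall w, 0 <= f w) -> measurable_fun setT f ->
  (\int[diag_measure nu i]_w (f w)%:E <= \int[norm_measure nu]_w (f w)%:E)%E.
Proof.
move=> f0 mf; have mf' : measurable_fun setT (EFin \o f) by exact/measurable_EFinP.
rewrite /norm_measure ge0_integral_measure_add//; last by move=> w _; rewrite lee_fin.
have i0 j : (0 <= \int[diag_measure nu j]_w (f w)%:E)%E.
  by apply: integral_ge0 => w _; rewrite lee_fin.
by case: (ord2P i) => ->; [rewrite leeDl|rewrite leeDr].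
Qed.

(** Rapid decrease absorbs the polynomial growth of the spectral measure. *)
Lemma L2_rapid (f : R -> R[i]) i : cmeasurable f ->
  (forall n, exists C : R, forall w, cmod (f w) <= C / (1 + w ^+ 2) ^+ n) ->
  L2 (diag_measure nu i) f.
Proof.
move=> mf bf; split => //; have [_ _ [p ip]] := nu_spectral.
(* [p] is the exponent of the temperedness condition *)
pose n := (Num.truncn `|p|).+1.
have pn : p <= n%:R by rewrite (le_trans (ler_norm p))// ltW// /n truncnS_gt.
have [C bC] := bf n.
have w1 (w : R) : 1 <= 1 + w ^+ 2 by rewrite lerDl sqr_ge0.
have mg : measurable_fun [set: TR] (fun w : TR => (1 + w ^+ 2) `^ (- p)).
  apply: (measurableT_comp (measurable_powR _)).
  by apply: measurable_funD => //; exact: measurable_funX.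
have mfs : measurable_fun [set: TR] (fun w : TR => cmod (f w) ^+ 2).
  by apply: measurable_funX; exact: (@cmeas_cmod _ TR).
apply: (@le_lt_trans _ _ (\int[diag_measure nu i]_w ((C ^+ 2) * (1 + w ^+ 2) `^ (- p))%:E)%E).
  apply: ge0_le_integral => //.
  - by move=> w _; rewrite lee_fin sqr_ge0.
  - by apply/measurable_EFinP.
  - by apply/measurable_EFinP; apply: measurable_funM.
  - move=> w _; rewrite lee_fin.
    have w0 : 0 < 1 + w ^+ 2 by rewrite (lt_le_trans ltr01).
    apply: (@le_trans _ _ ((C / (1 + w ^+ 2) ^+ n) ^+ 2)).
      by rewrite lerXn2r// nnegrE ?cmod_ge0// (le_trans (cmod_ge0 _) (bC w)).
    have w1w := w1 w; move: w0 w1w; set x := 1 + w ^+ 2 => w0 w1w.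
    rewrite exprMn ler_wpM2l ?sqr_ge0// exprVn -exprM -powR_mulrn ?(ltW w0)// -powRN.
    by apply: ler_powR => //; rewrite lerN2 (le_trans pn)// ler_nat leq_pmulr.
under eq_integral do rewrite EFinM.
rewrite ge0_integralZl_EFin ?sqr_ge0//; first last.
- exact/measurable_EFinP.
- by move=> w _; rewrite lee_fin powR_ge0.
apply: lte_mul_pinfty; rewrite ?lee_fin ?sqr_ge0//.
apply: le_lt_trans ip; apply: integral_diag_le => //.
by move=> w; rewrite powR_ge0.
Qed.

Lemma L2_fourier phi i : schwartz phi -> L2 (diag_measure nu i) (fourier phi).
Proof.
move=> Sphi; apply: L2_rapid; first exact: (cmeas_fourier (cmeas_schwartz Sphi)).
by move=> n; exact: fourier_decay.
Qed.

Lemma L2_deriv_fourier phi i : schwartz phi ->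
  L2 (diag_measure nu i) (fun w => - ('i * w%:C) * fourier phi w).
Proof.
move=> Sphi; apply: L2_rapid.
  apply: cmeasM; last exact: (cmeas_fourier (cmeas_schwartz Sphi)).
  by apply: cmeasN; apply: cmeasM; [exact: cmeas_cst|apply: cmeasR; exact: measurable_id].
move=> n; have [C bC] := fourier_decay n.+1 Sphi; exists C => w.
have w0 : 0 < 1 + w ^+ 2 by rewrite ltr_pwDl// sqr_ge0.
rewrite cmodM cmodN cmodM cmodi mul1r cmodR.
apply: (@le_trans _ _ ((1 + w ^+ 2) * (C / (1 + w ^+ 2) ^+ n.+1))).
  apply: ler_pM => //; first exact: cmod_ge0.
  rewrite -(real_normK (num_real w)); have := sqr_ge0 (`|w| - 1); have := normr_ge0 w.
  by move: `|w| => x; nra.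
move: w0; set x := 1 + w ^+ 2 => w0.
by rewrite exprS invfM mulrCA mulVKf ?gt_eqF.
Qed.

Lemma in_domain_L1 f (B : R) i : cmeasurable f -> cintegrable leb setT f ->
  (forall t, cmod (f t) <= B) -> L2 (diag_measure nu i) (fourier f) ->
  in_domain nu i (distr f) (fourier f).
Proof.
by move=> mf jf bf Lf; split; [exact: tempered_distr mf bf|exact: fourier_is_fun_L1|].
Qed.

Lemma in_domain_schwartz phi i : schwartz phi -> in_domain nu i (distr phi) (fourier phi).
Proof.
move=> Sphi; have [B bB] := schwartz_bounded Sphi.
apply: in_domain_L1 bB _; [exact: cmeas_schwartz|exact: cintegrable_schwartz|exact: L2_fourier].
Qed.

Lemma in_domain_scale z phi i : schwartz phi ->
  in_domain nu i (distr (fun t => z * phi t)) (fun w => z * fourier phi w).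
Proof.
move=> Sphi; have [B bB] := schwartz_bounded Sphi.
have mphi := cmeas_schwartz Sphi; have iphi := cintegrable_schwartz Sphi.
have E : fourier (fun t => z * phi t) = (fun w => z * fourier phi w).
  by apply/funext => w; rewrite fourierZ.
rewrite -E; apply: (@in_domain_L1 _ (cmod z * B)).
- by apply: cmeasM => //; exact: cmeas_cst.
- exact: (@cintegrableZl _ TR _ leb _ measurableT).
- by move=> t; rewrite cmodM ler_wpM2l ?cmod_ge0.
- by rewrite E; apply: L2Z; exact: L2_fourier.
Qed.

Lemma in_domain_opp_deriv phi i : schwartz phi ->
  in_domain nu i (distr (opp_deriv phi)) (fun w => - ('i * w%:C) * fourier phi w).
Proof.
move=> Sphi; have [C bC] := schwartz_decay 0 1 Sphi.
have E : fourier (opp_deriv phi) = (fun w => - ('i * w%:C) * fourier phi w).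
  by apply/funext => w; rewrite fourier_opp_deriv.
rewrite -E; apply: (@in_domain_L1 _ C).
- exact: cmeas_opp_deriv.
- exact: cintegrable_opp_deriv.
- by move=> t; rewrite cmodN; have := bC t; rewrite expr0 mul1r.
- by rewrite E; exact: L2_deriv_fourier.
Qed.

Section Drift.
Variables (m lambda beta : R) (K : R -> \bar R).
Hypotheses (Kv : kernel_valued K) (KI : kernel_I K) (KII : kernel_II K).

(** Fourier multiplier of the adjoint drift operator [Psi]. *)
Definition drift (w : R) : R[i] :=
  - (m%:C * ('i * w%:C)) + lambda%:C + beta%:C * khat K w.

Lemma cmeas_drift : cmeasurable drift.
Proof.
apply: cmeasD; first apply: cmeasD.
- apply: cmeasN; apply: cmeasM; first exact: cmeas_cst.
  by apply: cmeasM; [exact: cmeas_cst|apply: cmeasR; exact: measurable_id].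
- exact: cmeas_cst.
- by apply: cmeasM; [exact: cmeas_cst|exact: cmeas_khat].
Qed.

Let local_part phi (t : R) := - m%:C * cderiven 1 phi t + lambda%:C * phi t.

Let cmeas_local phi : schwartz phi -> cmeasurable (local_part phi).
Proof.
move=> Sphi; apply: cmeasD; apply: cmeasM; try exact: cmeas_cst.
  exact: cmeas_cderiven.
exact: cmeas_schwartz.
Qed.

Let local_bounded phi : schwartz phi -> exists B : R, forall t, cmod (local_part phi t) <= B.
Proof.
move=> Sphi; have [C1 b1] := schwartz_decay 0 1 Sphi; have [C0 b0] := schwartz_bounded Sphi.
exists (cmod (- m%:C) * C1 + cmod lambda%:C * C0) => t.
rewrite (le_trans (cmodD _ _))// !cmodM lerD// ler_wpM2l ?cmod_ge0//.
by have := b1 t; rewrite expr0 mul1r.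
Qed.

Lemma Psi_fourier_is_fun phi : schwartz phi ->
  fourier_is_fun (distr (Psi m lambda beta K phi)) (fun w => drift w * fourier phi w).
Proof.
move=> Sphi; have [B [_ _ bB]] := memory_cvg_bound Kv KI Sphi.
have [B' bB'] := local_bounded Sphi; have mphi := cmeas_schwartz Sphi.
have ml := cmeas_local Sphi; have iphi := cintegrable_schwartz Sphi.
have i1 := @cintegrableZl _ TR _ leb _ measurableT (- m%:C) _ (cintegrable_cderiven 1 Sphi).
have i2 := @cintegrableZl _ TR _ leb _ measurableT (lambda%:C) _ iphi.
have il : cintegrable leb setT (local_part phi) by exact: (@cintegrableD _ TR _ leb _ measurableT _ _ i1 i2).
have fl := fourier_is_fun_L1 ml il.
have mm := cmeas_memory KI mphi.
have := fourier_is_funD (beta%:C) ml bB' mm bB fl (memory_fourier_is_fun Kv KI KII Sphi).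
congr (fourier_is_fun _ _).
apply/funext => w; rewrite /local_part.
have m1 : cmeasurable (cderiven 1 phi) by exact: cmeas_cderiven.
have c1 := cintegrable_cderiven 1 Sphi.
rewrite (@fourierD _ (fun t => - m%:C * cderiven 1 phi t) (fun t => lambda%:C * phi t) w) //; last first.
- by apply: cmeasM => //; exact: cmeas_cst.
- by apply: cmeasM => //; exact: cmeas_cst.
rewrite !fourierZ// fourier_cderiven0// expr1 /drift; ring.
Qed.

Lemma in_domain_Psi phi i : schwartz phi ->
  L2 (diag_measure nu i) (fun w => drift w * fourier phi w) ->
  in_domain nu i (distr (Psi m lambda beta K phi)) (fun w => drift w * fourier phi w).
Proof.
move=> Sphi L; split => //; last exact: Psi_fourier_is_fun.
have [B [_ _ bB]] := memory_cvg_bound Kv KI Sphi.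
have [B' bB'] := local_bounded Sphi; have mphi := cmeas_schwartz Sphi.
apply: (@tempered_distr _ _ (B' + cmod (beta%:C) * B)).
  apply: (cmeasD (cmeas_local Sphi)); apply: cmeasM; [exact: cmeas_cst|exact: cmeas_memory].
move=> t; rewrite (le_trans (cmodD _ _))// lerD//; first exact: bB'.
by rewrite cmodM ler_wpM2l ?cmod_ge0// bB.
Qed.

End Drift.
End SpectralDomain.

(** * Sigma-additive complex set functions *)

Section SigmaAdditive.
Context {R : realType}.
Local Notation leb := (@lebesgue_measure R).
Local Notation TR := (measurableTypeR R).

Lemma sum_nat_eq (j n : nat) : \sum_(0 <= k < n) ((k == j)%:R : R) = (j < n)%:R.
Proof.
elim: n => [|n IH]; first by rewrite big_geq.
rewrite big_nat_recr //= IH; case: (ltngtP j n) => [jn|nj|->].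
- by rewrite ltnS (ltnW jn) addr0.
- by rewrite ltnS leqNgt nj addr0.
- by rewrite ltnS leqnn add0r.
Qed.

Lemma cint_sum (mu : {measure set TR -> \bar R}) (D : set TR) (g : nat -> R -> R[i]) n :
  measurable D -> (forall k, cintegrable mu D (g k)) ->
  cintegrable mu D (fun x => \sum_(0 <= k < n) g k x) /\
  cint mu D (fun x => \sum_(0 <= k < n) g k x) = \sum_(0 <= k < n) cint mu D (g k).
Proof.
move=> mD ig; elim: n => [|n [IH1 IH2]].
  under [X in cintegrable _ _ X]funext do rewrite big_geq//.
  under [X in cint _ _ X]funext do rewrite big_geq//.
  by rewrite big_geq//; split; [exact: (@cintegrable0 _ TR)|exact: (@cint0 _ TR)].
under [X in cintegrable _ _ X]funext do rewrite big_nat_recr//=.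
under [X in cint _ _ X]funext do rewrite big_nat_recr//=.
rewrite big_nat_recr//= -IH2; split; first exact: (@cintegrableD _ TR).
exact: (@cintD _ TR).
Qed.

(** The partial sums are integrals of [f] times the indicator of a finite
    union, and all of these are dominated by [|f|]. *)
Lemma cint_bigcup (mu : {measure set TR -> \bar R}) (E : (set TR)^nat) (f : R -> R[i]) :
  (forall n, measurable (E n)) -> trivIset setT E -> cmeasurable f ->
  cintegrable mu (\bigcup_n E n) f ->
  ccvg (fun n => \sum_(0 <= k < n) cint mu (E k) f) (cint mu (\bigcup_n E n) f).
Proof.
move=> mE tE mf jf; set D := \bigcup_n E n.
have mD : measurable D by exact: bigcup_measurable.
have mI k : cmeasurable (fun x : TR => f x * (\1_(E k) x : R)%:C).
  by apply: (@cmeasM _ TR) => //; apply: cmeasR; exact: measurable_indic.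
have ij k : cintegrable mu D (fun x : TR => f x * (\1_(E k) x : R)%:C).
  apply: (@cmeas_cintegrable _ TR _ mu _ mD _ (fun x => cmod (f x)) (mI k)).
    move=> x _; rewrite cmodM cmodR indicE ger0_norm ?ler0n// ler_piMr ?cmod_ge0//.
    by case: (_ \in _); rewrite ?lexx ?ler01.
  exact: (@cintegrable_cmod _ TR _ mu _ mD).
have cE k : cint mu (E k) f = cint mu D (fun x : TR => f x * (\1_(E k) x : R)%:C).
  rewrite cint_mkcond [RHS]cint_mkcond; apply: eq_cint => x _.
  rewrite -mulrA -rmorphM /= !indicE; congr (_ * _%:C).
  have [xE|] := boolP (x \in E k); last by rewrite mul0r.
  by rewrite mem_set ?mul1r//; exists k => //; rewrite inE in xE.
have e n x j : E j x ->
    \sum_(0 <= k < n) f x * (\1_(E k) x : R)%:C = f x * ((j < n)%:R : R)%:C.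
  move=> xj; rewrite -mulr_sumr -sum_nat_eq rmorph_sum /=; congr (_ * _).
  apply: eq_bigr => k _; rewrite indicE; congr ((_ : bool)%:R%:C).
  apply/idP/eqP => [|->]; last exact: mem_set.
  rewrite inE => xk; have [kj|kj] := eqVneq k j; first exact: kj.
  move/trivIsetP : tE => /(_ k j Logic.I Logic.I kj) /seteqP[/(_ x) h _].
  by case: h.
under eq_fun do under eq_bigr do rewrite cE.
under eq_fun do rewrite -(cint_sum _ mD ij).2.
apply: (@cdominated _ TR _ mu _ mD _ _ (fun x => cmod (f x)) _ mf _ _ _).2.
- elim=> [|n IH].
    by under [X in cmeasurable X]funext do rewrite big_geq//; exact: cmeas_cst.
  under [X in cmeasurable X]funext do rewrite big_nat_recr//=.
  by apply: (@cmeasD _ TR).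
- apply: aeW => x [j _ xj].
  rewrite -[X in ccvg _ X]mulr1 -[1 in X in ccvg _ X]/((1 : R)%:C).
  under eq_fun do rewrite (e _ _ _ xj).
  apply: ccvgM; first exact: ccvg_cst.
  apply: ccvgR; apply: cvg_near_cst; exists j.+1 => // n /= jn.
  by rewrite jn.
- exact: (@cintegrable_cmod _ TR _ mu _ mD).
- move=> n x [j _ xj].
  rewrite (e _ _ _ xj) cmodM cmodR ger0_norm ?ler0n// ler_piMr ?cmod_ge0//.
  by case: (_ < _)%N; rewrite ?lexx ?ler01.
Qed.

(** Countable additivity is required only for sets in [dom], since the entries
    of a spectral measure make sense only on sets of finite mass. *)
Definition sigma_additive_on (dom : set (set TR)) (S : set TR -> R[i]) :=
  forall E : (set TR)^nat, (forall n, measurable (E n)) -> trivIset setT E ->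
    dom (\bigcup_n E n) ->
    ccvg (fun n => \sum_(0 <= k < n) S (E k)) (S (\bigcup_n E n)).

Section Uniqueness.
Variables (dom : set (set TR)).
Hypothesis dom_meas : forall A, dom A -> measurable A.
Hypothesis dom_sub : forall A B, dom A -> measurable B -> B `<=` A -> dom B.
Hypothesis dom_itv : forall a b : R, dom `]a, b]%classic.

Section One.
Variable S : set TR -> R[i].
Hypothesis aS : sigma_additive_on dom S.

Let ccvg_shift (u : nat -> R[i]) z : ccvg u z -> ccvg (fun n => u n.+1) z.
Proof. by rewrite /ccvg => h; rewrite (cvg_shiftS (fun n => cmod (u n - z))). Qed.

Lemma sigma_additive0 A : dom A -> S set0 = 0.
Proof.
move=> dA; have d0 : dom set0 by apply: dom_sub dA _ _.
have := @aS (fun=> set0) (fun=> measurable0) (@trivIset_set0 _ _ _).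
rewrite (bigcup0 (fun _ _ => erefl)) => /(_ d0) h.
have h' := ccvgD h (ccvg_cst (S set0)).
have := ccvg_unique (ccvg_shift h).
under eq_fun do rewrite big_nat_recr//=.
by move=> /(_ _ h') /eqP; rewrite -subr_eq0 opprD addNKr oppr_eq0 => /eqP.
Qed.

Lemma sigma_additiveU A B : measurable A -> measurable B -> A `&` B = set0 ->
  dom (A `|` B) -> S (A `|` B) = S A + S B.
Proof.
move=> mA mB AB dAB.
have := @aS (bigcup2 A B); rewrite bigcup2E => h.
apply: (ccvg_unique (h _ _ dAB)).
- by move=> n; rewrite /bigcup2; case: ifP => // _; case: ifP.
- by rewrite -trivIset_bigcup2.
suff : \forall n \near \oo, \sum_(0 <= k < n) S (bigcup2 A B k) = S A + S B.
  move=> e; apply: (cvg_trans _ (ccvg_cst (S A + S B))); apply: near_eq_cvg.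
  by apply: filterS e => n e; rewrite e.
exists 2%N => // n /= n2; rewrite (@big_cat_nat _ _ _ 2)//= !big_nat_recr//= big_geq// add0r.
rewrite [X in _ + X]big_nat_cond big1 ?addr0// => i; rewrite andbT => /andP[i2 _].
rewrite /bigcup2; case: i i2 => [|[|i]]//= _; apply: sigma_additive0 dAB.
Qed.

End One.

Variables S1 S2 : set TR -> R[i].
Hypotheses (a1 : sigma_additive_on dom S1) (a2 : sigma_additive_on dom S2).
Hypothesis S12 : forall a b : R, a < b -> S1 `]a, b]%classic = S2 `]a, b]%classic.

Let S12_oc X : ocitv X -> S1 X = S2 X.
Proof.
move=> /ocitvP[->|[[a b] /= ab ->]]; last exact: S12.
by rewrite !(sigma_additive0 _ (dom_itv 0 0)).
Qed.

Let S12_bounded (a b : R) (E : set TR) : measurable E -> S1 (E `&` `]a, b]) = S2 (E `&` `]a, b]).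
Proof.
move=> mE; set D : set TR := `]a, b]%classic.
have dD : dom D by exact: dom_itv.
have mD : measurable D by exact: dom_meas.
have dI (A : set TR) : measurable A -> dom (A `&` D).
  by move=> mA; apply: dom_sub dD _ _; [exact: measurableI|exact: subIsetr].
(* inside [D] complements stay in [dom] *)
pose P (A : set TR) := S1 (A `&` D) = S2 (A `&` D).
apply: (@dynkin_induction _ TR (@ocitv R) P _ _ _ _ _ _ E mE).
- by [].
- exact: ocitvI.
- by rewrite /P setTI; apply: S12_oc; exact: is_ocitv.
- by move=> X oX; apply: S12_oc; apply: ocitvI => //; exact: is_ocitv.
- move=> A mA PA.
  have eD : D = (A `&` D) `|` (~` A `&` D) by rewrite -setIUl setUv setTI.
  have dj : (A `&` D) `&` (~` A `&` D) = set0 by rewrite setIACA setICr set0I.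
  have mAD : measurable (A `&` D) by exact: measurableI.
  have mCD : measurable (~` A `&` D) by apply: measurableI => //; exact: measurableC.
  have dU : dom ((A `&` D) `|` (~` A `&` D)) by rewrite -eD.
  have := S12_oc (is_ocitv a b); rewrite -/D eD.
  rewrite (sigma_additiveU a1 mAD mCD dj dU) (sigma_additiveU a2 mAD mCD dj dU).
  by rewrite PA => /addrI.
- move=> F mF tF PF; rewrite /P setI_bigcupl.
  have mFD n : measurable (F n `&` D) by exact: measurableI.
  have tFD : trivIset setT (fun n => F n `&` D) by exact: trivIset_setIr.
  have dU : dom (\bigcup_n (F n `&` D)).
    by rewrite -setI_bigcupl; apply: dI; exact: bigcup_measurable.
  apply: (ccvg_unique (a1 mFD tFD dU)).
  under eq_fun do under eq_bigr do rewrite PF.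
  exact: a2.
Qed.

(** A set of [dom] may be unbounded, and complements leave [dom]; the Dynkin
    argument is therefore carried out inside bounded intervals, which are then
    exhausted. *)
Lemma sigma_additive_unique E : dom E -> S1 E = S2 E.
Proof.
move=> dE; have mE := dom_meas dE.
pose F (n : nat) : set TR := `](- n%:R : R), n%:R]%classic.
have mF n : measurable (F n) by apply: dom_meas; exact: dom_itv.
pose U (n : nat) : set TR := \big[setU/set0]_(k < n) F k.
have mU n : measurable (U n) by exact: bigsetU_measurable.
have mI n : measurable (E `&` seqDU F n) by apply: measurableI => //; exact: (measurableD (mF n) (mU n)).
have tI : trivIset setT (fun n => E `&` seqDU F n).
  by apply: trivIset_setIl; exact: trivIset_seqDU.
have EE : E = \bigcup_n (E `&` seqDU F n).
  by rewrite -setI_bigcupr -seqDU_bigcup_eq (bigcup_itvT false false) setIT.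
have S12n n : S1 (E `&` seqDU F n) = S2 (E `&` seqDU F n).
  have -> : E `&` seqDU F n = (E `\` U n) `&` F n.
    by rewrite /seqDU !setDE setIA setIAC.
  by apply: S12_bounded; exact: measurableD.
have dU : dom (\bigcup_n (E `&` seqDU F n)) by rewrite -EE.
rewrite EE; apply: (ccvg_unique (a1 mI tI dU)).
under eq_fun do under eq_bigr do rewrite S12n.
exact: a2.
Qed.

End Uniqueness.
End SigmaAdditive.

(** * Testing against Schwartz functions *)

Section AlmostEverywhereMono.
Context d (T : measurableType d) (R : realType) (mu : {measure set T -> \bar R}).

Lemma ae_imp (P Q : T -> Prop) : (forall w, P w -> Q w) ->
  {ae mu, forall w, P w} -> {ae mu, forall w, Q w}.
Proof. by move=> PQ; apply: filterS. Qed.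

Lemma ae_imp2 (P Q S : T -> Prop) : (forall w, P w -> Q w -> S w) ->
  {ae mu, forall w, P w} -> {ae mu, forall w, Q w} -> {ae mu, forall w, S w}.
Proof. by move=> PQ; apply: filterS2. Qed.

End AlmostEverywhereMono.

Section Testing.
Context {R : realType}.
Local Notation leb := (@lebesgue_measure R).
Local Notation TR := (measurableTypeR R).

Lemma measure_eq_itv (m1 m2 : {measure set TR -> \bar R}) :
  (forall a b : R, a < b -> m1 `]a, b]%classic = m2 `]a, b]%classic) ->
  (forall a b : R, (m1 `]a, b]%classic < +oo)%E) ->
  forall A, measurable A -> m1 A = m2 A.
Proof.
move=> m12 m1oo; apply: (@measure_unique _ R TR (@ocitv R) (fun n => `](- n%:R : R), n%:R]%classic)).
- by [].
- exact: ocitvI.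
- by move=> n; exact: is_ocitv.
- by rewrite (bigcup_itvT false false).
- by move=> _ /ocitvP[->|[[a b] /= ab ->]]; [rewrite !measure0|exact: m12].
- by move=> n; exact: m1oo.
Qed.

(** The integral vanishes on intervals, hence on all measurable sets, and then
    so do the real and imaginary parts almost everywhere. *)
Lemma cint_itv_ae0 (f : R -> R[i]) : cmeasurable f -> cintegrable leb setT f ->
  (forall a b : R, a < b -> cint leb `]a, b] f = 0) -> {ae leb, forall w, f w = 0}.
Proof.
move=> mf jf f0.
have f0E (E : set TR) : measurable E -> cint leb E f = 0.
  apply: (@sigma_additive_unique R measurable _ _ _ (fun E => cint leb E f) (fun=> 0)) => //.
  - move=> F mF tF _; apply: cint_bigcup => //.
    have mU : measurable (\bigcup_n F n) by exact: bigcup_measurable.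
    by split; [apply: (integrableS measurableT mU _ jf.1)|apply: (integrableS measurableT mU _ jf.2)].
  - move=> F _ _ _; under eq_fun do rewrite big1//; exact: ccvg_cst.
have key (g : R -> R) : measurable_fun setT g -> leb.-integrable setT (EFin \o g) ->
    (forall E : set TR, measurable E -> Rintegral leb E g = 0) -> {ae leb, forall w, g w = 0}.
  move=> mg ig g0.
  have := @integral_ae_eq _ TR R leb setT measurableT (cst 0%E) (EFin \o g) ig (measurable_cst _).
  have h : forall E, E `<=` setT -> measurable E ->
      (\int[leb]_(x in E) (EFin \o g) x = \int[leb]_(x in E) cst 0 x)%E.
    move=> E _ mE; rewrite integral0.
    have fi : (\int[leb]_(x in E) (EFin \o g) x)%E \is a fin_num.
      by apply: integrable_fin_num => //; apply: integrableS ig.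
    by rewrite -(fineK fi); congr EFin; exact: g0.
  move=> /(_ h); apply: (@ae_imp _ TR) => w /(_ Logic.I) [].
  by [].
have hr := key _ mf.1 jf.1 (fun E mE => congr1 (@complex.Re R) (f0E E mE)).
have hi := key _ mf.2 jf.2 (fun E mE => congr1 (@complex.Im R) (f0E E mE)).
by apply: (@ae_imp2 _ TR _ _ _ _ _ _ hr hi) => w h1 h2; apply: complexP.
Qed.

Lemma win_ge0 a b n w : 0 <= win a b n w :> R.
Proof. exact: window_ge0. Qed.

Lemma win_le1 a b n w : win a b n w <= 1 :> R.
Proof. exact: window_le1. Qed.

Lemma win_gauss_bound a b n (w : R) :
  win a b n w <= (2 + expR ((2 * (`|a| + `|b|)) ^+ 2)) * gauss (16^-1) w.
Proof. by apply: window_gauss_bound; rewrite invr_gt0 ltr0n /= invf_le1 ?ler1n ?ltr0n. Qed.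

Lemma win_fourier a b n : exists phi : R -> R[i],
  schwartz phi /\ fourier phi = (fun w => (win a b n w)%:C).
Proof.
have [|phi [S e]] := @window_fourier R (n.+1%:R^-1) a b; first exact: win_gt0.
by exists phi; split => //; apply/funext => w; rewrite e.
Qed.

Lemma measurable_win a b n : measurable_fun setT (win a b n : R -> R).
Proof.
have [phi [S e]] := win_fourier a b n.
by have [] := cmeas_fourier (cmeas_schwartz S); rewrite e.
Qed.

Lemma null_itv_endpoint (mu : {measure set TR -> \bar R}) (a : R) : mu `<< leb -> mu [set a] = 0%E.
Proof.
move=> /null_content_dominatesP; apply; first exact: measurable_set1.
exact: lebesgue_measure_set1.
Qed.

Lemma win_cvg_ae (mu : {measure set TR -> \bar R}) a b : mu `<< leb ->
  {ae mu, forall w, win a b n w @[n --> \oo] --> (\1_(`[a, b]%classic : set R) w : R)}.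
Proof.
move=> ac.
have m1 (x : R) : measurable ([set x] : set TR) by exact: measurable_set1.
exists ([set a] `|` [set b]); split; first exact: measurableU.
  by apply: null_set_setU => //; exact: null_itv_endpoint.
move=> w /= h; apply: contrapT => /not_orP[/eqP wa /eqP wb]; apply: h.
exact: win_cvg.
Qed.

(** All windows lie below one Gaussian, so that integrability of [f] against
    it is enough for dominated convergence. Any positive power of the windows
    converges to the same indicator; first and second powers occur below. *)
Lemma win_test (mu : {measure set TR -> \bar R}) a b k (f : R -> R[i]) : mu `<< leb ->
  cmeasurable f -> mu.-integrable setT (EFin \o (fun w => gauss (16^-1) w * cmod (f w))) ->
  ccvg (fun n => cint mu setT (fun w => (win a b n w ^+ k.+1)%:C * f w)) (cint mu `[a, b] f).
Proof.
move=> ac mf ig; rewrite cint_mkcond.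
set C : R := 2 + expR ((2 * (`|a| + `|b|)) ^+ 2).
have C0 : 0 <= C by rewrite addr_ge0// expR_ge0.
apply: (@cdominated _ TR _ mu _ measurableT _ _ (fun w => C * (gauss (16^-1) w * cmod (f w))) _ _ _ _ _).2.
- move=> n; apply: (@cmeasM _ TR) => //; apply: cmeasR.
  by apply: measurable_funX; exact: measurable_win.
- by apply: (@cmeasM _ TR) => //; apply: cmeasR; exact: measurable_indic.
- apply: (@ae_imp _ TR _ _ _ _ _ (win_cvg_ae a b ac)) => w h _.
  have -> : f w * (\1_(`[a, b]%classic : set TR) w : R)%:C =
      ((\1_(`[a, b]%classic : set TR) w : R) ^+ k.+1)%:C * f w.
    by rewrite mulrC indicE; case: (_ \in _); rewrite ?expr1n ?expr0n.
  apply: ccvgM; last exact: ccvg_cst.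
  apply: ccvgR; elim: k => [|k IH]; first by under eq_fun do rewrite expr1; rewrite expr1.
  by under eq_fun do rewrite exprS; rewrite exprS; apply: cvgM.
- under [X in integrable _ _ X]funext do rewrite /= EFinM.
  exact: integrableZl.
- move=> n w _; rewrite cmodM cmodR mulrA ler_wpM2r ?cmod_ge0//.
  rewrite ger0_norm ?exprn_ge0 ?win_ge0// (le_trans _ (win_gauss_bound a b n w))//.
  by rewrite exprS ler_piMr ?win_ge0// exprn_ile1 ?win_ge0 ?win_le1.
Qed.

Lemma gauss_le1 (c w : R) : 0 <= c -> gauss c w <= 1.
Proof. by move=> c0; rewrite /gauss -expR0 ler_expR oppr_le0 mulr_ge0 ?sqr_ge0. Qed.

(** Multiplied by a Gaussian, [h] is integrable, its Fourier transform vanishes,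
    and hence so does its integral over every interval. *)
Lemma schwartz_test_ae0 (h : R -> R[i]) : cmeasurable h ->
  (forall psi, schwartz psi -> cintegrable leb setT (fun w => h w * psi w) /\
     cint leb setT (fun w => h w * psi w) = 0) ->
  {ae leb, forall w, h w = 0}.
Proof.
move=> mh H; pose G (w : R) := h w * (gauss 1 w)%:C.
have mG : cmeasurable G.
  by apply: cmeasM => //; apply: cmeasR; exact: measurable_gauss.
have iG : cintegrable leb setT G by exact: (H _ (schwartz_gauss ltr01)).1.
(* a Gaussian times a character is a Schwartz function *)
have FG w : fourier G w = 0.
  rewrite fourierE -(H _ (schwartz_gauss_cis (- w) ltr01)).2.
  by apply: eq_cint => t _; rewrite /G mulrN; ring.
have G0 (a b : R) : a < b -> cint leb `]a, b] G = 0.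
  move=> ab; have -> : cint leb `]a, b] G = cint leb `[a, b] G.
    rewrite /cint !Rintegral_itv_obnd_cbnd//.
    - by apply: (integrableS measurableT _ _ iG.2).
    - by apply: (integrableS measurableT _ _ iG.1).
  have ac : leb `<< leb by move=> A; exact.
  apply: (ccvg_unique (win_test a b 0 ac mG _)).
    apply: (@le_integrable _ TR _ leb setT measurableT _ (EFin \o (fun w => cmod (G w)))).
    - apply/measurable_EFinP; apply: measurable_funM; first exact: measurable_gauss.
      exact: cmeas_cmod.
    - move=> w _; rewrite /= lee_fin normrM ler_piMl//.
      by rewrite ger0_norm ?gauss_ge0// gauss_le1.
    - exact: (cintegrable_cmod measurableT iG).
  suff e n : cint leb setT (fun w => (win a b n w ^+ 1)%:C * G w) = 0.
    by under eq_fun do rewrite e; exact: ccvg_cst.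
  have [phi [S e]] := win_fourier a b n.
  have := fourier_mult mG iG (cmeas_schwartz S) (cintegrable_schwartz S).
  rewrite e; under [X in _ = cint _ _ X -> _]funext do rewrite FG mul0r.
  rewrite cint0 => <-; apply: eq_cint => w _; by rewrite expr1 mulrC.
apply: (@ae_imp _ TR _ _ _ _ _ (cint_itv_ae0 mG iG G0)) => w /eqP; rewrite /G mulf_eq0 => /orP[/eqP//|/eqP h0].
by have := congr1 (@complex.Re _) h0; rewrite /= => /eqP; rewrite gt_eqF// expR_gt0.
Qed.

(** The difference of two candidates is annihilated by all Schwartz
    functions. *)
Lemma fourier_is_fun_unique (g : (R -> R[i]) -> R[i]) h1 h2 :
  fourier_is_fun g h1 -> fourier_is_fun g h2 -> {ae leb, forall w, h1 w = h2 w}.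
Proof.
move=> [m1 H1] [m2 H2].
have : {ae leb, forall w, h1 w - h2 w = 0}.
  apply: schwartz_test_ae0; first exact: cmeasB.
  move=> psi S; have [i1 e1] := H1 _ S; have [i2 e2] := H2 _ S.
  have E : (fun w => (h1 w - h2 w) * psi w) = (fun w => h1 w * psi w - h2 w * psi w).
    by apply/funext => w; ring.
  rewrite E; split; first exact: (@cintegrableB _ TR).
  by rewrite (@cintB _ TR _ leb _ measurableT _ _ i1 i2) -/(distr h1 psi) -/(distr h2 psi) -e1 -e2 subrr.
by apply: (@ae_imp _ TR) => w /eqP; rewrite subr_eq0 => /eqP.
Qed.

End Testing.

(** * Second moments of stochastic integrals *)

Section StochasticMoments.
Context {d : measure_display} {T : measurableType d} {R : realType}.
Local Notation TR := (measurableTypeR R).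
Variables (P : probability T R) (nu : @matrix_data R) (Z : 'I_2 -> set R -> T -> R[i]).
Hypothesis rZ : random_measure P nu Z.

Definition finite_list (s : seq (R[i] * set R)) :=
  forall k, (k < size s)%N -> finite_on nu (nth (0, set0) s k).2.

Lemma finite_list_cons a s : finite_list (a :: s) -> finite_on nu a.2 /\ finite_list s.
Proof. by move=> h; split; [exact: (h 0%N)|move=> k ks; exact: (h k.+1)]. Qed.

Lemma simple_fun_cons a s : simple_fun (a :: s) = (fun w : R => a.1 * (\1_(a.2) w)%:C + simple_fun s w).
Proof. by apply/funext => w; rewrite /simple_fun big_cons. Qed.

Lemma simple_int_cons (Zi : set R -> T -> R[i]) a s :
  simple_int Zi (a :: s) = (fun x => a.1 * Zi a.2 x + simple_int Zi s x).
Proof. by apply/funext => x; rewrite /simple_int big_cons. Qed.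

Lemma diag_finite i E : finite_on nu E -> (diag_measure nu i E < +oo)%E.
Proof.
move=> [mE]; apply: le_lt_trans.
have -> : norm_measure nu E = (diag_measure nu ord0 E + diag_measure nu ord_max E)%E.
  exact: (measure_addE (diag_measure nu ord0) (diag_measure nu ord_max) E).
by case: (ord2P i) => ->; [rewrite leeDl|rewrite leeDr].
Qed.

Lemma L2_indicator i (E : set R) : finite_on nu E ->
  L2 (diag_measure nu i) (fun w : TR => (\1_E w : R)%:C).
Proof.
move=> fE; have [mE _] := fE; split.
  by apply: cmeasR; exact: (@measurable_indic _ TR).
rewrite /sqnormL2 (_ : (\int[_]_x _)%E = (\int[diag_measure nu i]_x (\1_E x)%:E)%E); last first.
  apply: eq_integral => x _; congr EFin; rewrite cmodR indicE.
  by case: (_ \in _); rewrite ?normr1 ?expr1n ?normr0 ?expr0n.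
rewrite integral_indic//= setIT; exact: diag_finite.
Qed.

Lemma simple_fun_L2 i s : finite_list s -> L2 (diag_measure nu i) (simple_fun s).
Proof.
elim: s => [|a s IH] fs.
  apply: (@eq_L2 _ TR _ _ (fun=> 0)); last exact: L20.
  by move=> w; rewrite /simple_fun big_nil.
have [fa fs'] := finite_list_cons fs; rewrite simple_fun_cons.
by apply: L2D; [apply: L2Z; exact: L2_indicator|exact: IH].
Qed.

Lemma simple_int_L2 i s : finite_list s -> L2 P (simple_int (Z i) s).
Proof.
elim: s => [|a s IH] fs.
  apply: (@eq_L2 _ _ _ _ (fun=> 0)); last exact: L20.
  by move=> w; rewrite /simple_int big_nil.
have [fa fs'] := finite_list_cons fs; rewrite simple_int_cons.
by apply: L2D; [apply: L2Z; exact: rZ.1|exact: IH].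
Qed.

Lemma simple_fun1 (E : set R) : simple_fun [:: (1, E)] = (fun w : R => (\1_E w)%:C).
Proof. by apply/funext => w; rewrite /simple_fun big_seq1 mul1r. Qed.

Lemma simple_int1 (Zi : set R -> T -> R[i]) (E : set R) : simple_int Zi [:: (1, E)] = Zi E.
Proof. by apply/funext => w; rewrite /simple_int big_seq1 mul1r. Qed.

Lemma stoch_int_measure i E : finite_on nu E ->
  is_stoch_int P nu Z i (fun w => (\1_E w)%:C) (Z i E).
Proof.
move=> fE; exists (fun=> [:: (1, E)]); split.
- by move=> _ [|k].
- apply: cvg_near_cst; apply: nearW => _.
  rewrite /sqnormL2 integral0_eq// => w _; rewrite simple_fun1.
  by rewrite subrr cmod0 expr0n.
- apply: cvg_near_cst; apply: nearW => _.
  rewrite /sqnormL2 integral0_eq// => w _; rewrite simple_int1.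
  by rewrite subrr cmod0 expr0n.
Qed.

Section Isometry.
Variables (i j : 'I_2) (mu : {measure set TR -> \bar R}) (p q : R -> R[i]).
Hypotheses (mp : cmeasurable p) (mq : cmeasurable q).
Hypothesis nuE : forall E, finite_on nu E ->
  nu E i j = cint mu E (fun w => p w * conjc (q w)).
Hypothesis normp : forall f : R -> R[i], cmeasurable f ->
  sqnormL2 (diag_measure nu i) f = sqnormL2 mu (fun w => p w * f w).
Hypothesis normq : forall f : R -> R[i], cmeasurable f ->
  sqnormL2 (diag_measure nu j) f = sqnormL2 mu (fun w => q w * f w).

Let L2p f : L2 (diag_measure nu i) f -> L2 mu (fun w => p w * f w).
Proof. by move=> [mf nf]; split; [exact: (@cmeasM _ TR)|rewrite -normp]. Qed.

Let L2q f : L2 (diag_measure nu j) f -> L2 mu (fun w => q w * f w).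
Proof. by move=> [mf nf]; split; [exact: (@cmeasM _ TR)|rewrite -normq]. Qed.

Let ip_indicator E1 E2 : finite_on nu E1 -> finite_on nu E2 ->
  ip P (Z i E1) (Z j E2) =
  ip mu (fun w => p w * (\1_E1 w)%:C) (fun w => q w * (\1_E2 w)%:C).
Proof.
move=> f1 f2; have f12 : finite_on nu (E1 `&` E2).
  split; first by apply: (@measurableI _ TR); [exact: f1.1|exact: f2.1].
  apply: le_lt_trans f1.2; apply: le_measure; rewrite ?inE.
  - by apply: (@measurableI _ TR); [exact: f1.1|exact: f2.1].
  - exact: f1.1.
  - exact: subIsetl.
transitivity (nu (E1 `&` E2) i j); first exact: rZ.2.
rewrite nuE// cint_mkcond; apply: eq_cint => w _.
have cr (x : R) : conjc x%:C = x%:C :> R[i] by rewrite /= oppr0.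
rewrite indicI [X in X%:C]/= rmorphM conjcM cr; ring.
Qed.

Let ip_simple s1 s2 : finite_list s1 -> finite_list s2 ->
  ip P (simple_int (Z i) s1) (simple_int (Z j) s2) =
  ip mu (fun w => p w * simple_fun s1 w) (fun w => q w * simple_fun s2 w).
Proof.
elim: s1 => [|a s1 IH] fs1 fs2.
  have -> : simple_int (Z i) [::] = (fun=> 0) by apply/funext => x; rewrite /simple_int big_nil.
  have -> : (fun w => p w * simple_fun [::] w) = (fun=> 0).
    by apply/funext => x; rewrite /simple_fun big_nil mulr0.
  by rewrite !ip0l.
have [fa fs1'] := finite_list_cons fs1.
have La := L2_indicator i fa.
have L1 := simple_fun_L2 i fs1'; have L2' := simple_fun_L2 j fs2.
rewrite simple_int_cons (ipDl (L2Z a.1 (rZ.1 i _ fa)) (simple_int_L2 i fs1') (simple_int_L2 j fs2)).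
rewrite (ipZl a.1 (rZ.1 i _ fa) (simple_int_L2 j fs2)) IH//.
have -> : (fun w => p w * simple_fun (a :: s1) w) =
    (fun w => a.1 * (p w * (\1_(a.2) w)%:C) + p w * simple_fun s1 w).
  by apply/funext => w; rewrite simple_fun_cons; ring.
rewrite (ipDl (L2Z a.1 (L2p La)) (L2p L1) (L2q L2')) (ipZl a.1 (L2p La) (L2q L2')).
congr (_ * _ + _); move: fs2 {L2' IH}; elim: s2 => [|b s2 IH2] fs2.
  have -> : simple_int (Z j) [::] = (fun=> 0) by apply/funext => x; rewrite /simple_int big_nil.
  have -> : (fun w => q w * simple_fun [::] w) = (fun=> 0).
    by apply/funext => x; rewrite /simple_fun big_nil mulr0.
  by rewrite !ip0r.
have [fb fs2'] := finite_list_cons fs2; have Lb := L2_indicator j fb.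
have L2' := simple_fun_L2 j fs2'.
rewrite simple_int_cons (ipDr (rZ.1 i _ fa) (L2Z b.1 (rZ.1 j _ fb)) (simple_int_L2 j fs2')).
rewrite (ipZr b.1 (rZ.1 i _ fa) (rZ.1 j _ fb)) IH2//.
have -> : (fun w => q w * simple_fun (b :: s2) w) =
    (fun w => b.1 * (q w * (\1_(b.2) w)%:C) + q w * simple_fun s2 w).
  by apply/funext => w; rewrite simple_fun_cons; ring.
rewrite (ipDr (L2p La) (L2Z b.1 (L2q Lb)) (L2q L2')) (ipZr b.1 (L2p La) (L2q Lb)).
by rewrite ip_indicator.
Qed.

(** The isometry between spectral space and random variables, for two
    components whose joint spectral measure factorizes as [p conj(q) mu] while
    the diagonal entries are [|p|^2 mu] and [|q|^2 mu]. It holds for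
    indicators by definition of the random measure, then for simple functions,
    and passes to limits in mean square. *)
Lemma stoch_int_moment h1 h2 Y1 Y2 :
  L2 (diag_measure nu i) h1 -> L2 (diag_measure nu j) h2 -> L2 P Y1 -> L2 P Y2 ->
  is_stoch_int P nu Z i h1 Y1 -> is_stoch_int P nu Z j h2 Y2 ->
  ip P Y1 Y2 = ip mu (fun w => p w * h1 w) (fun w => q w * h2 w).
Proof.
move=> Lh1 Lh2 LY1 LY2 [s1 [f1 h1s Y1s]] [s2 [f2 h2s Y2s]].
have Ls1 n := simple_fun_L2 i (f1 n); have Ls2 n := simple_fun_L2 j (f2 n).
have c1 := ip_cvg LY1 LY2 (fun n => simple_int_L2 i (f1 n)) (fun n => simple_int_L2 j (f2 n))
  (sqnorm_cvg Y1s) (sqnorm_cvg Y2s).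
have e n := ip_simple (f1 n) (f2 n).
apply: (ccvg_unique c1); under eq_fun do rewrite e.
apply: (@ip_cvg _ TR _ mu (fun n w => p w * simple_fun (s1 n) w) (fun n w => q w * simple_fun (s2 n) w)).
- exact: L2p.
- exact: L2q.
- by move=> n; exact: L2p.
- by move=> n; exact: L2q.
- apply: sqnorm_cvg; apply: cvg_trans h1s; apply: near_eq_cvg; apply: nearW => n.
  rewrite normp; last by apply: (@cmeasB _ TR); [exact: Lh1.1|exact: (Ls1 n).1].
  by congr sqnormL2; apply/funext => w; rewrite mulrBr.
- apply: sqnorm_cvg; apply: cvg_trans h2s; apply: near_eq_cvg; apply: nearW => n.
  rewrite normq; last by apply: (@cmeasB _ TR); [exact: Lh2.1|exact: (Ls2 n).1].
  by congr sqnormL2; apply/funext => w; rewrite mulrBr.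
Qed.

End Isometry.

(** Nothing has to be known about the other component. This is the form with
    which the velocity condition is tested before the two are linked. *)
Lemma stoch_int_moment_diag i h1 h2 Y1 Y2 : is_matrix_measure nu ->
  L2 (diag_measure nu i) h1 -> L2 (diag_measure nu i) h2 -> L2 P Y1 -> L2 P Y2 ->
  is_stoch_int P nu Z i h1 Y1 -> is_stoch_int P nu Z i h2 Y2 ->
  ip P Y1 Y2 = ip (diag_measure nu i) h1 h2.
Proof.
move=> [_ nuii _] Lh1 Lh2 LY1 LY2 s1 s2.
have n1 f : sqnormL2 (diag_measure nu i) f = sqnormL2 (diag_measure nu i) (fun w => 1 * f w).
  by congr sqnormL2; apply/funext => w; rewrite mul1r.
rewrite (@stoch_int_moment i i (diag_measure nu i) (fun=> 1) (fun=> 1) _ _ _ _ _ h1 h2)//.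
- by congr ip; apply/funext => w; rewrite mul1r.
- move=> E fE; rewrite nuii//.
  have -> : 1 * conjc 1 = (1 : R)%:C by apply: complexP; rewrite !cReImE /=; ring.
  rewrite (@cintR _ TR) Rintegral_cst ?mul1r//; exact: fE.1.
Qed.

End StochasticMoments.

(** * Uniqueness of densities *)

Section WeightedMeasures.
Context d (T : measurableType d) (R : realType).

Lemma weighted_measure (mu : {measure set T -> \bar R}) (rho : T -> R) :
  (forall x, 0 <= rho x) -> measurable_fun setT rho ->
  exists m : {measure set T -> \bar R},
    forall A, m A = (\int[mu]_(x in A) (rho x)%:E)%E.
Proof.
move=> rho0 mrho; pose m A := (\int[mu]_(x in A) (rho x)%:E)%E.
have m0 : m set0 = 0%E by rewrite /m integral_set0.
have m_ge0 A : (0 <= m A)%E by apply: integral_ge0 => x _; rewrite lee_fin.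
have m_sig : semi_sigma_additive m.
  move=> F mF tF mUF.
  have mr : measurable_fun (\bigcup_k F k) (fun x => (rho x)%:E).
    by apply/measurable_EFinP; exact: measurable_funTS.
  have r0 x : (\bigcup_k F k) x -> (0 <= (rho x)%:E)%E by rewrite lee_fin.
  rewrite /m ge0_integral_bigcup//=.
  apply: is_cvg_ereal_nneg_natsum_cond => n _ _.
  by apply: integral_ge0 => x _; rewrite lee_fin.
pose mm : {measure set T -> \bar R} := HB.pack m (isMeasure.Build _ _ _ m m0 m_ge0 m_sig).
by exists mm.
Qed.

End WeightedMeasures.

Section DensityUniqueness.
Context {R : realType}.
Local Notation leb := (@lebesgue_measure R).
Local Notation TR := (measurableTypeR R).

(** Both sides are integrals of [f] against the measure with the given
    density; the two measures agree on intervals, where they are finite. *)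
Lemma weighted_eq (mu1 mu2 : {measure set TR -> \bar R}) (rho1 rho2 : TR -> R) :
  (forall x, 0 <= rho1 x) -> measurable_fun setT rho1 ->
  (forall x, 0 <= rho2 x) -> measurable_fun setT rho2 ->
  (forall a b : R, a < b ->
    (\int[mu1]_(x in `]a, b]) (rho1 x)%:E = \int[mu2]_(x in `]a, b]) (rho2 x)%:E)%E) ->
  (forall a b : R, (\int[mu1]_(x in `]a, b]) (rho1 x)%:E < +oo)%E) ->
  forall f : TR -> \bar R, (forall x, (0 <= f x)%E) -> measurable_fun setT f ->
  (\int[mu1]_x (f x * (rho1 x)%:E) = \int[mu2]_x (f x * (rho2 x)%:E))%E.
Proof.
move=> p1 m1 p2 m2 e12 fin f f0 mf.
have [w1 w1E] := weighted_measure mu1 p1 m1; have [w2 w2E] := weighted_measure mu2 p2 m2.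
have w12 := @measure_eq_itv R w1 w2.
rewrite -(ge0_integral_density p1 m1 (fun A _ => w1E A) f0 mf).
rewrite -(ge0_integral_density p2 m2 (fun A _ => w2E A) f0 mf).
apply: eq_measure_integral => A mA _; apply: w12 => // a b; first by move=> ab; rewrite w1E w2E e12.
by rewrite w1E.
Qed.

Lemma gauss_rapid_bound (c : R) n : 0 < c ->
  exists C : R, forall w, gauss c w * (1 + w ^+ 2) <= C / (1 + w ^+ 2) ^+ n.
Proof.
move=> c0; have [C0 b0] := gauss_pow_bound 0 c0; have [C1 b1] := gauss_pow_bound (2 * n.+1)%N c0.
exists (2 ^+ n.+1 * (C0 + C1)) => w.
have w0 : 0 < 1 + w ^+ 2 by rewrite ltr_pwDl// sqr_ge0.
rewrite ler_pdivlMr ?exprn_gt0// -mulrA -exprS.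
have := @pow_oneD_le R (w ^+ 2) n.+1 (sqr_ge0 w) => h.
apply: (@le_trans _ _ (gauss c w * (2 ^+ n.+1 * (1 + (w ^+ 2) ^+ n.+1)))).
  by rewrite ler_wpM2l ?gauss_ge0.
rewrite mulrCA ler_wpM2l ?exprn_ge0// mulrDr mulr1 lerD//.
  by have := b0 w; rewrite expr0 mul1r.
have := b1 w; rewrite exprM real_normK ?num_real// => h1.
by rewrite mulrC.
Qed.

Section Spectral.
Variable nu : @matrix_data R.
Hypothesis nu_spectral : spectral_measure nu.

(** A Gaussian is the square of a Gaussian of half the exponent, and that one
    is rapidly decreasing, hence square-integrable. *)
Lemma integrable_gauss_poly i :
  (diag_measure nu i).-integrable setT (EFin \o (fun w : TR => gauss (16^-1) w * (1 + w ^+ 2))).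
Proof.
have c0 : 0 < (32^-1 : R) by rewrite invr_gt0 ltr0n.
have mg : measurable_fun setT (fun w : TR => gauss (32^-1) w * (1 + w ^+ 2)).
  apply: measurable_funM; first exact: measurable_gauss.
  by apply: measurable_funD => //; exact: measurable_funX.
have L : L2 (diag_measure nu i) (fun w : R => (gauss (32^-1) w * (1 + w ^+ 2))%:C).
  apply: (L2_rapid nu_spectral); first exact: cmeasR.
  move=> n; have [C bC] := gauss_rapid_bound n c0; exists C => w.
  by rewrite cmodR ger0_norm ?bC// mulr_ge0 ?gauss_ge0// addr_ge0// sqr_ge0.
apply: (@le_integrable _ TR _ _ _ measurableT _ _ _ _ (L2_integrable L)).
  apply/measurable_EFinP; apply: measurable_funM; first exact: measurable_gauss.
  by apply: measurable_funD => //; exact: measurable_funX.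
move=> w _; rewrite /comp /abse lee_fin.
have w1 : 1 <= 1 + w ^+ 2 by rewrite lerDl sqr_ge0.
have g0 := gauss_ge0 (16^-1) w.
rewrite ger0_norm; last by rewrite mulr_ge0// (le_trans ler01).
rewrite ger0_norm ?sqr_ge0// cmodR real_normK ?num_real//.
rewrite exprMn; have -> : gauss 32^-1 w ^+ 2 = gauss (16^-1 : R) w.
  by rewrite /gauss expr2 -expRD; congr expR; field.
by rewrite ler_wpM2l// expr2 ler_peMl// (le_trans ler01).
Qed.

Lemma diag_dominated i : diag_measure nu i `<< leb.
Proof.
have [_ + _] := nu_spectral => /null_content_dominatesP ac.
apply/null_content_dominatesP => A mA A0; apply/eqP; rewrite -measure_le0.
rewrite -(ac A mA A0).
have -> : norm_measure nu A = (diag_measure nu ord0 A + diag_measure nu ord_max A)%E.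
  exact: (measure_addE (diag_measure nu ord0) (diag_measure nu ord_max) A).
by case: (ord2P i) => ->; [rewrite leeDl|rewrite leeDr].
Qed.

Lemma diag_itv_fin i (a b : R) : (diag_measure nu i `[a, b]%classic < +oo)%E.
Proof.
have mi : measurable (`[a, b]%classic : set TR) by exact: measurable_itv.
set M : R := `|a| + `|b|; have M0 : 0 <= M by rewrite addr_ge0.
set C : R := expR (16^-1 * M ^+ 2).
have bC w : \1_(`[a, b]%classic : set TR) w <= C * (gauss (16^-1) w * (1 + w ^+ 2)).
  have r0 : 0 <= C * (gauss (16^-1) w * (1 + w ^+ 2)).
    by rewrite !mulr_ge0 ?expR_ge0// addr_ge0// sqr_ge0.
  rewrite indicE; have [|//] := boolP (w \in _); rewrite inE /= in_itv /=.
  move=> /itv_sqr_le; rewrite -/M => wM.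
  rewrite mulrA; apply: (@le_trans _ _ (C * gauss (16^-1) w)).
    by rewrite /C /gauss -expRD -[leLHS]expR0 ler_expR; lra.
  by rewrite ler_peMr ?mulr_ge0 ?expR_ge0// lerDl sqr_ge0.
have ig := integrable_gauss_poly i.
have : (\int[diag_measure nu i]_w (\1_(`[a, b]%classic : set TR) w)%:E < +oo)%E.
  apply: (@le_lt_trans _ _ (\int[diag_measure nu i]_w (C%:E * (gauss (16^-1) w * (1 + w ^+ 2))%:E))%E).
    apply: ge0_le_integral => //.
    - by apply/measurable_EFinP; exact: measurable_indic.
    - by apply: measurable_funeM; exact: (measurable_int _ ig).
    - by move=> w _; rewrite -EFinM lee_fin.
  rewrite ge0_integralZl_EFin ?expR_ge0//; first last.
  - exact: (measurable_int _ ig).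
  - by move=> w _; rewrite lee_fin mulr_ge0 ?gauss_ge0// addr_ge0// sqr_ge0.
  apply: lte_mul_pinfty; rewrite ?lee_fin ?expR_ge0//.
  have /integrableP[_] := ig; apply: le_lt_trans; rewrite ge0_le_integral//.
  - by move=> w _; rewrite lee_fin mulr_ge0 ?gauss_ge0// addr_ge0// sqr_ge0.
  - exact: (measurable_int _ ig).
  - by apply: measurableT_comp => //; exact: (measurable_int _ ig).
  - by move=> w _; exact: lee_abs.
by rewrite integral_indic// setIT.
Qed.

Lemma finite_on_itv (a b : R) : finite_on nu `]a, b]%classic.
Proof.
split; first exact: measurable_itv.
have -> : norm_measure nu `]a, b]%classic =
    (diag_measure nu ord0 `]a, b]%classic + diag_measure nu ord_max `]a, b]%classic)%E.
  exact: (measure_addE (diag_measure nu ord0) (diag_measure nu ord_max)).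
have h i : (diag_measure nu i `]a, b]%classic < +oo)%E.
  apply: le_lt_trans (diag_itv_fin i a b); apply: le_measure; rewrite ?inE.
  - exact: measurable_itv.
  - exact: measurable_itv.
  - exact: subset_itv_oc_cc.
by rewrite lte_add_pinfty.
Qed.

Lemma finite_on_sub (A B : set TR) : finite_on nu A -> measurable B -> B `<=` A -> finite_on nu B.
Proof.
move=> [mA fA] mB BA; split => //; apply: le_lt_trans fA.
by apply: le_measure; rewrite ?inE.
Qed.

End Spectral.
End DensityUniqueness.

(** * Moments when the velocity is the derivative of the position *)

Section LinkedMoments.
Context {d : measure_display} {T : measurableType d} {R : realType}.
Local Notation leb := (@lebesgue_measure R).
Local Notation TR := (measurableTypeR R).
Variables (P : probability T R) (nu : @matrix_data R).
Hypothesis nu_spectral : spectral_measure nu.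
Local Notation nu11 := (diag_measure nu ord0).
Local Notation nu22 := (diag_measure nu ord_max).

(** The factor by which [phi |-> - phi'] acts on Fourier transforms. *)
Definition ddt_symbol (w : R) : R[i] := - ('i * w%:C).
Local Notation q := ddt_symbol.

Lemma cmeas_ddt_symbol : cmeasurable q.
Proof.
apply: cmeasN; apply: cmeasM; first exact: cmeas_cst.
by apply: cmeasR; exact: measurable_id.
Qed.

Lemma sqr_cmod_ddt_symbol w : cmod (q w) ^+ 2 = w ^+ 2.
Proof. by rewrite cmodN cmodM cmodi mul1r cmodR real_normK ?num_real. Qed.

(** The relation [nu22 = w^2 nu11] is stated by integrating nonnegative
    functions, so that it also covers sets of infinite mass. *)
Definition diag_linked :=
  forall f : TR -> \bar R, (forall w, (0 <= f w)%E) -> measurable_fun setT f ->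
    (\int[nu22]_w f w = \int[nu11]_w (f w * (w ^+ 2)%:E))%E.

(** What dx/dt = v says about the spectral measure. The entry [nu21] is
    determined by Hermitian symmetry. *)
Definition velocity_linked :=
  (forall E, finite_on nu E -> nu E ord0 ord_max = cint nu11 E (fun w : R => 'i * w%:C)) /\
  diag_linked.

Hypothesis link : velocity_linked.

Lemma linked_sqnorm (f : R -> R[i]) : cmeasurable f ->
  sqnormL2 nu22 f = sqnormL2 nu11 (fun w => q w * f w).
Proof.
move=> mf; rewrite /sqnormL2 link.2.
- apply: eq_integral => w _; rewrite -EFinM; congr EFin.
  by rewrite cmodM exprMn sqr_cmod_ddt_symbol mulrC.
- by move=> w; rewrite lee_fin sqr_ge0.
- by apply/measurable_EFinP; apply: measurable_funX; exact: (@cmeas_cmod _ TR).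
Qed.

Lemma linked_L2 (f : R -> R[i]) : cmeasurable f ->
  L2 nu22 f <-> L2 nu11 (fun w => q w * f w).
Proof.
move=> mf; rewrite /L2 linked_sqnorm//; split=> -[_ h]; split => //.
by apply: (@cmeasM _ TR) => //; exact: cmeas_ddt_symbol.
Qed.

Lemma linked_nu12 E : finite_on nu E ->
  nu E ord0 ord_max = cint nu11 E (fun w => 1 * conjc (q w)).
Proof.
move=> fE; rewrite link.1//; apply: eq_cint => w _.
by apply: complexP; rewrite !cReImE /=; ring.
Qed.

Lemma linked_nu22 E : finite_on nu E ->
  nu E ord_max ord_max = cint nu11 E (fun w => q w * conjc (q w)).
Proof.
move=> fE; have [[_ nuii _] _ _] := nu_spectral; rewrite nuii//.
under [X in cint _ _ X]funext do rewrite mulcJ sqr_cmod_ddt_symbol.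
rewrite (@cintR _ TR); congr (_%:C); congr fine.
have mE : measurable (E : set TR) := fE.1.
transitivity (\int[nu22]_w (\1_E w)%:E)%E; first by rewrite integral_indic// setIT.
rewrite link.2.
- rewrite [RHS]integral_mkcond; apply: eq_integral => w _; rewrite patchE indicE.
  by case: (_ \in _); rewrite ?mul1e ?mul0e.
- by move=> w; rewrite lee_fin.
- by apply/measurable_EFinP; exact: (@measurable_indic _ TR).
Qed.

Variable Z : 'I_2 -> set R -> T -> R[i].
Hypothesis rZ : random_measure P nu Z.
Variables X V : ((R -> R[i]) -> R[i]) -> T -> R[i].
Hypotheses (opX : operator_component P nu Z ord0 X) (opV : operator_component P nu Z ord_max V).

Let norm1 (f : R -> R[i]) : cmeasurable f -> sqnormL2 nu11 f = sqnormL2 nu11 (fun w => 1 * f w).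
Proof. by move=> _; congr sqnormL2; apply/funext => w; rewrite mul1r. Qed.

Lemma moment_XX g1 h1 g2 h2 : in_domain nu ord0 g1 h1 -> in_domain nu ord0 g2 h2 ->
  ip P (X g1) (X g2) = ip nu11 h1 h2.
Proof.
move=> d1 d2; have [L1 S1] := opX d1; have [L2' S2] := opX d2.
have [mm _ _] := nu_spectral; have [_ _ Lh1] := d1; have [_ _ Lh2] := d2.
exact: (@stoch_int_moment_diag _ _ _ P nu Z rZ).
Qed.

Lemma moment_XV g1 h1 g2 h2 : in_domain nu ord0 g1 h1 -> in_domain nu ord_max g2 h2 ->
  ip P (X g1) (V g2) = ip nu11 h1 (fun w => q w * h2 w).
Proof.
move=> d1 d2; have [L1 S1] := opX d1; have [L2' S2] := opV d2.
have [_ _ Lh1] := d1; have [_ _ Lh2] := d2.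
rewrite (@stoch_int_moment _ _ _ P nu Z rZ ord0 ord_max nu11 (fun=> 1) q (cmeas_cst _)
  cmeas_ddt_symbol linked_nu12 norm1 linked_sqnorm h1 h2)//.
by congr ip; apply/funext => w; rewrite mul1r.
Qed.

Lemma moment_VV g1 h1 g2 h2 : in_domain nu ord_max g1 h1 -> in_domain nu ord_max g2 h2 ->
  ip P (V g1) (V g2) = ip nu11 (fun w => q w * h1 w) (fun w => q w * h2 w).
Proof.
move=> d1 d2; have [L1 S1] := opV d1; have [L2' S2] := opV d2.
have [_ _ Lh1] := d1; have [_ _ Lh2] := d2.
exact: (@stoch_int_moment _ _ _ P nu Z rZ ord_max ord_max nu11 q q cmeas_ddt_symbol
  cmeas_ddt_symbol linked_nu22 linked_sqnorm linked_sqnorm).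
Qed.

Lemma moment_VX g1 h1 g2 h2 : in_domain nu ord_max g1 h1 -> in_domain nu ord0 g2 h2 ->
  ip P (V g1) (X g2) = ip nu11 (fun w => q w * h1 w) h2.
Proof.
move=> d1 d2; have [L1 S1] := opV d1; have [L2' S2] := opX d2.
have [_ _ Lh1] := d1; have [_ _ Lh2] := d2.
rewrite (ipC L2' L1) (moment_XV d2 d1) -ipC//.
by apply/linked_L2 => //; exact: Lh1.1.
Qed.

Section Response.
Variables (m lambda beta gamma : R) (K : R -> \bar R).
Hypotheses (Kv : kernel_valued K) (KI : kernel_I K) (KII : kernel_II K).
Local Notation a := (drift m lambda beta K).
Local Notation Psi := (Psi m lambda beta K).

(** The factor with which the left-hand side of the equation acts on the
    spectral measure of the position. *)
Definition response (w : R) : R[i] := q w * a w + gamma%:C.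

Lemma cmeas_response : cmeasurable response.
Proof.
apply: cmeasD; last exact: cmeas_cst.
by apply: cmeasM; [exact: cmeas_ddt_symbol|exact: cmeas_drift].
Qed.

Lemma L2_response phi : schwartz phi -> L2 nu22 (fun w => a w * fourier phi w) ->
  L2 nu11 (fun w => response w * fourier phi w).
Proof.
move=> S L; have /linked_L2 L' := L.
have := L2D (L' L.1) (L2Z (gamma%:C) (L2_fourier nu_spectral ord0 S)).
by apply: eq_L2 => w; rewrite /response; ring.
Qed.

(** With [Z_2 = q Z_1] the sum of the two stochastic integrals is a single one
    with respect to [Z_1]; here this is seen on the four moments of the
    expanded product. *)
Lemma lhs_moment phi1 phi2 : schwartz phi1 -> schwartz phi2 ->
  L2 nu22 (fun w => a w * fourier phi1 w) -> L2 nu22 (fun w => a w * fourier phi2 w) ->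
  ip P (fun x => V (distr (Psi phi1)) x + X (distr (fun t => gamma%:C * phi1 t)) x)
       (fun x => V (distr (Psi phi2)) x + X (distr (fun t => gamma%:C * phi2 t)) x) =
  ip nu11 (fun w => response w * fourier phi1 w) (fun w => response w * fourier phi2 w).
Proof.
move=> S1 S2 La1 La2.
have dV1 := in_domain_Psi Kv KI KII S1 La1.
have dV2 := in_domain_Psi Kv KI KII S2 La2.
have dX1 := in_domain_scale nu_spectral (gamma%:C) ord0 S1.
have dX2 := in_domain_scale nu_spectral (gamma%:C) ord0 S2.
have [LV1 _] := opV dV1; have [LV2 _] := opV dV2.
have [LX1 _] := opX dX1; have [LX2 _] := opX dX2.
have /linked_L2 qa1 := La1; have {}qa1 := qa1 La1.1.
have /linked_L2 qa2 := La2; have {}qa2 := qa2 La2.1.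
have [_ _ g1] := dX1; have [_ _ g2] := dX2.
have E phi : (fun w => response w * fourier phi w) =
    (fun w => q w * (a w * fourier phi w) + gamma%:C * fourier phi w).
  by apply/funext => w; rewrite /response; ring.
rewrite !E (ipDl LV1 LX1 (L2D LV2 LX2)) (ipDl qa1 g1 (L2D qa2 g2)).
rewrite (ipDr LV1 LV2 LX2) (ipDr LX1 LV2 LX2) (ipDr qa1 qa2 g2) (ipDr g1 qa2 g2).
by rewrite (moment_VV dV1 dV2) (moment_VX dV1 dX2) (moment_XV dX1 dV2) (moment_XX dX1 dX2).
Qed.

End Response.
End LinkedMoments.

(** * The response function and the noise density *)

Section SpectralDensity.
Context {R : realType}.
Local Notation leb := (@lebesgue_measure R).
Local Notation TR := (measurableTypeR R).
Variables (m lambda beta gamma kBT : R) (K : R -> \bar R).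
Hypotheses (lambda_gt0 : 0 < lambda) (beta_gt0 : 0 < beta) (kBT_gt0 : 0 < kBT).
Hypotheses (Kv : kernel_valued K) (KI : kernel_I K) (KII : kernel_II K).
Local Notation q := ddt_symbol.
Local Notation response := (response m lambda beta gamma K).
Local Notation r11 := (r11 m lambda beta gamma K).
Local Notation gle := (gle_density m lambda beta gamma kBT K).
Local Notation c := (kBT / (2 * pi)).

Definition noise (w : R) : R := 2 * lambda + beta * Khat K w.

Lemma c_gt0 : 0 < c :> R.
Proof. by rewrite divr_gt0// mulr_gt0// pi_gt0. Qed.

Lemma measurable_noise : measurable_fun setT noise.
Proof.
have [mk _] := cmeas_khat Kv KI.
by apply: measurable_funD => //; apply: measurable_funM => //; apply: measurable_funM.
Qed.

Lemma noise_gt0 w : w != 0 -> 0 < noise w.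
Proof.
move=> w0; have [_ _ _ _ /(_ w w0) k0] := KI.
by rewrite addr_gt0// mulr_gt0// mulr_gt0.
Qed.

(** [Psi] is the adjoint of the drift operator, hence the conjugate. *)
Lemma responseE w : response w = conjc ((gamma - m * w ^+ 2)%:C
  + 'i * w%:C * (lambda%:C + beta%:C * Kplus_hat K w)).
Proof.
by rewrite /response /ddt_symbol /drift; apply: complexP; rewrite !cReImE /=; ring.
Qed.

Lemma r11E w : r11 w = noise w / cmod (response w) ^+ 2.
Proof. by rewrite responseE cmodJ. Qed.

(** The imaginary part of the response is [-w (lambda + beta Kcos w)]. *)
Lemma response_gt0 w : w != 0 -> 0 < cmod (response w).
Proof.
move=> w0; apply: cmod_gt0; apply/eqP => /(congr1 (@complex.Im R)).
have [_ _ _ _ /(_ w w0) k0] := KI.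
rewrite responseE !cReImE /= => /eqP; rewrite oppr_eq0.
have -> : 0 + ((0 * w - 1 * 0) * (0 + (beta * - Ksin K w + 0 * Kcos K w)) + (0 * 0 + 1 * w) * (lambda + (beta * Kcos K w - 0 * - Ksin K w)))
  = w * (lambda + beta * Kcos K w) by ring.
by rewrite mulf_eq0 (negbTE w0) /= gt_eqF// addr_gt0// mulr_gt0.
Qed.

(** The density of [nu11], truncated at zero because [Kcos] is only known to
    be positive off the origin; the truncation changes at most the value
    there. *)
Definition rho (w : R) : R := Num.max 0 (c * r11 w).

Lemma rho_ge0 w : 0 <= rho w. Proof. by rewrite le_max lexx. Qed.

Lemma measurable_response : measurable_fun setT (fun w : R => cmod (response w) ^+ 2).
Proof. by apply: measurable_funX; apply: cmeas_cmod; exact: cmeas_response. Qed.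

Lemma r11_gt0 w : w != 0 -> 0 < r11 w.
Proof. by move=> w0; rewrite r11E divr_gt0 ?noise_gt0// exprn_gt0// response_gt0. Qed.

Lemma rhoE w : w != 0 -> rho w = c * r11 w.
Proof. by move=> w0; rewrite /rho max_r// mulr_ge0 ?(ltW c_gt0)// ltW// r11_gt0. Qed.

Lemma measurable_r11 : measurable_fun setT r11.
Proof.
have -> : r11 = (fun w => noise w * (cmod (response w) ^+ 2) `^ (- 1)).
  by apply/funext => w; rewrite r11E powR_inv1 ?sqr_ge0.
apply: measurable_funM; first exact: measurable_noise.
exact: (measurableT_comp (measurable_powR _) measurable_response).
Qed.

Lemma measurable_rho : measurable_fun setT rho.
Proof.
apply: measurable_maxr => //; apply: measurable_funM => //; exact: measurable_r11.
Qed.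

Lemma response_rho w : w != 0 -> cmod (response w) ^+ 2 * rho w = c * noise w.
Proof.
move=> w0; rewrite (rhoE w0) r11E mulrC -!mulrA mulVf ?mulr1//.
by rewrite gt_eqF// exprn_gt0// response_gt0.
Qed.

Let mul_max_div_le (s p n : R) : 0 <= s -> 0 <= p -> s * Num.max 0 (p * (n / s)) <= p * `|n|.
Proof.
move=> s0 p0; rewrite maxr_pMr// ge_max mulr0 mulr_ge0//=.
have [->|e] := eqVneq s 0; first by rewrite mul0r mulr_ge0.
have -> : s * (p * (n / s)) = p * n by field.
by rewrite ler_wpM2l// ler_norm.
Qed.

(** Unlike [response_rho], this bound also holds at the origin, where the sign
    of the noise density is not known. *)
Lemma response_rho_le w : cmod (response w) ^+ 2 * rho w <= c * `|noise w|.
Proof.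
rewrite /rho r11E; apply: mul_max_div_le; first exact: sqr_ge0.
exact: ltW c_gt0.
Qed.

Lemma noise_bound : exists D b : R, [/\ 0 <= D, 0 < b < 1 &
  forall w, `|noise w| <= D * (1 + `|w| `^ (- b))].
Proof.
have [D [b [D0 b01 bk _]]] := khat_bound Kv KI KII.
exists (2 * lambda + beta * (2 * D)), b.
have D1 : 0 <= 2 * lambda by rewrite mulr_ge0// ltW.
have D2 : 0 <= beta * (2 * D) by rewrite !mulr_ge0// ltW.
split => // [|w]; first exact: addr_ge0.
have W : 0 <= `|w| `^ (- b) by rewrite powR_ge0.
rewrite mulrDl; apply: (le_trans (ler_normD _ _)); apply: lerD.
  by rewrite ger0_norm// ler_peMr// lerDl.
rewrite !normrM (gtr0_norm beta_gt0) ger0_norm// -!mulrA ler_wpM2l ?(ltW beta_gt0)//.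
rewrite ler_wpM2l//; exact: (le_trans (Re_le_cmod (khat K w)) (bk w)).
Qed.

Lemma integrable_noise (psi : R -> R[i]) C : cmeasurable psi -> cintegrable leb setT psi ->
  (forall w, cmod (psi w) <= C) ->
  leb.-integrable setT (EFin \o (fun w => `|noise w| * cmod (psi w))).
Proof.
move=> mpsi ipsi bpsi; have [D [b [D0 b01 bn]]] := noise_bound.
have ib := integrable_singular_bound D0 b01 mpsi ipsi bpsi.
apply: (@le_integrable _ TR _ leb setT measurableT _ _ _ _ ib).
  apply/measurable_EFinP; apply: measurable_funM; last exact: cmeas_cmod.
  by apply: measurableT_comp => //; exact: measurable_noise.
move=> w _; rewrite /comp /abse lee_fin.
have c0 := cmod_ge0 (psi w); have n0 := normr_ge0 (noise w).
rewrite ger0_norm ?mulr_ge0// ger0_norm; last by rewrite !mulr_ge0// addr_ge0// powR_ge0.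
by rewrite ler_wpM2r.
Qed.

Lemma fourier_pair_bounded (phi1 phi2 : R -> R[i]) : schwartz phi1 -> schwartz phi2 ->
  [/\ cmeasurable (fun w => fourier phi1 w * conjc (fourier phi2 w)),
      cintegrable leb setT (fun w => fourier phi1 w * conjc (fourier phi2 w)) &
      exists C, forall w, cmod (fourier phi1 w * conjc (fourier phi2 w)) <= C].
Proof.
move=> S1 S2; have m1 := cmeas_schwartz S1; have m2 := cmeas_schwartz S2.
have f1 := cmeas_fourier m1; have f2 := cmeasJ (cmeas_fourier m2).
have b1 w := cmod_fourier_le w m1 (cintegrable_schwartz S1).
have b2 w := cmod_fourier_le w m2 (cintegrable_schwartz S2).
split; first exact: cmeasM.
  apply: (cintegrable_bounded_mul f1 b1 f2).
  exact: (@cintegrableJ _ TR _ leb setT _ (cintegrable_fourier S2)).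
exists (Rintegral leb setT (fun t => cmod (phi1 t)) * Rintegral leb setT (fun t => cmod (phi2 t))).
by move=> w; rewrite cmodM cmodJ ler_pM ?cmod_ge0.
Qed.

Lemma cintegrable_noise phi1 phi2 : schwartz phi1 -> schwartz phi2 ->
  cintegrable leb setT (fun w => (noise w)%:C * (fourier phi1 w * conjc (fourier phi2 w))).
Proof.
move=> S1 S2; have [mp ip [C bC]] := fourier_pair_bounded S1 S2.
have ib := integrable_noise mp ip bC.
apply: (@cmeas_cintegrable _ TR _ leb _ measurableT _ _ _ _ ib).
  by apply: cmeasM => //; apply: cmeasR; exact: measurable_noise.
by move=> w _; rewrite cmodM cmodR.
Qed.

Section DensityConsequences.
Variable mu : {measure set TR -> \bar R}.
Hypothesis muE : forall A : set TR, measurable A -> mu A = (\int[leb]_(w in A) (rho w)%:E)%E.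

(** The integrand is [|response|^2 rho |phi^|^2], bounded by a multiple of
    [|noise| |phi^|^2], which is integrable although the noise may be singular
    at the origin. *)
Lemma density_L2_response phi : schwartz phi -> L2 mu (fun w => response w * fourier phi w).
Proof.
move=> S; have [mp ip [C bC]] := fourier_pair_bounded S S.
have mf := cmeas_fourier (cmeas_schwartz S).
have mr : cmeasurable (fun w => response w * fourier phi w).
  by apply: cmeasM => //; exact: cmeas_response.
have mr2 : measurable_fun setT (fun w => cmod (response w * fourier phi w) ^+ 2).
  by apply: measurable_funX; exact: cmeas_cmod.
apply: integrable_L2 => //; apply/(@integrable_density _ TR R leb mu rho rho_ge0 measurable_rho muE) => //.
have ib := integrable_noise mp ip bC.
have ic : leb.-integrable setT (EFin \o (fun w => c * (`|noise w| * cmod (fourier phi w * conjc (fourier phi w))))).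
  by under [X in integrable _ _ X]funext do rewrite /= EFinM; exact: integrableZl.
apply: (@le_integrable _ TR _ leb setT measurableT _ _ _ _ ic).
  by apply/measurable_EFinP; apply: measurable_funM => //; exact: measurable_rho.
move=> w _; rewrite /comp /abse lee_fin.
have r0 := rho_ge0 w; have s0 := sqr_ge0 (cmod (fourier phi w)).
rewrite ger0_norm; last by rewrite mulr_ge0// sqr_ge0.
rewrite (ger0_norm (mulr_ge0 (ltW c_gt0) (mulr_ge0 (normr_ge0 _) (cmod_ge0 _)))).
rewrite [X in _ <= _ * (_ * X)]cmodM cmodJ -expr2 cmodM exprMn mulrAC mulrA.
by rewrite ler_wpM2r// response_rho_le.
Qed.

Lemma density_ip_response phi1 phi2 : schwartz phi1 -> schwartz phi2 ->
  ip mu (fun w => response w * fourier phi1 w) (fun w => response w * fourier phi2 w) =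
  c%:C * cint leb setT (fun w => (noise w)%:C * (fourier phi1 w * conjc (fourier phi2 w))).
Proof.
move=> S1 S2; have L1 := density_L2_response S1; have L2' := density_L2_response S2.
have mr : cmeasurable response by exact: cmeas_response.
have m1 := cmeas_fourier (cmeas_schwartz S1); have m2 := cmeas_fourier (cmeas_schwartz S2).
rewrite /ip (@cint_density _ TR R leb mu rho rho_ge0 measurable_rho muE _ (ip_integrable L1 L2')).
rewrite -(@cintZl _ TR _ leb _ measurableT _ _ (cintegrable_noise S1 S2)).
apply: eq_cint_neq0.
- apply: cmeasM; last by apply: cmeasR; exact: measurable_rho.
  by apply: cmeasM; [exact: cmeasM|apply: cmeasJ; exact: cmeasM].
- apply: cmeasM; first exact: cmeas_cst.
  apply: cmeasM; first by apply: cmeasR; exact: measurable_noise.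
  by apply: cmeasM => //; exact: cmeasJ.
move=> w w0; rewrite conjcM.
have -> : response w * fourier phi1 w * (conjc (response w) * conjc (fourier phi2 w)) * (rho w)%:C =
   (response w * conjc (response w)) * (rho w)%:C * (fourier phi1 w * conjc (fourier phi2 w)) by ring.
by rewrite mulcJ -rmorphM response_rho// rmorphM -mulrA.
Qed.

End DensityConsequences.

End SpectralDensity.

(** * Matrix densities of linked spectral measures *)

Section DensityForm.
Context {R : realType}.
Local Notation leb := (@lebesgue_measure R).
Local Notation TR := (measurableTypeR R).

Lemma cintegrable_mkcond (mu : {measure set TR -> \bar R}) (E : set TR) (f : R -> R[i]) :
  measurable E -> cintegrable mu E f <-> cintegrable mu setT (fun w => f w * (\1_E w : R)%:C).
Proof.
move=> mE; have h (g : R -> R) : (mu.-integrable E (EFin \o g)) <->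
    mu.-integrable setT (EFin \o (fun w => g w * \1_E w)).
  have -> : EFin \o (fun w => g w * \1_E w) = (EFin \o g) \_ E.
    by apply/funext => w; rewrite /= patchE indicE; case: ifP => _; rewrite ?mulr1 ?mulr0.
  exact: (iff_trans (iff_refl _) (integrable_mkcond _ mE)).
have e1 : (fun w : TR => (complex.Re (f w * (\1_E w : R)%:C))%:E) = EFin \o (fun w => complex.Re (f w) * \1_E w).
  by apply/funext => w; rewrite /= !cReImE /= mulr0 subr0.
have e2 : (fun w : TR => (complex.Im (f w * (\1_E w : R)%:C))%:E) = EFin \o (fun w => complex.Im (f w) * \1_E w).
  by apply/funext => w; rewrite /= !cReImE /= mulr0 add0r.
rewrite /cintegrable e1 e2; split=> -[h1 h2]; split.
- exact: (h _).1 h1.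
- exact: (h _).1 h2.
- exact: (h (fun w => complex.Re (f w))).2 h1.
- exact: (h (fun w => complex.Im (f w))).2 h2.
Qed.

Lemma eq_integral_off_point (mu : {measure set TR -> \bar R}) (a : R) (A : set TR) (f g : R -> R) :
  mu `<< leb -> measurable A -> measurable_fun setT f ->
  measurable_fun setT g -> (forall w, w != a -> f w = g w) ->
  (\int[mu]_(w in A) (f w)%:E = \int[mu]_(w in A) (g w)%:E)%E.
Proof.
move=> ac mA mf mg fg; apply: ae_eq_integral => //.
- by apply/measurable_EFinP; exact: measurable_funTS.
- by apply/measurable_EFinP; exact: measurable_funTS.
exists [set a]; split; first exact: measurable_set1.
  exact: null_itv_endpoint.
move=> w /= /not_implyP[_ h]; apply: contrapT => /eqP w0; apply: h.
by rewrite fg.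
Qed.

Lemma eq_integral_neq0 (A : set TR) (f g : R -> R) : measurable A -> measurable_fun setT f ->
  measurable_fun setT g -> (forall w, w != 0 -> f w = g w) ->
  (\int[leb]_(w in A) (f w)%:E = \int[leb]_(w in A) (g w)%:E)%E.
Proof. by apply: eq_integral_off_point => N; exact. Qed.

Lemma cintegrable_neq0 (f g : R -> R[i]) : cmeasurable f -> cmeasurable g ->
  (forall w, w != 0 -> f w = g w) -> cintegrable leb setT f -> cintegrable leb setT g.
Proof.
move=> [mf mf'] [mg mg'] fg.
have h (u v : R -> R) : measurable_fun setT u -> measurable_fun setT v ->
    (forall w, w != 0 -> u w = v w) -> leb.-integrable setT (EFin \o u) -> leb.-integrable setT (EFin \o v).
  move=> mu mv uv /integrableP[_ iu]; apply/integrableP; split; first exact/measurable_EFinP.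
  have e : (\int[leb]_x `|(EFin \o u) x| = \int[leb]_x `|(EFin \o v) x|)%E.
    apply: (@eq_integral_neq0 _ (fun w => `|u w|) (fun w => `|v w|)) => //.
    - exact: measurableT_comp.
    - exact: measurableT_comp.
    - by move=> w w0; rewrite uv.
  by rewrite -e.
by move=> [i1 i2]; split; [apply: h i1|apply: h i2] => // w w0; rewrite fg.
Qed.

Variables (m lambda beta gamma kBT : R) (K : R -> \bar R).
Hypotheses (lambda_gt0 : 0 < lambda) (beta_gt0 : 0 < beta) (kBT_gt0 : 0 < kBT).
Hypotheses (Kv : kernel_valued K) (KI : kernel_I K) (KII : kernel_II K).
Local Notation q := ddt_symbol.
Local Notation r11 := (r11 m lambda beta gamma K).
Local Notation gle := (gle_density m lambda beta gamma kBT K).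
Local Notation rho := (rho m lambda beta gamma kBT K).
Local Notation c := (kBT / (2 * pi)).
Variable nu : @matrix_data R.
Hypothesis nu_spectral : spectral_measure nu.
Local Notation nu11 := (diag_measure nu ord0).
Local Notation nu22 := (diag_measure nu ord_max).

Let mrho : measurable_fun [set: TR] rho.
Proof. exact: measurable_rho. Qed.

Let mcr11 : measurable_fun setT (fun w : R => c * r11 w).
Proof. by apply: measurable_funM => //; exact: measurable_r11. Qed.

Let rhoN0 w : w != 0 -> rho w = c * r11 w.
Proof. exact: rhoE. Qed.

Lemma gle00 w : gle w ord0 ord0 = 1 * (c * r11 w)%:C.
Proof. by rewrite !mxE /= mul1r -rmorphM. Qed.

Lemma gle01 w : gle w ord0 ord_max = 'i * w%:C * (c * r11 w)%:C.
Proof. by rewrite !mxE /= /r12 !rmorphM; ring. Qed.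

Lemma gle10 w : gle w ord_max ord0 = conjc ('i * w%:C) * (c * r11 w)%:C.
Proof. by rewrite !mxE /= /r12; apply: complexP; rewrite !cReImE /=; ring. Qed.

Lemma gle11 w : gle w ord_max ord_max = (w ^+ 2)%:C * (c * r11 w)%:C.
Proof. by rewrite !mxE /= /r22 !rmorphM; ring. Qed.

Section Entries.
Hypothesis nu11E : forall A : set TR, measurable A -> nu11 A = (\int[leb]_(w in A) (rho w)%:E)%E.
Variables (E : set TR) (p : R -> R[i]).
Hypotheses (mE : measurable E) (mp : cmeasurable p).

Let mpE : cmeasurable (fun w : TR => p w * (\1_E w : R)%:C).
Proof. by apply: (@cmeasM _ TR) => //; apply: cmeasR; exact: measurable_indic. Qed.

Let mpr : cmeasurable (fun w : TR => p w * (\1_E w : R)%:C * (rho w)%:C).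
Proof. by apply: (@cmeasM _ TR) => //; apply: cmeasR; exact: mrho. Qed.

Let mpc : cmeasurable (fun w : TR => p w * (c * r11 w)%:C * (\1_E w : R)%:C).
Proof.
apply: (@cmeasM _ TR); last by apply: cmeasR; exact: measurable_indic.
by apply: (@cmeasM _ TR) => //; apply: cmeasR; exact: mcr11.
Qed.

Let rw w : w != 0 -> p w * (\1_E w : R)%:C * (rho w)%:C = p w * (c * r11 w)%:C * (\1_E w : R)%:C.
Proof. by move=> w0; rewrite rhoN0//; ring. Qed.

(** On a set of finite mass the entries are integrals against [nu11], whose
    density is then inserted; it differs from [c r11] at most at the
    origin. *)
Lemma entry_integrable :
  cintegrable nu11 E p <-> cintegrable leb E (fun w => p w * (c * r11 w)%:C).
Proof.
have r0 := rho_ge0 m lambda beta gamma kBT K.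
split.
  move/(cintegrable_mkcond _ _ mE)/(@cintegrable_density _ TR R leb nu11 rho r0 mrho nu11E _ mpE).
  by move/(cintegrable_neq0 mpr mpc rw)/(cintegrable_mkcond _ _ mE).
move/(cintegrable_mkcond _ _ mE) => h; apply/(cintegrable_mkcond _ _ mE).
apply/(@cintegrable_density _ TR R leb nu11 rho r0 mrho nu11E _ mpE).
by apply: (cintegrable_neq0 mpc mpr) h => w w0; rewrite rw.
Qed.

Lemma entry_cint : cintegrable nu11 E p ->
  cint nu11 E p = cint leb E (fun w => p w * (c * r11 w)%:C).
Proof.
have r0 := rho_ge0 m lambda beta gamma kBT K.
move/(cintegrable_mkcond _ _ mE) => h; rewrite cint_mkcond [RHS]cint_mkcond.
by rewrite (@cint_density _ TR R leb nu11 rho r0 mrho nu11E _ h); exact: eq_cint_neq0.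
Qed.

End Entries.

Let mw2 : measurable_fun [set: TR] (fun w : TR => w ^+ 2).
Proof. exact: measurable_funX. Qed.

Lemma has_density_linked : has_density nu gle ->
  velocity_linked nu /\
  forall A : set TR, measurable A -> nu11 A = (\int[leb]_(w in A) (rho w)%:E)%E.
Proof.
move=> [hd ho].
have r0 := rho_ge0 m lambda beta gamma kBT K.
have nu11E A : measurable A -> nu11 A = (\int[leb]_(w in A) (rho w)%:E)%E.
  move=> mA; rewrite hd//; under eq_integral do rewrite gle00 mul1r.
  by apply: eq_integral_neq0 => // w w0; rewrite rhoN0.
have p2 (w : TR) : 0 <= w ^+ 2 * rho w by rewrite mulr_ge0// sqr_ge0.
have m2 : measurable_fun setT (fun w : TR => w ^+ 2 * rho w) by exact: measurable_funM.
have nu22E A : measurable A -> nu22 A = (\int[leb]_(w in A) (w ^+ 2 * rho w)%:E)%E.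
  move=> mA; rewrite hd//.
  under eq_integral do rewrite gle11 -rmorphM /=.
  apply: eq_integral_neq0 => //; first exact: measurable_funM.
  by move=> w w0; rewrite rhoN0.
split => //; split.
  move=> E fE; have mE : measurable (E : set TR) := fE.1.
  have [+ ->] := ho E ord0 ord_max fE.
  have mi : cmeasurable (fun w : R => 'i * w%:C).
    by apply: cmeasM; [exact: cmeas_cst|apply: cmeasR; exact: measurable_id].
  have e : (fun w => gle w ord0 ord_max) = (fun w => 'i * w%:C * (c * r11 w)%:C).
    by apply/funext => w; exact: gle01.
  by rewrite e => /(entry_integrable nu11E mE mi) h; rewrite (entry_cint nu11E mE mi h).
move=> f f0 mf; rewrite (ge0_integral_density p2 m2 nu22E f0 mf).
have f2 w : (0 <= f w * (w ^+ 2)%:E)%E by rewrite mule_ge0// lee_fin sqr_ge0.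
have mf2 : measurable_fun setT (fun w : TR => f w * (w ^+ 2)%:E)%E.
  by apply: emeasurable_funM => //; exact/measurable_EFinP.
rewrite (@ge0_integral_density _ TR R leb nu11 rho r0 mrho nu11E _ f2 mf2).
by apply: eq_integral => w _; rewrite EFinM muleA.
Qed.

Section Weight.
Hypothesis link2 : diag_linked nu.

(** The integrals of 1 and of [w^2] are the masses of [nu11] and [nu22]. *)
Lemma weight_fin E : finite_on nu E -> nu11.-integrable E (EFin \o (fun w : TR => 1 + w ^+ 2)).
Proof.
move=> fE; have mE : measurable (E : set TR) := fE.1.
apply/integrableP; split.
  by apply/measurable_EFinP; apply: measurable_funTS; exact: measurable_funD.
have e (w : TR) : `|(EFin \o (fun w : TR => (1 + w ^+ 2)%R)) w|%E = (1%:E + (w ^+ 2)%:E)%E.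
  by rewrite /= ger0_norm// addr_ge0// sqr_ge0.
under eq_integral do rewrite e.
rewrite ge0_integralD//; last 2 first.
- by move=> w _; rewrite lee_fin sqr_ge0.
- by apply/measurable_EFinP; exact: measurable_funTS.
rewrite integral_cst// mul1e lte_add_pinfty//; first exact: diag_finite.
have -> : (\int[nu11]_(w in E) (w ^+ 2)%:E = nu22 E)%E.
  transitivity (\int[nu22]_w (\1_E w)%:E)%E; last by rewrite integral_indic// setIT.
  rewrite link2.
  - rewrite integral_mkcond; apply: eq_integral => w _; rewrite patchE indicE.
    by case: (_ \in _); rewrite ?mul1e ?mul0e.
  - by move=> w; rewrite lee_fin.
  - by apply/measurable_EFinP; exact: (@measurable_indic _ TR).
exact: diag_finite.
Qed.

Lemma weight_cintegrable E (p : R -> R[i]) : finite_on nu E -> cmeasurable p ->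
  (forall w, cmod (p w) <= 1 + w ^+ 2) -> cintegrable nu11 E p.
Proof.
move=> fE mp bp; have mE : measurable (E : set TR) := fE.1.
exact: (@cmeas_cintegrable _ TR _ nu11 _ mE _ _ mp (fun w _ => bp w) (weight_fin fE)).
Qed.

End Weight.

Lemma norm_le_weight (w : R) : `|w| <= 1 + w ^+ 2.
Proof.
rewrite -(real_normK (num_real w)); have := sqr_ge0 (`|w| - 1); have := normr_ge0 w.
by move: `|w| => x; nra.
Qed.

Section Converse.
Hypothesis link : velocity_linked nu.
Hypothesis nu11E : forall A : set TR, measurable A -> nu11 A = (\int[leb]_(w in A) (rho w)%:E)%E.

(** Each entry is the integral of [1], [iw], its conjugate or [w^2] against
    [nu11]; the lower left one by Hermitian symmetry. *)
Lemma linked_has_density : has_density nu gle.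
Proof.
have r0 := rho_ge0 m lambda beta gamma kBT K.
have mi : cmeasurable (fun w : R => 'i * w%:C).
  by apply: cmeasM; [exact: cmeas_cst|apply: cmeasR; exact: measurable_id].
split.
  move=> E i mE'; have mE : measurable (E : set TR) := mE'.
  case: (ord2P i) => ->.
    rewrite nu11E//; under [RHS]eq_integral do rewrite gle00 mul1r.
    by apply: eq_integral_neq0 => // w w0; rewrite rhoN0.
  under [RHS]eq_integral do rewrite gle11 -rmorphM /=.
  transitivity (\int[nu22]_w (\1_E w)%:E)%E; first by rewrite integral_indic// setIT.
  have m1 : measurable_fun setT (fun w : TR => (\1_E w)%:E : \bar R).
    by apply/measurable_EFinP; exact: (@measurable_indic _ TR).
  have i0 (w : TR) : (0 <= (\1_E w)%:E :> \bar R)%E by rewrite lee_fin.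
  rewrite link.2//.
  rewrite (@ge0_integral_density _ TR R leb nu11 rho r0 mrho nu11E); last 2 first.
  - by move=> w; rewrite mule_ge0// lee_fin sqr_ge0.
  - by apply: emeasurable_funM => //; exact/measurable_EFinP.
  transitivity (\int[leb]_(w in E) (w ^+ 2 * rho w)%:E)%E.
    rewrite [RHS]integral_mkcond; apply: eq_integral => w _; rewrite patchE indicE.
    by case: (_ \in _); rewrite ?mul1e ?mul0e.
  apply: eq_integral_neq0 => //; [exact: measurable_funM|exact: measurable_funM|].
  by move=> w w0; rewrite rhoN0.
move=> E i j fE; have mE : measurable (E : set TR) := fE.1.
have [[herm nuii _] _ _] := nu_spectral.
have key p : (forall w, cmod (p w) <= 1 + w ^+ 2) -> cmeasurable p ->
    nu E i j = cint nu11 E p -> (forall w, gle w i j = p w * (c * r11 w)%:C) ->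
    cintegrable leb E (fun w => gle w i j) /\ nu E i j = cint leb E (fun w => gle w i j).
  move=> bp mp -> e; have -> : (fun w => gle w i j) = (fun w => p w * (c * r11 w)%:C).
    exact/funext.
  have ip := weight_cintegrable link.2 fE mp bp.
  by split; [apply/(entry_integrable nu11E mE mp)|exact: (entry_cint nu11E mE mp)].
case: (ord2P i) => ei; case: (ord2P j) => ej; rewrite ei ej in key *.
- apply: (key (fun=> 1)) gle00.
  + by move=> w; rewrite cmod1 lerDl sqr_ge0.
  + exact: cmeas_cst.
  + rewrite nuii// -[X in cint _ _ X]/(fun=> (1 : R)%:C) (@cintR _ TR) Rintegral_cst ?mul1r//.
- apply: (key (fun w => 'i * w%:C)) gle01 => //; last exact: link.1.
  by move=> w; rewrite cmodM cmodi mul1r cmodR norm_le_weight.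
- apply: (key (fun w => conjc ('i * w%:C))) gle10.
  + by move=> w; rewrite cmodJ cmodM cmodi mul1r cmodR norm_le_weight.
  + exact: cmeasJ.
  + have bi (w : R) : cmod ('i * w%:C) <= 1 + w ^+ 2.
      by rewrite cmodM cmodi mul1r cmodR norm_le_weight.
    rewrite (@cintJ _ TR _ nu11 E mE _ (weight_cintegrable link.2 fE mi bi)) -(link.1 _ fE).
    have [h _] := herm E fE.
    by rewrite -[in LHS]h !mxE.
- apply: (key (fun w => (w ^+ 2)%:C)) gle11.
  + by move=> w; rewrite cmodR ger0_norm ?sqr_ge0// lerDr.
  + by apply: cmeasR; exact: mw2.
  + rewrite (linked_nu22 nu_spectral link fE); apply: eq_cint => w _.
    by rewrite mulcJ sqr_cmod_ddt_symbol.
Qed.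

End Converse.
End DensityForm.

(** * From the density to the solution *)

Section SolutionOfDensity.
Context {d : measure_display} {T : measurableType d} {R : realType}.
Local Notation leb := (@lebesgue_measure R).
Local Notation TR := (measurableTypeR R).
Variables (P : probability T R) (m lambda beta gamma kBT : R) (K : R -> \bar R).
Variables (F W : (R -> R[i]) -> T -> R[i]) (nu : @matrix_data R).
Variables (X V : ((R -> R[i]) -> R[i]) -> T -> R[i]).
Hypotheses (lambda_gt0 : 0 < lambda) (beta_gt0 : 0 < beta) (kBT_gt0 : 0 < kBT).
Hypotheses (Kv : kernel_valued K) (KI : kernel_I K) (KII : kernel_II K).
Hypotheses (W_noise : white_noise P W) (F_noise : kernel_noise P K F).
Hypotheses (nu_spectral : spectral_measure nu) (Phi : stationary_operator P nu X V).
Local Notation nu11 := (diag_measure nu ord0).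
Local Notation nu22 := (diag_measure nu ord_max).
Local Notation q := ddt_symbol.
Local Notation a := (drift m lambda beta K).
Local Notation response := (response m lambda beta gamma K).
Local Notation rho := (rho m lambda beta gamma kBT K).
Local Notation noise := (noise lambda beta K).
Local Notation c := (kBT / (2 * pi)).

Lemma noise_moment phi1 phi2 : schwartz phi1 -> schwartz phi2 ->
  kBT%:C * (beta%:C * second_moment P (F phi1) (F phi2)
            + (2 * lambda)%:C * second_moment P (W phi1) (W phi2)) =
  c%:C * cint leb setT (fun w => (noise w)%:C * (fourier phi1 w * conjc (fourier phi2 w))).
Proof.
move=> S1 S2; have [_ _ hW] := W_noise; have [_ _ hF] := F_noise.
have [mp ip _] := fourier_pair_bounded S1 S2.
have iN := cintegrable_noise lambda_gt0 beta_gt0 Kv KI KII S1 S2.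
rewrite hW// hF//.
set psi := (fun w => fourier phi1 w * conjc (fourier phi2 w)) in mp ip iN *.
have iZ := @cintegrableZl _ TR _ leb _ measurableT ((2 * lambda)%:C) _ ip.
have iK : cintegrable leb setT (fun w => (2 * Kcos K w)%:C * fourier phi1 w * conjc (fourier phi2 w)).
  have := @cintegrableZl _ TR _ leb _ measurableT ((beta^-1)%:C) _ (@cintegrableB _ TR _ leb _ measurableT _ _ iN iZ).
  apply: (@eq_cintegrable _ TR _ _ _ measurableT) => w _.
  have -> : 2 * Kcos K w = beta^-1 * (noise w - 2 * lambda).
    by rewrite /noise addrAC subrr add0r mulKf ?gt_eqF.
  by rewrite /psi !(rmorphM, rmorphB) /=; ring.
have E : (fun w => (noise w)%:C * psi w) = (fun w => (2 * lambda)%:C * psi w +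
    beta%:C * ((2 * Kcos K w)%:C * fourier phi1 w * conjc (fourier phi2 w))).
  by apply/funext => w; rewrite /noise /Khat /psi !(rmorphD, rmorphM) /=; ring.
rewrite E (@cintD _ TR _ leb _ measurableT _ _ iZ (@cintegrableZl _ TR _ leb _ measurableT _ _ iK)).
rewrite (@cintZl _ TR _ leb _ measurableT _ _ ip) (@cintZl _ TR _ leb _ measurableT _ _ iK).
rewrite !rmorphM /=; ring.
Qed.

(** The identities for the velocity follow from the isometry. The equation is
    the identity [|response|^2 rho = c noise], integrated; and [w drift = i
    (response - gamma)] shows that [V] is defined at [Psi phi]. *)
Lemma density_solution : has_density nu (gle_density m lambda beta gamma kBT K) ->
  weak_stationary_solution P m lambda beta gamma kBT K F W nu X V.
Proof.
move=> hd; have [link nu11E] := has_density_linked lambda_gt0 beta_gt0 kBT_gt0 Kv KI hd.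
have [Z [rZ opX opV]] := Phi.
have La phi : schwartz phi -> L2 nu22 (fun w => a w * fourier phi w).
  move=> S; have mf := cmeas_fourier (cmeas_schwartz S).
  apply/(linked_L2 link).
    by apply: cmeasM => //; exact: cmeas_drift.
  have L1 := density_L2_response lambda_gt0 beta_gt0 kBT_gt0 Kv KI KII nu11E S.
  have := L2B L1 (L2Z (gamma%:C) (L2_fourier nu_spectral ord0 S)).
  by apply: eq_L2 => w; rewrite /response; ring.
split.
- move=> phi S; have dV := in_domain_Psi Kv KI KII S (La phi S).
  by split; [exists (fun w => a w * fourier phi w)|exact: (opV _ _ dV).1.2].
- move=> phi1 phi2 S1 S2.
  have dX1 := in_domain_opp_deriv nu_spectral ord0 S1.
  have dX2 := in_domain_opp_deriv nu_spectral ord0 S2.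
  have dV1 := in_domain_schwartz nu_spectral ord_max S1.
  have dV2 := in_domain_schwartz nu_spectral ord_max S2.
  have eXX := moment_XX nu_spectral rZ opX dX1 dX2.
  have eVV := moment_VV nu_spectral link rZ opV dV1 dV2.
  have eXV := moment_XV link rZ opX opV dX1 dV2.
  by split; [exact: etrans eXX (esym eVV)|exact: etrans eVV (esym eXV)].
- move=> phi1 phi2 S1 S2; rewrite noise_moment//.
  transitivity (ip nu11 (fun w => response w * fourier phi1 w) (fun w => response w * fourier phi2 w)).
    exact: (lhs_moment nu_spectral link rZ opX opV gamma Kv KI KII S1 S2 (La _ S1) (La _ S2)).
  exact: (density_ip_response lambda_gt0 beta_gt0 kBT_gt0 Kv KI KII nu11E S1 S2).
Qed.

End SolutionOfDensity.

(** * From the solution to the density *)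

Section DensityOfSolution.
Context {R : realType}.
Local Notation leb := (@lebesgue_measure R).
Local Notation TR := (measurableTypeR R).

Lemma eq_integral_oc (mu : {measure set TR -> \bar R}) (s t : R) (f : R -> R) :
  mu `<< leb -> measurable_fun setT f ->
  (\int[mu]_(w in `[s, t]) (f w)%:E = \int[mu]_(w in `]s, t]) (f w)%:E)%E.
Proof.
move=> ac mf; pose g (D : set TR) (w : R) : R := f w * \1_D w.
have mg (D : set TR) : measurable D -> measurable_fun setT (g D).
  by move=> mD; apply: measurable_funM => //; exact: (@measurable_indic _ TR).
have gE (D : set TR) : (\int[mu]_(w in D) (f w)%:E = \int[mu]_w (g D w)%:E)%E.
  rewrite integral_mkcond; apply: eq_integral => w _; rewrite patchE /g indicE.
  by case: (_ \in _); rewrite ?mulr1 ?mulr0.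
rewrite !gE; apply: (@eq_integral_off_point _ mu s) => //.
- by apply: mg; exact: measurable_itv.
- by apply: mg; exact: measurable_itv.
move=> w ws; rewrite /g !indicE; congr (_ * (nat_of_bool _)%:R).
by apply/idP/idP; rewrite !inE /= !in_itv /= => /andP[h ->]; rewrite andbT ?ltW// lt_neqAle eq_sym ws.
Qed.

Lemma cint_oc (mu : {measure set TR -> \bar R}) (s t : R) (f : R -> R[i]) :
  mu `<< leb -> cmeasurable f -> cint mu `[s, t] f = cint mu `]s, t] f.
Proof.
by move=> ac [m1 m2]; rewrite /cint /Rintegral !eq_integral_oc.
Qed.

Lemma cint_indicator_sub (mu : {measure set TR -> \bar R}) (A B : set TR) (f : R -> R[i]) :
  A `<=` B -> cint mu B (fun w => (\1_A w : R)%:C * f w) = cint mu A f.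
Proof.
move=> AB; rewrite cint_mkcond [RHS]cint_mkcond; apply: eq_cint => w _.
rewrite mulrAC [RHS]mulrC -rmorphM; congr (_%:C * _); rewrite !indicE.
have [wA|] := boolP (w \in A); last by rewrite mul0r.
by rewrite mem_set ?mulr1//; apply: AB; rewrite inE in wA.
Qed.

Lemma Re_sum I (r : seq I) (f : I -> R[i]) :
  complex.Re (\sum_(k <- r) f k) = \sum_(k <- r) complex.Re (f k).
Proof. by elim: r => [|k r IH]; rewrite ?big_nil// !big_cons cReD IH. Qed.

Lemma Im_sum I (r : seq I) (f : I -> R[i]) :
  complex.Im (\sum_(k <- r) f k) = \sum_(k <- r) complex.Im (f k).
Proof. by elim: r => [|k r IH]; rewrite ?big_nil// !big_cons cImD IH. Qed.

Section Spectral.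
Variable nu : @matrix_data R.
Hypothesis nu_spectral : spectral_measure nu.
Local Notation nu11 := (diag_measure nu ord0).
Local Notation nu22 := (diag_measure nu ord_max).
Local Notation q := ddt_symbol.

Lemma sigma_additive_entry i j : sigma_additive_on (finite_on nu) (fun E => nu E i j).
Proof.
have [[_ _ sa] _ _] := nu_spectral; move=> E mE tE fE.
have [h1 h2] := sa E i j mE tE fE; apply/ccvgP; split.
  by under eq_fun do rewrite Re_sum.
by under eq_fun do rewrite Im_sum.
Qed.

Lemma gauss_weight_integrable i (f : R -> R[i]) : cmeasurable f ->
  (forall w, cmod (f w) <= 1 + w ^+ 2) ->
  (diag_measure nu i).-integrable setT (EFin \o (fun w => gauss (16^-1) w * cmod (f w))).
Proof.
move=> mf bf; have ig := integrable_gauss_poly nu_spectral i.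
apply: (@le_integrable _ TR _ _ _ measurableT _ _ _ _ ig).
  apply/measurable_EFinP; apply: measurable_funM; first exact: measurable_gauss.
  exact: (@cmeas_cmod _ TR).
move=> w _; rewrite /comp /abse lee_fin.
have g0 := gauss_ge0 (16^-1) w; have c0 := cmod_ge0 (f w).
rewrite ger0_norm ?mulr_ge0// ger0_norm; last by rewrite mulr_ge0// (le_trans c0).
by rewrite ler_wpM2l.
Qed.

Lemma cmeas_sqr : cmeasurable (fun w : R => (w ^+ 2)%:C).
Proof. by apply: cmeasR; exact: measurable_funX. Qed.

Lemma cmod_sqr_le (w : R) : cmod ((w ^+ 2)%:C : R[i]) <= 1 + w ^+ 2.
Proof. by rewrite cmodR ger0_norm ?sqr_ge0// lerDr. Qed.

Lemma cmod_one_le (w : R) : cmod (1 : R[i]) <= 1 + w ^+ 2.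
Proof. by rewrite cmod1 lerDl sqr_ge0. Qed.

(** With the windows as test functions both sides converge to the integrals
    over the interval, of [w^2] against [nu11] and of 1 against [nu22]. *)
Lemma diag_linked_of_tests :
  (forall phi, schwartz phi ->
     ip nu11 (fun w => q w * fourier phi w) (fun w => q w * fourier phi w) =
     ip nu22 (fourier phi) (fourier phi)) -> diag_linked nu.
Proof.
move=> tst; have ac i := diag_dominated nu_spectral i.
have m2 : measurable_fun setT (fun w : TR => w ^+ 2) by exact: measurable_funX.
(* the reference density on the side of [nu22] is 1 *)
have fin1 (s t : R) : (\int[nu22]_(w in `]s, t]) (1 : R)%:E < +oo)%E.
  rewrite integral_cst//.
  by rewrite mul1e; apply: diag_finite; exact: finite_on_itv.
have cE (s t : R) : cint nu11 `]s, t] (fun w => (w ^+ 2)%:C) = cint nu22 `]s, t] (fun=> 1).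
  rewrite -(cint_oc s t (ac ord0) cmeas_sqr) -(cint_oc s t (ac ord_max) (cmeas_cst 1)).
  have c1 := win_test s t 1 (ac ord0) cmeas_sqr (gauss_weight_integrable ord0 cmeas_sqr cmod_sqr_le).
  have c2 := win_test s t 1 (ac ord_max) (cmeas_cst 1) (gauss_weight_integrable ord_max (cmeas_cst 1) cmod_one_le).
  apply: (ccvg_unique c1); move: c2; congr ccvg; apply/funext => n.
  have [phi [S e]] := win_fourier s t n; have := tst phi S; rewrite e => h.
  transitivity (ip nu22 (fun w => (win s t n w)%:C) (fun w => (win s t n w)%:C)).
    by apply: eq_cint => w _; rewrite mulr1 mulcJ cmodR real_normK ?num_real.
  rewrite -h; apply: eq_cint => w _.
  rewrite mulcJ -rmorphM cmodM exprMn sqr_cmod_ddt_symbol cmodR real_normK ?num_real//.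
  by rewrite mulrC.
have intw (s t : R) : (\int[nu11]_(w in `]s, t]) (w ^+ 2)%:E < +oo)%E.
  have mi : measurable (`]s, t]%classic : set TR) by exact: measurable_itv.
  apply: (@le_lt_trans _ _ (\int[nu11]_(w in `]s, t]) ((`|s| + `|t|) ^+ 2)%:E)%E).
    apply: ge0_le_integral => //.
    - by move=> w _; rewrite lee_fin sqr_ge0.
    - by apply/measurable_EFinP; exact: measurable_funTS.
    - move=> w; rewrite /= in_itv /= => /andP[sw wt]; rewrite lee_fin.
      by rewrite itv_sqr_le// (ltW sw).
  rewrite integral_cst//; apply: lte_mul_pinfty; rewrite ?lee_fin ?sqr_ge0//.
  by apply: diag_finite; exact: finite_on_itv.
have ge0fin (mu : {measure set TR -> \bar R}) (D : set TR) (f : R -> R) : (forall w, 0 <= f w) ->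
    (\int[mu]_(w in D) (f w)%:E < +oo)%E -> (\int[mu]_(w in D) (f w)%:E)%E \is a fin_num.
  by move=> f0 h; rewrite ge0_fin_numE//; apply: integral_ge0 => w _; rewrite lee_fin.
have eI (s t : R) : s < t ->
    (\int[nu22]_(w in `]s, t]) (1 : R)%:E = \int[nu11]_(w in `]s, t]) (w ^+ 2)%:E)%E.
  move=> st.
  rewrite -(fineK (ge0fin _ _ _ (fun _ => ler01) (fin1 s t))) -(fineK (ge0fin _ _ _ (@sqr_ge0 R) (intw s t))).
  congr EFin; exact: (esym (congr1 (@complex.Re R) (cE s t))).
move=> f f0 mf; transitivity (\int[nu22]_w (f w * (1 : R)%:E))%E.
  by apply: eq_integral => w _; rewrite mule1.
exact: (@weighted_eq R nu22 nu11 (fun=> 1) (fun w => w ^+ 2) (fun _ => ler01) (measurable_cst _)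
  (fun w => sqr_ge0 w) m2 eI fin1 f f0 mf).
Qed.

End Spectral.
End DensityOfSolution.

Section CrossEntry.
Context {d : measure_display} {T : measurableType d} {R : realType}.
Local Notation leb := (@lebesgue_measure R).
Local Notation TR := (measurableTypeR R).
Variables (P : probability T R) (nu : @matrix_data R).
Hypothesis nu_spectral : spectral_measure nu.
Local Notation nu11 := (diag_measure nu ord0).
Local Notation nu22 := (diag_measure nu ord_max).
Local Notation q := ddt_symbol.
Variable Z : 'I_2 -> set R -> T -> R[i].
Hypothesis rZ : random_measure P nu Z.

Lemma stoch_int_sqnormB i h1 h2 Y1 Y2 :
  L2 (diag_measure nu i) h1 -> L2 (diag_measure nu i) h2 -> L2 P Y1 -> L2 P Y2 ->
  is_stoch_int P nu Z i h1 Y1 -> is_stoch_int P nu Z i h2 Y2 ->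
  sqnorm P (fun x => Y1 x - Y2 x) = sqnorm (diag_measure nu i) (fun w => h1 w - h2 w).
Proof.
move=> L1 L2' LY1 LY2 s1 s2; have [mm _ _] := nu_spectral.
have iso := stoch_int_moment_diag rZ mm.
apply: (congr1 (@complex.Re R) (_ : (_)%:C = (_)%:C)).
rewrite (sqnormB LY1 LY2) (sqnormB L1 L2').
rewrite (iso _ _ _ _ _ L1 L1 LY1 LY1 s1 s1) (iso _ _ _ _ _ L1 L2' LY1 LY2 s1 s2).
by rewrite (iso _ _ _ _ _ L2' L1 LY2 LY1 s2 s1) (iso _ _ _ _ _ L2' L2' LY2 LY2 s2 s2).
Qed.

(** The square of the difference, expanded, consists of terms that converge by
    [win_test], and the limits cancel. *)
Lemma win_indicator_L2 i (s t : R) :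
  sqnorm (diag_measure nu i) (fun w => (\1_(`]s, t]%classic : set TR) w : R)%:C - (win s t n w)%:C)
    @[n --> \oo] --> (0 : R).
Proof.
set mu := diag_measure nu i; set A : set TR := `]s, t]%classic.
have fA : finite_on nu A by exact: finite_on_itv.
have LA := L2_indicator i fA.
have ac := diag_dominated nu_spectral i.
have Lw n : L2 mu (fun w => (win s t n w)%:C).
  by have [phi [S e]] := win_fourier s t n; rewrite -e; exact: L2_fourier.
have mA : cmeasurable (fun w : R => (\1_A w : R)%:C) by have [] := LA.
have bA (w : R) : cmod ((\1_A w : R)%:C : R[i]) <= 1 + w ^+ 2.
  by rewrite cmodR indicE ger0_norm// (@le_trans _ _ 1) ?lerDl ?sqr_ge0//; case: (_ \in _).
have c1 := win_test s t 0 ac mA (gauss_weight_integrable nu_spectral i mA bA).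
have c2 := win_test s t 1 ac (cmeas_cst 1) (gauss_weight_integrable nu_spectral i (cmeas_cst 1) cmod_one_le).
have L : cint mu setT (fun w : TR => (\1_A w : R)%:C) = cint mu `[s, t] (fun w : TR => (\1_A w : R)%:C).
  have sub : A `<=` (`[s, t]%classic : set TR) by exact: subset_itv_oc_cc.
  have h1 := @cint_indicator_sub R mu A _ (fun=> 1) sub.
  have h2 := @cint_indicator_sub R mu A setT (fun=> 1) (@subsetT _ _).
  have eA : (fun w : TR => (\1_A w : R)%:C * 1) = (fun w : TR => (\1_A w : R)%:C).
    by apply/funext => w; rewrite mulr1.
  by move: h1 h2; rewrite eA => -> ->.
have L1 : cint mu setT (fun w : TR => (\1_A w : R)%:C) = cint mu `[s, t] (fun=> 1).
  rewrite (cint_oc s t ac (cmeas_cst 1)) -(@cint_indicator_sub R mu A setT (fun=> 1) (@subsetT _ _)).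
  by apply: eq_cint => w _; rewrite mulr1.
rewrite -L in c1; rewrite -L1 in c2.
set l := cint mu setT (fun w : TR => (\1_A w : R)%:C) in c1 c2.
have cc : ccvg (fun n => (sqnorm mu (fun w => (\1_A w : R)%:C - (win s t n w)%:C))%:C) 0.
  have e n : (sqnorm mu (fun w => (\1_A w : R)%:C - (win s t n w)%:C))%:C =
      l - cint mu setT (fun w => (win s t n w ^+ 1)%:C * (\1_A w : R)%:C)
      - cint mu setT (fun w => (win s t n w ^+ 1)%:C * (\1_A w : R)%:C)
      + cint mu setT (fun w => (win s t n w ^+ 2)%:C * 1).
    rewrite (sqnormB LA (Lw n)).
    have cr (x : R) : conjc x%:C = x%:C :> R[i] by rewrite /= oppr0.
    congr (_ - _ - _ + _); apply: eq_cint => w _; rewrite cr ?expr1 -?rmorphM //=.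
    - by congr (_%:C); rewrite indicE; case: (_ \in _); rewrite ?mul1r ?mul0r.
    - by rewrite mulrC.
    - by rewrite mulr1 expr2.
  under eq_fun do rewrite e.
  have cN z_ z : ccvg z_ z -> ccvg (fun n => - z_ n) (- z) :> Prop.
    by move=> h; have := ccvgM (ccvg_cst (-1)) h; under eq_fun do rewrite mulN1r; rewrite mulN1r.
  have -> : 0 = l - l - l + l :> R[i] by rewrite subrr sub0r addNr.
  by apply: ccvgD => //; apply: ccvgD; [apply: ccvgD; [exact: ccvg_cst|exact: cN]|exact: cN].
by have /ccvgP[] := cc.
Qed.

Variables X V : ((R -> R[i]) -> R[i]) -> T -> R[i].
Hypotheses (opX : operator_component P nu Z ord0 X) (opV : operator_component P nu Z ord_max V).
Hypothesis dX_eq_V : forall phi, schwartz phi ->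
  second_moment P (X (distr (opp_deriv phi))) (X (distr (opp_deriv phi))) =
    second_moment P (V (distr phi)) (V (distr phi)) /\
  second_moment P (V (distr phi)) (V (distr phi)) =
    second_moment P (X (distr (opp_deriv phi))) (V (distr phi)).

Lemma diag_linked_solution : diag_linked nu.
Proof.
apply: (diag_linked_of_tests nu_spectral) => phi S; have [e _] := dX_eq_V S.
have dX := in_domain_opp_deriv nu_spectral ord0 S.
have dV := in_domain_schwartz nu_spectral ord_max S.
have [mm _ _] := nu_spectral.
have [LV sV] := opV dV; have [_ _ Lf] := dV.
transitivity (second_moment P (X (distr (opp_deriv phi))) (X (distr (opp_deriv phi)))).
  exact: (esym (moment_XX nu_spectral rZ opX dX dX)).
rewrite e; exact: (stoch_int_moment_diag rZ mm Lf Lf LV LV sV sV).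
Qed.

(** Expanding E|<X,-phi'> - <V,phi>|^2 yields four moments, which cancel
    because they are all equal. *)
Lemma velocity_is_derivative phi : schwartz phi ->
  sqnorm P (fun x => X (distr (opp_deriv phi)) x - V (distr phi) x) = 0.
Proof.
move=> S; have [e1 e2] := dX_eq_V S.
have [LX _] := opX (in_domain_opp_deriv nu_spectral ord0 S).
have [LV _] := opV (in_domain_schwartz nu_spectral ord_max S).
apply: (congr1 (@complex.Re R) (_ : (_)%:C = 0%:C)).
rewrite (sqnormB LX LV) (ipC LX LV).
move: e1 e2; rewrite -/(ip P _ _) => e1 e2.
have eXX : ip P (X (distr (opp_deriv phi))) (X (distr (opp_deriv phi))) = ip P (V (distr phi)) (V (distr phi)) := e1.
have eXV : ip P (X (distr (opp_deriv phi))) (V (distr phi)) = ip P (V (distr phi)) (V (distr phi)) := esym e2.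
rewrite eXX eXV ip_self /= oppr0 subrr sub0r addNr; by [].
Qed.

(** Both sides are limits of the moments of [Z_1(]s, t])] with the velocity,
    taken at windows of the same interval: computed from [Z_2], they tend to
    [nu12(]s, t])]; computed from the derivative of the position, they tend to
    the integral. *)
Lemma cross_itv (s t : R) :
  nu `]s, t]%classic ord0 ord_max = cint nu11 `]s, t] (fun w : R => 'i * w%:C).
Proof.
set A : set TR := `]s, t]%classic.
have fA : finite_on nu A by exact: finite_on_itv.
have mA : measurable A := fA.1.
have [mm _ _] := nu_spectral.
have LZ1 := rZ.1 ord0 A fA; have LZ2 := rZ.1 ord_max A fA.
have sZ1 := stoch_int_measure P Z ord0 fA; have sZ2 := stoch_int_measure P Z ord_max fA.
have LA1 := L2_indicator ord0 fA; have LA2 := L2_indicator ord_max fA.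
pose phi n := projT1 (cid (win_fourier s t n)).
have Sphi n : schwartz (phi n) by rewrite /phi; case: cid => f [].
have Fphi n : fourier (phi n) = (fun w => (win s t n w)%:C) by rewrite /phi; case: cid => f [].
have dX n := in_domain_opp_deriv nu_spectral ord0 (Sphi n).
have dV n := in_domain_schwartz nu_spectral ord_max (Sphi n).
pose Xn n := X (distr (opp_deriv (phi n))); pose Vn n := V (distr (phi n)).
have LX n : L2 P (Xn n) := (opX (dX n)).1.
have LV n : L2 P (Vn n) := (opV (dV n)).1.
have l1 : ccvg (fun n => ip P (Z ord0 A) (Vn n)) (ip P (Z ord0 A) (Z ord_max A)).
  apply: (@ip_cvg _ _ _ P (fun=> Z ord0 A) Vn) => //.
    rewrite (_ : sqnorm P (fun x => Z ord0 A x - Z ord0 A x) = 0); first exact: cvg_cst.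
    by rewrite /sqnorm; under eq_Rintegral do rewrite subrr cmod0 expr0n; rewrite Rintegral_cst// mul0r.
  have e n : sqnorm P (fun x => Z ord_max A x - Vn n x) =
      sqnorm nu22 (fun w => (\1_A w : R)%:C - (win s t n w)%:C).
    have [_ _ Lf] := dV n.
    rewrite (stoch_int_sqnormB LA2 Lf LZ2 (LV n) sZ2 (opV (dV n)).2).
    by rewrite Fphi.
  under eq_fun do rewrite e; exact: win_indicator_L2.
have e12 : ip P (Z ord0 A) (Z ord_max A) = nu A ord0 ord_max.
  by rewrite -[in RHS](setIid A); exact: rZ.2.
rewrite e12 in l1; apply: (ccvg_unique l1).
have mi : cmeasurable (fun w : R => 'i * w%:C).
  by apply: cmeasM; [exact: cmeas_cst|apply: cmeasR; exact: measurable_id].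
have miA : cmeasurable (fun w : TR => (\1_A w : R)%:C * ('i * w%:C)).
  by apply: (@cmeasM _ TR) => //; exact: LA1.1.
have bi (w : R) : cmod ((\1_A w : R)%:C * ('i * w%:C)) <= 1 + w ^+ 2.
  rewrite !cmodM cmodi mul1r !cmodR (le_trans _ (norm_le_weight w))// ler_piMl//.
  by rewrite indicE ger0_norm//; case: (_ \in _).
have ac := diag_dominated nu_spectral ord0.
have l2 := win_test s t 0 ac miA (gauss_weight_integrable nu_spectral ord0 miA bi).
rewrite cint_indicator_sub in l2; last exact: subset_itv_oc_cc.
have e n : ip P (Z ord0 A) (Vn n) =
   cint nu11 setT (fun w => (win s t n w ^+ 1)%:C * ((\1_A w : R)%:C * ('i * w%:C))).
  transitivity (ip P (Z ord0 A) (Xn n)).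
    apply/esym/eqP; rewrite -subr_eq0 -(ipBr LZ1 (LX n) (LV n)); apply/eqP/cmod_eq0/eqP.
    rewrite eq_le cmod_ge0 andbT (le_trans (cauchy_schwarz LZ1 (L2B (LX n) (LV n))))//.
    by rewrite (velocity_is_derivative (Sphi n)) mulr0 sqrtr0.
  have [_ _ Lf] := dX n.
  rewrite (stoch_int_moment_diag rZ mm LA1 Lf LZ1 (LX n) sZ1 (opX (dX n)).2).
  apply: eq_cint => w _; rewrite Fphi expr1.
  by apply: complexP; rewrite !cReImE /=; ring.
by under eq_fun do rewrite e.
Qed.

Lemma linked_solution : velocity_linked nu.
Proof.
have link2 := diag_linked_solution; split => // E fE.
have mi : cmeasurable (fun w : R => 'i * w%:C).
  by apply: cmeasM; [exact: cmeas_cst|apply: cmeasR; exact: measurable_id].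
have bi (w : R) : cmod ('i * w%:C) <= 1 + w ^+ 2.
  by rewrite cmodM cmodi mul1r cmodR norm_le_weight.
apply: (@sigma_additive_unique R (finite_on nu) _ _ _ (fun E => nu E ord0 ord_max)
  (fun E => cint nu11 E (fun w : R => 'i * w%:C)) _ _ _ E fE).
- by move=> A [].
- by move=> A B fA mB BA; exact: finite_on_sub fA mB BA.
- by move=> s t; exact: finite_on_itv.
- exact: sigma_additive_entry.
- move=> F mF tF fF; apply: cint_bigcup => //.
  exact: (weight_cintegrable link2 fF mi bi).
- by move=> s t _; exact: cross_itv.
Qed.

End CrossEntry.

Section PositionDensity.
Context {R : realType}.
Local Notation leb := (@lebesgue_measure R).
Local Notation TR := (measurableTypeR R).
Variables (m lambda beta gamma kBT : R) (K : R -> \bar R).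
Hypotheses (lambda_gt0 : 0 < lambda) (beta_gt0 : 0 < beta) (kBT_gt0 : 0 < kBT).
Hypotheses (Kv : kernel_valued K) (KI : kernel_I K) (KII : kernel_II K).
Variable nu : @matrix_data R.
Hypothesis nu_spectral : spectral_measure nu.
Local Notation nu11 := (diag_measure nu ord0).
Local Notation nu22 := (diag_measure nu ord_max).
Local Notation a := (drift m lambda beta K).
Local Notation response := (response m lambda beta gamma K).
Local Notation rho := (rho m lambda beta gamma kBT K).
Local Notation r11 := (r11 m lambda beta gamma K).
Local Notation noise := (noise lambda beta K).
Local Notation c := (kBT / (2 * pi)).

(** The witness [h] is almost everywhere the product of the drift and the
    transform of [phi], by uniqueness of the transform, and [nu22] does not
    charge null sets. *)
Lemma in_domain_drift_L2 phi h : schwartz phi ->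
  in_domain nu ord_max (distr (Psi m lambda beta K phi)) h ->
  L2 nu22 (fun w => a w * fourier phi w).
Proof.
move=> S [_ fh [mh nh]].
have fa := Psi_fourier_is_fun m lambda beta Kv KI KII S.
have [ma _] := fa; split => //.
have e := fourier_is_fun_unique fh fa.
apply: le_lt_trans nh; rewrite le_eqVlt; apply/orP; left; apply/eqP/esym.
apply: ae_eq_integral => //.
- by apply/measurable_EFinP; apply: measurable_funX; exact: (@cmeas_cmod _ TR).
- by apply/measurable_EFinP; apply: measurable_funX; exact: (@cmeas_cmod _ TR).
have /null_content_dominatesP ac := diag_dominated nu_spectral ord_max.
have [N [mN N0 hN]] := e; exists N; split => //; first exact: ac.
move=> w /= /not_implyP[_ hw]; apply: hN => /= ew; apply: hw.
by rewrite ew.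
Qed.

(** Tested with a Gaussian Schwartz function, whose transform is a Gaussian as
    well. *)
Lemma gauss_response_integrable :
  (forall phi, schwartz phi -> L2 nu11 (fun w => response w * fourier phi w)) ->
  nu11.-integrable setT
    (EFin \o (fun w => gauss (16^-1) w * cmod ((cmod (response w) ^+ 2)%:C : R[i]))).
Proof.
move=> hL; have c8 : 0 < (8 : R) by rewrite ltr0n.
(* the transform of [gauss 8] is a multiple of [gauss (1/32)], and the square
   of that is [gauss (1/16)] *)
have L := L2_integrable (hL _ (schwartz_gauss c8)).
set I := Rintegral leb setT (gauss (8 : R)).
have I0 : I != 0.
  apply/eqP => I0; have := Rintegral_normal_pdf 0 (4^-1 : R).
  have -> : normal_pdf 0 (4^-1) = (fun x : R => normal_peak (4^-1) * gauss 8 x).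
    apply/funext => x; rewrite normal_pdf_gauss ?invr_neq0 ?pnatr_eq0//.
    have e8 : (2 * (4^-1) ^+ 2)^-1 = 8 :> R by field.
    by rewrite e8 /gauss sub0r sqrrN.
  rewrite RintegralZl//; last exact: integrable_gauss.
  by rewrite -/I I0 mulr0 => /eqP; rewrite eq_sym oner_eq0.
have := @integrableZl _ TR R nu11 setT measurableT (I ^- 2) _ L.
congr (integrable _ _ _); apply/funext => w; rewrite /comp -EFinM; congr EFin.
rewrite fourier_gauss// -/I cmodM !cmodR normrM.
have -> : gauss ((4 * 8)^-1) w = gauss (32^-1) w by rewrite -natrM.
have -> : gauss (16^-1) w = gauss (32^-1) w ^+ 2.
  by apply/esym; rewrite /gauss expr2 -expRD; congr expR; field.
rewrite (ger0_norm (gauss_ge0 _ _)) (ger0_norm (sqr_ge0 _)) !exprMn real_normK ?num_real//.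
by rewrite [X in _ * X]mulrCA mulKf ?expf_neq0// mulrC.
Qed.

(** Testing with windows shows that [|response|^2 nu11] has the density [c
    noise]; one then divides by [|response|^2], which vanishes at most at the
    origin. *)
Lemma response_density :
  (forall phi, schwartz phi -> L2 nu11 (fun w => response w * fourier phi w)) ->
  (forall phi, schwartz phi ->
     ip nu11 (fun w => response w * fourier phi w) (fun w => response w * fourier phi w) =
     c%:C * cint leb setT (fun w => (noise w)%:C * (fourier phi w * conjc (fourier phi w)))) ->
  forall E : set TR, measurable E -> nu11 E = (\int[leb]_(w in E) (rho w)%:E)%E.
Proof.
move=> hL tst.
have ac := diag_dominated nu_spectral ord0.
have acl : leb `<< leb by move=> N; exact.
have c0 : 0 <= c by apply: ltW; exact: c_gt0.
have mr2 : measurable_fun [set: TR] (fun w : TR => cmod (response w) ^+ 2).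
  by apply: measurable_response.
have mN : measurable_fun [set: TR] noise by exact: measurable_noise.
pose g (w : R) : R := Num.max 0 (c * noise w).
have g0 w : 0 <= g w by rewrite le_max lexx.
have mcN : measurable_fun [set: TR] (fun w : TR => c * noise w) by exact: measurable_funM.
have mg : measurable_fun [set: TR] g by apply: measurable_maxr.
have gE w : w != 0 -> g w = c * noise w.
  by move=> w0; rewrite /g max_r// mulr_ge0// ltW// noise_gt0.
have mR2 : cmeasurable (fun w : R => (cmod (response w) ^+ 2)%:C) by exact: cmeasR.
have mNC : cmeasurable (fun w : R => (noise w)%:C) by exact: cmeasR.
have iG := gauss_response_integrable hL.
have mga : cmeasurable (fun w : R => (gauss (16^-1) w)%:C) by apply: cmeasR; exact: measurable_gauss.
have iga : cintegrable leb setT (fun w : R => (gauss (16^-1) w)%:C).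
  by apply: (@cintegrableR _ TR); apply: integrable_gauss; rewrite invr_gt0 ltr0n.
have bga (w : R) : cmod ((gauss (16^-1) w)%:C : R[i]) <= 1.
  by rewrite cmodR ger0_norm ?gauss_ge0// gauss_le1// invr_ge0.
have iN : leb.-integrable setT (EFin \o (fun w => gauss (16^-1) w * cmod ((noise w)%:C : R[i]))).
  have := integrable_noise lambda_gt0 beta_gt0 Kv KI KII mga iga bga.
  congr (integrable _ _ _); apply/funext => w; rewrite /comp !cmodR mulrC.
  by rewrite (ger0_norm (gauss_ge0 _ _)).
have cE (s t : R) : cint nu11 `[s, t] (fun w => (cmod (response w) ^+ 2)%:C) =
    c%:C * cint leb `[s, t] (fun w => (noise w)%:C).
  have l1 := win_test s t 1 ac mR2 iG.
  have l2 := ccvgM (ccvg_cst (c%:C)) (win_test s t 1 acl mNC iN).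
  apply: (ccvg_unique l1); move: l2; congr ccvg; apply/funext => n.
  have [phi [S e]] := win_fourier s t n; have := tst phi S; rewrite e => h.
  transitivity (c%:C * cint leb setT (fun w => (noise w)%:C * ((win s t n w)%:C * conjc (win s t n w)%:C))).
    congr (_ * _); apply: eq_cint => w _.
    by rewrite mulcJ cmodR real_normK ?num_real// mulrC.
  rewrite -h; apply: eq_cint => w _.
  by rewrite mulcJ -rmorphM cmodM exprMn cmodR real_normK ?num_real// mulrC.
have mI (s t : R) : measurable (`[s, t]%classic : set TR) by exact: measurable_itv.
have mIo (s t : R) : measurable (`]s, t]%classic : set TR) by exact: measurable_itv.
have gbound (s t : R) : exists B : R, forall w, (`[s, t]%classic : set TR) w -> 1 <= B * gauss (16^-1) w.
  set M : R := `|s| + `|t|; exists (expR (16^-1 * M ^+ 2)) => w.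
  rewrite /= in_itv /= => /itv_sqr_le; rewrite -/M => wM.
  by rewrite /gauss -expRD -[leLHS]expR0 ler_expR; lra.
have loc (mu : {measure set TR -> \bar R}) (f : R -> R) (s t : R) :
    measurable_fun [set: TR] f ->
    mu.-integrable setT (EFin \o (fun w => gauss (16^-1) w * cmod ((f w)%:C : R[i]))) ->
    mu.-integrable `[s, t] (EFin \o f).
  move=> mf ig; have [B bB] := gbound s t.
  have iB := @integrableZl _ TR R mu setT measurableT B _ ig.
  have {}iB := integrableS measurableT (mI s t) (@subsetT _ _) iB.
  apply: (@le_integrable _ TR R mu _ (mI s t) _ _ _ _ iB).
    by apply/measurable_EFinP; exact: measurable_funTS.
  move=> w sw; rewrite /comp -EFinM /abse lee_fin cmodR.
  have b1 := bB w sw; rewrite [leRHS]ger0_norm; last first.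
    by rewrite mulrA mulr_ge0// (le_trans ler01).
  by rewrite mulrA ler_peMl.
have iR s t := loc nu11 _ s t mr2 iG.
have iNl s t := loc leb _ s t mN iN.
have fin1 (s t : R) : (\int[nu11]_(w in `]s, t]) (cmod (response w) ^+ 2)%:E < +oo)%E.
  rewrite -(eq_integral_oc s t ac mr2); have /integrableP[_] := iR s t.
  apply: le_lt_trans; apply: ge0_le_integral => //.
  - by move=> w _; rewrite lee_fin sqr_ge0.
  - by apply/measurable_EFinP; exact: measurable_funTS.
  - by apply: measurableT_comp => //; exact: (measurable_int _ (iR s t)).
  - by move=> w _; exact: lee_abs.
have eI (s t : R) : s < t ->
    (\int[nu11]_(w in `]s, t]) (cmod (response w) ^+ 2)%:E = \int[leb]_(w in `]s, t]) (g w)%:E)%E.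
  move=> st; rewrite -(eq_integral_oc s t ac mr2) -(eq_integral_oc s t acl mg).
  rewrite (eq_integral_neq0 (mI s t) mg mcN gE).
  have f1 := integrable_fin_num (mI s t) (iR s t).
  have icN : leb.-integrable `[s, t] (EFin \o (fun w => c * noise w)).
    by under [X in integrable _ _ X]funext do rewrite /= EFinM; apply: integrableZl => //; exact: iNl.
  have f2 := integrable_fin_num (mI s t) icN.
  rewrite -[LHS](fineK f1) -[RHS](fineK f2); congr EFin.
  transitivity (c * Rintegral leb `[s, t] noise); last by rewrite -RintegralZl//; exact: iNl.
  by have := cE s t; rewrite !(@cintR _ TR) -rmorphM => /(congr1 (@complex.Re R)).
have eR w : w != 0 -> rho w = c * r11 w by move=> w0; exact: rhoE.
have key := @weighted_eq R nu11 leb (fun w => cmod (response w) ^+ 2) g (fun w => sqr_ge0 _) mr2 g0 mg eI fin1.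
move=> E mE.
(* the reciprocal is written as a real power, a function known to be
   measurable; its value at the origin does not matter *)
have mri : measurable_fun [set: TR] (fun w : TR => \1_E w * (cmod (response w) ^+ 2) `^ (- 1)).
  apply: measurable_funM; first exact: (@measurable_indic _ TR).
  exact: (measurableT_comp (measurable_powR _) mr2).
have r0 (w : TR) : (0 <= (\1_E w * (cmod (response w) ^+ 2) `^ (- 1))%:E)%E.
  by rewrite lee_fin mulr_ge0// powR_ge0.
have mri' : measurable_fun [set: TR] (fun w : TR => (\1_E w * (cmod (response w) ^+ 2) `^ (- 1))%:E).
  exact/measurable_EFinP.
have := key _ r0 mri'.
under eq_integral do rewrite -EFinM.
under [in X in _ = X -> _]eq_integral do rewrite -EFinM.
have mIE : measurable_fun [set: TR] (fun w : TR => \1_E w : R) by exact: (@measurable_indic _ TR).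
rewrite (@eq_integral_off_point _ nu11 0 setT _ (fun w : TR => \1_E w) ac) //; first last.
- move=> w w0; rewrite powR_inv1 ?sqr_ge0// -mulrA mulVf ?mulr1//.
  by rewrite gt_eqF// exprn_gt0// response_gt0.
- by apply: measurable_funM => //.
rewrite integral_indic// setIT => ->.
rewrite (@eq_integral_off_point _ leb 0 setT _ (fun w : TR => \1_E w * rho w) acl) //; first last.
- move=> w w0; rewrite powR_inv1 ?sqr_ge0// gE// (eR w w0) r11E.
  by ring.
- by apply: measurable_funM => //; exact: measurable_rho.
- exact: measurable_funM.
rewrite [RHS]integral_mkcond; apply: eq_integral => w _; rewrite patchE indicE.
by case: (_ \in _); rewrite ?mul1r ?mul0r.
Qed.

End PositionDensity.

Theorem theorem3p1 (R : realType) (d : measure_display) (T : measurableType d)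
    (P : probability T R) (m lambda beta gamma kBT : R) (K : R -> \bar R)
    (F W : (R -> R[i]) -> T -> R[i])
    (nu : @matrix_data R) (X V : ((R -> R[i]) -> R[i]) -> T -> R[i])
    (m_gt0 : 0 < m) (lambda_gt0 : 0 < lambda) (beta_gt0 : 0 < beta)
    (gamma_gt0 : 0 < gamma) (kBT_gt0 : 0 < kBT)
    (K_valued : kernel_valued K) (K_I : kernel_I K) (K_II : kernel_II K)
    (W_noise : white_noise P W) (F_noise : kernel_noise P K F)
    (WF_uncorrelated : uncorrelated P W F)
    (nu_spectral : spectral_measure nu)
    (Phi_stationary : stationary_operator P nu X V) :
  weak_stationary_solution P m lambda beta gamma kBT K F W nu X V
  <-> has_density nu (gle_density m lambda beta gamma kBT K).
Proof.
split; last exact: density_solution.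
move=> [dom vel gle]; have [Z [rZ opX opV]] := Phi_stationary.
have link := linked_solution nu_spectral rZ opX opV (fun phi S => vel phi phi S S).
have La phi : schwartz phi ->
    L2 (diag_measure nu ord_max) (fun w => drift m lambda beta K w * fourier phi w).
  by move=> S; have [[h dh] _] := dom phi S; exact: (in_domain_drift_L2 K_valued K_I K_II nu_spectral S dh).
apply: linked_has_density => //; apply: response_density => // phi S.
  exact: (L2_response nu_spectral link gamma S (La phi S)).
rewrite -(lhs_moment nu_spectral link rZ opX opV gamma K_valued K_I K_II S S (La _ S) (La _ S)).
by apply: etrans (gle phi phi S S) _; exact: noise_moment.
Qed.
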